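(* Let $z_1,z_2\in\bigwedge_\infty^0$ (and $\theta_1,\theta_2\in\bigwedge_\infty^1$) be such that $|(z_1)_B|>|(z_2)_B|>|(z_1)_B-(z_2)_B|>0$. Then $$\big((z_1,\theta_1),(z_2,\theta_2);\mathbf 0,(1,\mathbf 0),(1,\mathbf 0),(1,\mathbf 0)\big)$$ $$=\big((z_2,\theta_2);\mathbf 0,(1,\mathbf 0),(1,\mathbf 0)\big)\;{}_1\infty_0\;\big((z_1-z_2-\theta_1\theta_2,\theta_1-\theta_2);\mathbf 0,(1,\mathbf 0),(1,\mathbf 0)\big)$$ $$=\big((z_1,\theta_1);\mathbf 0,(1,\mathbf 0),(1,\mathbf 0)\big)\;{}_2\infty_0\;\big((z_2,\theta_2);\mathbf 0,(1,\mathbf 0),(1,\mathbf 0)\big).$$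
   Context: Grassmann algebra: $\bigwedge_\infty$ is the complex Grassmann algebra on anticommuting generators $\zeta_1,\zeta_2,\ldots$, with even/odd parts $\bigwedge_\infty^0,\bigwedge_\infty^1$, body/soul decomposition $a=a_B+a_S$, ${}^\times$ = invertible elements ($a_B\ne0$); points are written $(z,\theta)$ ($z$ even, $\theta$ odd). DeWitt open sets: $\{a:a_B\in V\}$, $V\subset\mathbb C$ open; $\mathcal B_0^r=\{a:|a_B|<r\}$, $\bar{\mathcal B}_0^r$ closed analogue. A function $H(w,\rho)=(f+\rho\xi,\psi+\rho g)$ ($f,g$ even, $\xi,\psi$ odd, analytic in $w$, Taylor extended from the body) is superconformal if $\xi=g\psi$, $g^2=f'+\psi\psi'$, $g+\rho\psi'\not\equiv0$. For $j\in\mathbb Z$: $L_j(x,\varphi)=-(x^{j+1}\partial_x+\frac{j+1}2\varphi x^j\partial_\varphi)$, $G_{j-1/2}(x,\varphi)=-x^j(\partial_\varphi-\varphi\partial_x)$; $b^{\mp2L_0}$ sends $c\varphi^mx^n$ to $c\,b^{\pm(2n+m)}\varphi^mx^n$. For sequences $(A,M)=\{(A_j,M_{j-1/2})\}_{j\ge1}$ (even, odd) and $a\in(\bigwedge_\infty^0)^\times$: $\tilde E(A,M)=\exp(-\sum_{j\ge1}(A_jL_j+M_{j-1/2}G_{j-1/2}))\cdot(x,\varphi)$, $\hat E(a,A,M)=\exp(-\sum_{j\ge1}(A_jL_j+M_{j-1/2}G_{j-1/2}))\cdot a^{-2L_0}\cdot(x,\varphi)$. $\mathcal H$ = set of $(A,M)$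 with $\tilde E(A,M)$ absolutely convergent near $0$; $\mathbf0$ = zero sequences. $I(w,\rho)=(1/w,i\rho/w)$, $s_{(z,\theta)}(w,\rho)=(w-z-\rho\theta,\rho-\theta)$. A supersphere is a super-Riemann surface over $\bigwedge_\infty$ (charts onto DeWitt open subsets of $\bigwedge_\infty$, superconformal transitions) whose body is a connected compact genus-zero Riemann surface; with $1+n$ tubes: one negatively oriented puncture $p_0$, $n$ positively oriented ordered punctures, distinct bodies, superconformal local coordinates vanishing at the punctures, considered up to superconformal isomorphisms matching punctures and coordinate germs. $S\hat{\mathbb C}$ is the super-Riemann sphere with charts $\Delta,\Upsilon$ onto $\bigwedge_\infty$, $\Delta\circ\Upsilon^{-1}=I$. For $n\ge1$, $SK(n)=SM^{n-1}\times\mathcal H\times((\bigwedge_\infty^0)^\times\times\mathcal H)^n$ ($SM^{n-1}$: $(n-1)$-tuples of points of $\bigwedge_\infty^\times$ with distinct bodies) is identified with the set of equivalence classes of superspheres with $1+n$ tubes: $((z_k,\theta_k)_{k<n};(A^{(0)},M^{(0)}),(a^{(k)},A^{(k)},M^{(k)})_{k\le n})$ is the class of $S\hat{\mathbb C}$ with punctures $\infty=\Upsilon^{-1}(0)$ (negative), $(z_k,\theta_k)$ and $(z_n,\theta_n)=0$, with coordinates $\tilde E(A^{(0)},-iM^{(0)})\circ I$ at $\infty$ and $\hat E(a^{(k)},A^{(k)},M^{(k)})\circ s_{(z_k,\theta_k)}$ at the $k$-th puncture (in the chart $\Delta$). Sewing: for $(S_1;p_0,\ldots,p_m;\Omega_k)$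 and $(S_2;q_0,\ldots,q_n;\Xi_l)$ such that for some $r>0$ the images of $\Omega_i$, $\Xi_0$ contain $\bar{\mathcal B}_0^r$, $\bar{\mathcal B}_0^{1/r}$ and $p_i$, $q_0$ are the only punctures in their preimages, $S_1\,{}_i\infty_0\,S_2$ is obtained, for $r_2<r<r_1$ close to $r$, by gluing $S_1\smallsetminus\Omega_i^{-1}(\bar{\mathcal B}_0^{r_2})$ and $S_2\smallsetminus\Xi_0^{-1}(\bar{\mathcal B}_0^{1/r_1})$ via $p\sim\Xi_0^{-1}\circ I\circ\Omega_i(p)$ on $\Omega_i^{-1}(\mathcal B_0^{r_1}\smallsetminus\bar{\mathcal B}_0^{r_2})$, with punctures $p_0,\ldots,p_{i-1},q_1,\ldots,q_n,p_{i+1},\ldots,p_m$ and restricted coordinates. This induces the partial operation ${}_i\infty_0:SK(m)\times SK(n)\to SK(m+n-1)$. *)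

(* Defs.v *)
From HB Require Import structures.
From mathcomp Require Import all_boot all_order all_algebra.
From mathcomp Require Import finmap complex.
From mathcomp Require Import all_classical all_reals.
From mathcomp Require Import topology normedtype sequences.
(* The notations of monalg clash with those of mathcomp-analysis. *)
From mathcomp Require Import -(notations) monalg.

Set Implicit Arguments.
Unset Strict Implicit.
Unset Printing Implicit Defensive.

Import Order.TTheory GRing.Theory Num.Theory.
Import numFieldNormedType.Exports.

Local Open Scope classical_set_scope.
Local Open Scope ring_scope.

(* A finite set S = {s_1 < ... < s_k} of naturals indexes the monomial
   zeta_{s_1} ... zeta_{s_k}; elements are finite linear combinations. *)
Definition grassmann (F : fieldType) : predArgType := malg {fset nat} F.

HB.instance Definition _ (F : fieldType) := GRing.Lmodule.on (grassmann F).
HB.instance Definition _ (F : fieldType) := Choice.on (grassmann F).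

Section Grassmann.
Variable F : fieldType.
Local Notation G := (grassmann F).
Implicit Types (a b c : G) (S T U : {fset nat}).

Definition gmon S (x : F) : G := mkmalgU S x.
Definition coef a S : F := mcoeff S a.

(* zeta_S zeta_T = gsgn S T zeta_(S u T). *)
Definition inversions S T : nat := (\sum_(s <- S) \sum_(t <- T) (t < s))%N.
Definition gsgn S T : F :=
  if fdisjoint S T then (-1) ^+ inversions S T else 0.

Definition gmul a b : G :=
  \sum_(S <- msupp a) \sum_(T <- msupp b)
    gmon (S `|` T)%fset (gsgn S T * (coef a S * coef b T)).

Fact gmulw (d1 d2 : {fset {fset nat}}) a b :
  (msupp a `<=` d1)%fset -> (msupp b `<=` d2)%fset ->
  gmul a b = \sum_(S <- d1) \sum_(T <- d2)
    gmon (S `|` T)%fset (gsgn S T * (coef a S * coef b T)).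
Proof.
move=> le_d1 le_d2; rewrite /gmul (big_fset_incl _ le_d1) /=.
  apply/eq_bigr=> S _; apply/big_fset_incl => // T _ /mcoeff_outdom bT.
  by rewrite /coef bT !mulr0 /gmon monalgU0.
move=> S _ /mcoeff_outdom aS.
by rewrite big1 // => T _; rewrite /coef aS mul0r mulr0 /gmon monalgU0.
Qed.

Fact gmulDl : left_distributive gmul +%R.
Proof.
move=> a b c; have sub := fsubset_refl (msupp c).
rewrite [in RHS](gmulw (fsubsetUl _ (msupp b)) sub).
rewrite [in RHS](gmulw (fsubsetUr (msupp a) _) sub) (gmulw (msuppD_le _ _) sub).
rewrite -big_split /=; apply/eq_bigr=> S _.
rewrite -big_split /=; apply/eq_bigr=> T _.
by rewrite /coef mcoeffD mulrDl mulrDr /gmon monalgUD.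
Qed.

Fact gmulDr : right_distributive gmul +%R.
Proof.
move=> c a b; have sub := fsubset_refl (msupp c).
rewrite [in RHS](gmulw sub (fsubsetUl _ (msupp b))).
rewrite [in RHS](gmulw sub (fsubsetUr (msupp a) _)) (gmulw sub (msuppD_le _ _)).
rewrite -big_split /=; apply/eq_bigr=> S _.
rewrite -big_split /=; apply/eq_bigr=> T _.
by rewrite /coef mcoeffD mulrDr mulrDr /gmon monalgUD.
Qed.

Fact gmul0 : left_zero 0 gmul.
Proof. by move=> a; rewrite /gmul msupp0 big_seq_fset0. Qed.

Fact gmulr0 : right_zero 0 gmul.
Proof.
by move=> a; rewrite /gmul big1 // => S _; rewrite msupp0 big_seq_fset0.
Qed.

Fact gmulUU S T (x y : F) :
  gmul (gmon S x) (gmon T y) = gmon (S `|` T)%fset (gsgn S T * (x * y)).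
Proof.
by rewrite (gmulw msuppU_le msuppU_le) !big_seq_fset1 /coef /gmon !mcoeffUU.
Qed.

Fact gmonE a : a = \sum_(S <- msupp a) gmon S (coef a S).
Proof. exact: monalgE. Qed.

Fact inversions0l T : inversions fset0 T = 0%N.
Proof. by rewrite /inversions big_seq_fset0. Qed.

Fact inversions0r S : inversions S fset0 = 0%N.
Proof. by rewrite /inversions big1 // => s _; rewrite big_seq_fset0. Qed.

Fact sum_fsetU S T (f : nat -> nat) : fdisjoint S T ->
  (\sum_(i <- (S `|` T)%fset) f i = \sum_(i <- S) f i + \sum_(i <- T) f i)%N.
Proof.
move=> dST; rewrite -big_cat; apply: perm_big; apply: uniq_perm => [||x].
- exact: fset_uniq.
- rewrite cat_uniq !fset_uniq andbT /=; apply/hasPn => x xT.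
  by rewrite fdisjoint_sym in dST; apply: (fdisjointP dST).
- by rewrite mem_cat in_fsetU.
Qed.

Fact inversionsUl S T U : fdisjoint S T ->
  inversions (S `|` T)%fset U = (inversions S U + inversions T U)%N.
Proof. by move=> dST; rewrite /inversions sum_fsetU. Qed.

Fact inversionsUr S T U : fdisjoint T U ->
  inversions S (T `|` U)%fset = (inversions S T + inversions S U)%N.
Proof.
move=> dTU; rewrite /inversions -big_split /=; apply: eq_bigr => s _.
by rewrite sum_fsetU.
Qed.

Fact gsgnA S T U :
  gsgn S T * gsgn (S `|` T)%fset U = gsgn T U * gsgn S (T `|` U)%fset.
Proof.
rewrite /gsgn fdisjointUX fdisjointXU.
case: (boolP (fdisjoint S T)) => dST; case: (boolP (fdisjoint T U)) => dTU;
  rewrite ?(andbT, andbF, andTb, andFb, mul0r, mulr0) //.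
case: ifP => dSU; rewrite ?mulr0 // -!exprD inversionsUl // inversionsUr //.
by congr (_ ^+ _); rewrite addnA addnC.
Qed.

Definition gone : G := gmon fset0 1.

Fact gmul1 : left_id gone gmul.
Proof.
move=> a; rewrite {2}[a]gmonE (gmulw msuppU_le (fsubset_refl _)).
rewrite big_seq_fset1; apply: eq_bigr => S _.
rewrite fset0U /gsgn fdisjoint0X inversions0l expr0 mul1r.
by rewrite {1}/coef /gone /gmon mcoeffUU mul1r.
Qed.

Fact gmulr1 : right_id gone gmul.
Proof.
move=> a; rewrite {2}[a]gmonE (gmulw (fsubset_refl _) msuppU_le).
apply: eq_bigr => S _; rewrite big_seq_fset1.
rewrite fsetU0 /gsgn fdisjointX0 inversions0r expr0 mul1r.
by rewrite {2}/coef /gone /gmon mcoeffUU mulr1.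
Qed.

Fact gmulA : associative gmul.
Proof.
have suml b (r : seq {fset nat}) (f : {fset nat} -> G) :
    gmul (\sum_(S <- r) f S) b = \sum_(S <- r) gmul (f S) b.
  exact: (big_morph (gmul^~ b) (fun x y => gmulDl x y b) (gmul0 b)).
have sumr b (r : seq {fset nat}) (f : {fset nat} -> G) :
    gmul b (\sum_(S <- r) f S) = \sum_(S <- r) gmul b (f S).
  exact: (big_morph (gmul b) (fun x y => gmulDr b x y) (gmulr0 b)).
have mon3 S x T y U z : gmul (gmon S x) (gmul (gmon T y) (gmon U z)) =
    gmul (gmul (gmon S x) (gmon T y)) (gmon U z).
  rewrite !gmulUU fsetUA; congr gmon.
  transitivity (gsgn T U * gsgn S (T `|` U)%fset * (x * y * z)).
    by rewrite (mulrCA x) -!mulrA; apply: mulrCA.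
  by rewrite -gsgnA -!mulrA mulrCA.
have mon2 S x T y c : gmul (gmon S x) (gmul (gmon T y) c) =
    gmul (gmul (gmon S x) (gmon T y)) c.
  by rewrite [c]gmonE (sumr (gmon T y)) (sumr (gmon S x))
    (sumr (gmul _ _)); apply: eq_bigr => U _; apply: mon3.
have mon1 S x b c : gmul (gmon S x) (gmul b c) = gmul (gmul (gmon S x) b) c.
  by rewrite [b]gmonE (suml c) !(sumr (gmon S x)) (suml c); apply: eq_bigr => T _; apply: mon2.
move=> a b c; rewrite [a]gmonE (suml (gmul b c)) (suml b) (suml c).
by apply: eq_bigr => S _; apply: mon1.
Qed.

Fact gone_neq0 : gone != 0.
Proof.
apply/eqP => /(congr1 (mcoeff fset0)); rewrite /gone /gmon mcoeffUU mcoeff0.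
exact/eqP/oner_neq0.
Qed.

HB.instance Definition _ := GRing.Zmodule_isNzRing.Build G
  gmulA gmul1 gmulr1 gmulDl gmulDr gone_neq0.

Fact gscaleE (x : F) a : x *: a = gmon fset0 x * a.
Proof.
rewrite [RHS](gmulw msuppU_le (fsubset_refl _)) big_seq_fset1.
apply: eq_bigr => S _; rewrite fset0U /gsgn fdisjoint0X inversions0l expr0.
by rewrite mul1r {1}/coef /gmon mcoeffUU.
Qed.

Fact gscale_comm (x : F) a : gmon fset0 x * a = a * gmon fset0 x.
Proof.
rewrite [LHS](gmulw msuppU_le (fsubset_refl _)) big_seq_fset1.
rewrite [RHS](gmulw (fsubset_refl _) msuppU_le); apply: eq_bigr => S _.
rewrite big_seq_fset1 fset0U fsetU0 /gsgn fdisjoint0X fdisjointX0.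
by rewrite inversions0l inversions0r [X in _ * X]mulrC.
Qed.

Fact gscaleAl (x : F) a b : x *: (a * b) = x *: a * b.
Proof. by rewrite !gscaleE mulrA. Qed.

Fact gscaleAr (x : F) a b : x *: (a * b) = a * (x *: b).
Proof. by rewrite !gscaleE mulrA gscale_comm mulrA. Qed.

HB.instance Definition _ := GRing.Lmodule_isLalgebra.Build F G gscaleAl.
HB.instance Definition _ := GRing.Lalgebra_isAlgebra.Build F G gscaleAr.

Definition gunit : pred G := fun a => `[< exists b, b * a = 1 /\ a * b = 1 >].

Definition ginv a : G :=
  if pselect (exists b, b * a = 1 /\ a * b = 1) is left ab then sval (cid ab)
  else a.

Fact gmulVr : {in gunit, left_inverse 1 ginv *%R}.
Proof.
by move=> a /asboolP ua; rewrite /ginv; case: pselect => // h; case: cid => b [].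
Qed.

Fact gmulrV : {in gunit, right_inverse 1 ginv *%R}.
Proof.
by move=> a /asboolP ua; rewrite /ginv; case: pselect => // h; case: cid => b [].
Qed.

Fact gunitP a b : b * a = 1 /\ a * b = 1 -> a \in gunit.
Proof. by move=> ab; apply/asboolP; exists b. Qed.

Fact ginv_out : {in [predC gunit], ginv =1 id}.
Proof. by move=> a /asboolPn nua; rewrite /ginv; case: pselect. Qed.

HB.instance Definition _ := GRing.NzRing_hasMulInverse.Build G
  gmulVr gmulrV gunitP ginv_out.

Definition body a : F := coef a fset0.

Definition ev a : G :=
  \sum_(S <- msupp a | ~~ odd #|` S|) gmon S (coef a S).
Definition od a : G :=
  \sum_(S <- msupp a | odd #|` S|) gmon S (coef a S).

Definition geven : set G := [set a | forall S, odd #|` S| -> coef a S = 0].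
Definition godd : set G := [set a | forall S, ~~ odd #|` S| -> coef a S = 0].

End Grassmann.

Section GrassmannUnit.
Variable F : fieldType.
Local Notation G := (grassmann F).
Implicit Types (a b : G) (S T : {fset nat}).

Fact coef_sum (I : Type) (r : seq I) (f : I -> G) S :
  coef (\sum_(i <- r) f i) S = \sum_(i <- r) coef (f i) S.
Proof. exact: (raddf_sum (mcoeff S)). Qed.

Fact coefM a b U : coef (a * b) U =
  \sum_(S <- msupp a) \sum_(T <- msupp b)
    (gsgn F S T * (coef a S * coef b T)) *+ ((S `|` T)%fset == U).
Proof.
rewrite [a * b]/(gmul a b) coef_sum; apply: eq_bigr => S _.
rewrite coef_sum; apply: eq_bigr => T _.
by rewrite /coef /gmon mcoeffU.
Qed.

Fact bodyM a b : body (a * b) = body a * body b.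
Proof.
rewrite /body.
have ab := gmulw (fsubsetU1 fset0 (msupp a)) (fsubsetU1 fset0 (msupp b)).
rewrite [X in coef X _]ab.
have z0 (d : {fset {fset nat}}) : fset0 \in (fset0 |` d)%fset.
  by rewrite in_fset1U eqxx.
rewrite coef_sum (big_fsetD1 _ (z0 _)) /= [X in _ + X]big1_fset ?addr0; last first.
  move=> S; rewrite in_fsetD1 => /andP[S0 _] _.
  rewrite coef_sum big1 // => T _; rewrite /coef /gmon mcoeffU.
  by rewrite -fsubset0 fsubUset fsubset0 (negbTE S0).
rewrite coef_sum (big_fsetD1 _ (z0 _)) /= [X in _ + X]big1_fset ?addr0; last first.
  move=> T; rewrite in_fsetD1 => /andP[T0 _] _.
  by rewrite /coef /gmon mcoeffU fset0U (negbTE T0).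
by rewrite /coef /gmon fset0U mcoeffUU /gsgn fdisjoint0X inversions0l mul1r.
Qed.

Fact body1 : body (1 : G) = 1.
Proof. exact: mcoeffUU. Qed.

Definition deg_ge (D : {fset nat}) (k : nat) a : Prop :=
  forall S, coef a S != 0 -> (S `<=` D)%fset /\ (k <= #|` S|)%N.

Fact deg_geM D k l a b : deg_ge D k a -> deg_ge D l b ->
  deg_ge D (k + l) (a * b).
Proof.
move=> ha hb U; have [//|nU] := pselect ((U `<=` D)%fset /\ (k + l <= #|` U|)%N).
rewrite coefM big1 ?eqxx // => S _; rewrite big1 // => T _.
case: eqP => // SU; case: (eqVneq (coef a S) 0) => [->|/ha[SD kS]].
  by rewrite mul0r mulr0.
case: (eqVneq (coef b T) 0) => [->|/hb[TD lT]]; first by rewrite !mulr0.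
rewrite /gsgn; case: ifP => [dST|]; last by rewrite mul0r.
exfalso; apply: nU; rewrite -SU; split.
  by rewrite fsubUset SD.
by rewrite cardfsU (eqP dST) cardfs0 subn0 leq_add.
Qed.

Fact soul_nilpotent a : body a = 0 -> exists N, a ^+ N = 0.
Proof.
move=> a0; pose D := (\bigcup_(S <- msupp a) S)%fset.
have dk k : deg_ge D k (a ^+ k).
  elim: k => [|k IH]; first by rewrite expr0 => S; rewrite [coef _ _]mcoeffU;
    case: (fset0 =P S) => [<-|_]; rewrite ?eqxx // fsub0set.
  rewrite exprS -add1n; apply: deg_geM => // S aS; split.
    apply: bigfcup_sup => //.
    by rewrite -mcoeff_neq0.
  rewrite cardfs_gt0; apply: contra_neq aS => ->; exact: a0.
exists #|` D|.+1; apply/malgP => S; rewrite mcoeff0; apply/eqP.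
case: eqVneq => // /dk[/fsubset_leq_card SD].
by rewrite ltnNge SD.
Qed.

Lemma grassmann_unitE a : (a \is a GRing.unit) = (body a != 0).
Proof.
apply/idP/idP => [ua|a0].
  apply/eqP => a0; have := bodyM a a^-1.
  by rewrite mulrV // body1 a0 mul0r => /eqP; rewrite oner_eq0.
pose s := 1 - (body a)^-1 *: a.
have [N sN] : exists N, s ^+ N = 0.
  apply: soul_nilpotent; rewrite /body /coef /s mcoeffB mcoeffZ.
  by rewrite -/(coef a fset0) -/(body a) mulVf // -/(coef 1 fset0)
    -/(body 1) body1 subrr.
have aE : a = body a *: (1 - s).
  by rewrite /s opprB addrC subrK scalerA divff // scale1r.
have u1s : 1 - s \is a GRing.unit.
  apply/unitrP; exists (\sum_(i < N) s ^+ i).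
  have e : (1 - s) * \sum_(i < N) s ^+ i = 1.
    have := subrX1 s N; rewrite sN sub0r => /(congr1 -%R).
    by rewrite opprK -mulNr opprB => <-.
  split=> //; rewrite -[RHS]e; apply/esym/commr_sum => i _.
  by apply: commrX; apply: commr_sym; apply: commrB => //; apply: commr1.
rewrite aE; apply/unitrP; exists ((body a)^-1 *: (1 - s)^-1).
by split; rewrite -scalerAl -scalerAr scalerA ?mulVf ?divff // scale1r
  ?mulVr ?mulrV.
Qed.

End GrassmannUnit.

(* R[i] with its topology: mathcomp-analysis attaches the topology to
   numClosedFieldType, and not to R[i] itself. *)
Definition cplx (R : realType) : numClosedFieldType := R[i].

(* A point (z, theta) is the element z + theta of the Grassmann algebra, so
   that its coordinates are recovered by ev and od. *)
Definition Gr (R : realType) := grassmann (cplx R).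

Section Superconformal.
Variable R : realType.
Local Notation C := (cplx R).
Local Notation Lam := (Gr R).

Definition dewitt (V : set C) : set Lam := [set a | V (body a)].

(* [c n] is the n-th Taylor coefficient at b of the function [F] of an even
   variable: near b in the body, every component of F is the sum of its power
   series, and the value of F at b plus an even soul s is the (finite) sum of
   the c_n s^n. *)
Definition taylor (F : Lam -> Lam) (b : C) (c : nat -> Lam) : Prop :=
  (exists2 e : C, 0 < e & forall h : C, `|h| < e -> forall S,
     series (fun n => coef (c n) S * h ^+ n) @ \oo --> coef (F (b + h)%:A) S)
  /\ (forall s N, geven s -> body s = 0 -> s ^+ N = 0 ->
       F (b%:A + s) = \sum_(n < N) c n * s ^+ n).

Definition super_analytic (V : set C) (F : Lam -> Lam) : Prop :=
  forall b, V b -> exists c, taylor F b c.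

Definition super_deriv (V : set C) (F F' : Lam -> Lam) : Prop :=
  forall b, V b ->
    exists2 c, taylor F b c & taylor F' b (fun n => c n.+1 *+ n.+1).

Definition maps_to (V : set C) (F : Lam -> Lam) (Y : set Lam) : Prop :=
  forall w, geven w -> V (body w) -> Y (F w).

Definition superconformal (V : set C) (H : Lam -> Lam) : Prop :=
  exists f xi psi g f' psi' : Lam -> Lam,
  [/\ [/\ maps_to V f (@geven C), maps_to V g (@geven C),
          maps_to V xi (@godd C) & maps_to V psi (@godd C)],
      [/\ super_deriv V f f', super_deriv V psi psi',
          super_analytic V xi & super_analytic V g],
      forall x, dewitt V x ->
        H x = (f (ev x) + od x * xi (ev x)) + (psi (ev x) + od x * g (ev x)),
      forall w, geven w -> V (body w) ->
        xi w = g w * psi w /\ g w ^+ 2 = f' w + psi w * psi' w &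
      exists2 x, dewitt V x & g (ev x) + od x * psi' (ev x) != 0].

(* I(w, rho) = (1/w, i rho/w) *)
Definition sinv (x : Lam) : Lam := (ev x)^-1 + 'i *: (od x * (ev x)^-1).

(* s_{(z, theta)}(w, rho) = (w - z - rho theta, rho - theta) *)
Definition sshift (z x : Lam) : Lam :=
  (ev x - ev z - od x * od z) + (od x - od z).

End Superconformal.

Section Surfaces.
Variable R : realType.
Local Notation C := (cplx R).
Local Notation Lam := (Gr R).

(* Charts are partial functions, given by their graphs. *)
Definition pchart (T : Type) := T -> Lam -> Prop.

Definition is_pchart (T : Type) (X : set T) (c : pchart T) : Prop :=
  [/\ forall p a, c p a -> X p,
      forall p a b, c p a -> c p b -> a = b,
      forall p q a, c p a -> c q a -> p = q &
      exists2 V, open V & [set a | exists p, c p a] = dewitt V].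

(* The transition function from [c] to [c'] is superconformal on the image of
   the overlap, which is DeWitt open. *)
Definition compatible (T : Type) (c c' : pchart T) : Prop :=
  let ov := [set a | exists p a', c p a /\ c' p a'] in
  ov !=set0 ->
  exists V H, [/\ open V, ov = dewitt V, superconformal V H &
    forall p a a', c p a -> c' p a' -> a' = H a].

Record surface := Surface {
  pt : Type;
  carrier : set pt;
  atlas : set (pchart pt) }.
Arguments carrier : clear implicits.
Arguments atlas : clear implicits.

Definition super_riemann (S : surface) : Prop :=
  [/\ forall c, atlas S c -> is_pchart (carrier S) c,
      forall p, carrier S p -> exists c a, atlas S c /\ c p a &
      forall c c', atlas S c -> atlas S c' -> compatible c c'].

Definition sopen (S : surface) (U : set (pt S)) : Prop :=
  forall c, atlas S c ->
    exists2 V, open V & [set a | exists2 p, U p & c p a] = dewitt V.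

Definition body_eq (S : surface) (p q : pt S) : Prop :=
  exists c a b, [/\ atlas S c, c p a, c q b & body a = body b].

Definition unit_sphere : set (R * R * R)%type :=
  [set v | v.1.1 ^+ 2 + v.1.2 ^+ 2 + v.2 ^+ 2 = 1].

(* The body, i.e. the quotient of S by [body_eq], is homeomorphic to the
   2-sphere, so that it is connected, compact and of genus zero: [h] induces
   the homeomorphism. *)
Definition body_genus0 (S : surface) : Prop :=
  exists h : pt S -> (R * R * R)%type,
  [/\ h @` carrier S = unit_sphere,
      forall p q, carrier S p -> carrier S q -> (h p = h q <-> body_eq p q) &
      forall U, U `<=` carrier S ->
        (sopen U <->
         exists2 W, open W & U = [set p | carrier S p /\ W (h p)])].

Definition supersphere (S : surface) : Prop :=
  super_riemann S /\ body_genus0 S.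

Definition superconformal_iso (S S' : surface) (f : pt S -> pt S') : Prop :=
  set_bij (carrier S) (carrier S') f /\
  forall c c', atlas S c -> atlas S' c' ->
    compatible c (fun p => c' (f p)) /\ compatible (fun p => c' (f p)) c.

(* Puncture 0 is the negatively oriented one. *)
Record tubed (n : nat) := Tubed {
  surf : surface;
  punct : 'I_n.+1 -> pt surf;
  coord : 'I_n.+1 -> pchart (pt surf) }.
Arguments punct {n}.
Arguments coord {n}.

Definition sphere_with_tubes n (T : tubed n) : Prop :=
  [/\ supersphere (surf T),
      forall k, carrier (surf T) (punct T k),
      forall k l, k != l -> ~ body_eq (punct T k) (punct T l),
      forall k, is_pchart (carrier (surf T)) (coord T k)
        /\ coord T k (punct T k) 0 &
      forall k c, atlas (surf T) c ->
        compatible c (coord T k) /\ compatible (coord T k) c].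

(* Isomorphism matching the punctures and the germs of the coordinates there. *)
Definition tubed_equiv n (T T' : tubed n) : Prop :=
  exists f : pt (surf T) -> pt (surf T'),
    superconformal_iso f /\
    forall k, f (punct T k) = punct T' k /\
      exists2 e : C, 0 < e & forall p a,
        coord T k p a -> `|body a| < e -> coord T' k (f p) a.

End Surfaces.

Arguments carrier {R}.
Arguments atlas {R}.
Arguments punct {R n}.
Arguments coord {R n}.

Section Gluing.
Variables (R : realType) (T1 T2 : Type).
Variables (U1 : set T1) (U2 : set T2) (r : T1 -> T2 -> Prop).

(* The disjoint union of U1 and U2 modulo p ~ q for all (p, q) with r p q, as a
   set of equivalence classes. *)
Definition glue_in (x : T1 + T2) : Prop :=
  match x with inl p => U1 p | inr q => U2 q end.

Definition glue_rel (x y : T1 + T2) : Prop :=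
  match x, y with
  | inl p, inl p' => p = p'
  | inr q, inr q' => q = q'
  | inl p, inr q => r p q
  | inr q, inl p => r p q
  end.

Definition glue_class (x : T1 + T2) : set (T1 + T2) :=
  [set y | glue_in y /\ glue_rel x y].

Definition glue_carrier : set (set (T1 + T2)) :=
  [set glue_class x | x in glue_in].

Definition glue_chart1 (c : pchart R T1) : pchart R (set (T1 + T2)) :=
  fun X a => glue_carrier X /\ exists2 p, X (inl p) & c p a.

Definition glue_chart2 (c : pchart R T2) : pchart R (set (T1 + T2)) :=
  fun X a => glue_carrier X /\ exists2 q, X (inr q) & c q a.

End Gluing.

Section RiemannSphere.
Variable R : realType.
Local Notation Lam := (Gr R).

(* Two copies of the Grassmann algebra, the images of Delta and of Upsilon,
   glued by Delta o Upsilon^-1 = I. *)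
Definition sphere_rel (a u : Lam) : Prop := body u != 0 /\ a = sinv u.

Definition sphere_class : Lam + Lam -> set (Lam + Lam) :=
  glue_class setT setT sphere_rel.

Definition Delta : pchart R (set (Lam + Lam)) :=
  glue_chart1 setT setT sphere_rel eq.
Definition Upsilon : pchart R (set (Lam + Lam)) :=
  glue_chart2 setT setT sphere_rel eq.

Definition super_sphere : surface R :=
  Surface (glue_carrier setT setT sphere_rel) [set Delta; Upsilon].

End RiemannSphere.

Section FormalSeries.
Variable R : realType.
Local Notation C := (cplx R).
Local Notation Lam := (Gr R).

(* (alpha, beta) stands for sum_n alpha_n x^n + phi sum_n beta_n x^n, with phi
   to the left of the coefficients. *)
Definition sseries := ((nat -> Lam) * (nat -> Lam))%type.

(* Left multiplication by a; a phi = phi (ev a - od a). *)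
Definition sscale (a : Lam) (u : sseries) : sseries :=
  (fun n => a * u.1 n, fun n => (ev a - od a) * u.2 n).

Definition sadd (u v : sseries) : sseries :=
  (fun n => u.1 n + v.1 n, fun n => u.2 n + v.2 n).

(* L_j = - (x^(j+1) d/dx + (j+1)/2 phi x^j d/dphi) *)
Definition opL (j : nat) (u : sseries) : sseries :=
  (fun n => if (j <= n)%N then - (u.1 (n - j)%N *+ (n - j)) else 0,
   fun n => if (j <= n)%N then
      - ((((n - j)%:R + j.+1%:R / 2%:R) : C) *: u.2 (n - j)%N) else 0).

(* G_(j-1/2) = - x^j (d/dphi - phi d/dx) *)
Definition opG (j : nat) (u : sseries) : sseries :=
  (fun n => if (j <= n)%N then - u.2 (n - j)%N else 0,
   fun n => if (j <= n)%N then u.1 (n - j).+1 *+ (n - j).+1 else 0).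

(* The sequences are shifted by one: A j and M j are A_(j+1) and
   M_(j+1/2). *)
Definition sseq := ((nat -> Lam) * (nat -> Lam))%type.

(* sum_(j >= 1) (A_j L_j + M_(j-1/2) G_(j-1/2)): only the terms of index at
   most n contribute to the coefficients of x^n and phi x^n. *)
Definition opX (AM : sseq) (u : sseries) : sseries :=
  let t j := sadd (sscale (AM.1 j) (opL j.+1 u))
                  (sscale (AM.2 j) (opG j.+1 u)) in
  (fun n => \sum_(j < n) (t j).1 n, fun n => \sum_(j < n) (t j).2 n).

(* exp(- opX AM): opX raises the degree (2 for x, 1 for phi) by at least one,
   so that its k-th iterate does not contribute to the coefficients of x^n and
   phi x^n for k > 2n + 1. *)
Definition opexp (AM : sseq) (u : sseries) : sseries :=
  let t k n (v : nat -> Lam) := (((-1) ^+ k / k`!%:R) : C) *: v n in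
  (fun n => \sum_(k < n.*2.+2) t k n (iter k (opX AM) u).1,
   fun n => \sum_(k < n.*2.+2) t k n (iter k (opX AM) u).2).

(* b^(-2 L_0) *)
Definition powL0 (b : Lam) (u : sseries) : sseries :=
  (fun n => u.1 n * b ^+ n.*2, fun n => u.2 n * b ^+ n.*2.+1).

Definition sx : sseries := (fun n => (n == 1%N)%:R, fun=> 0).
Definition sphi : sseries := (fun=> 0, fun n => (n == 0%N)%:R).

Definition Etilde (AM : sseq) : sseries * sseries :=
  (opexp AM sx, opexp AM sphi).

Definition Ehat (a : Lam) (AM : sseq) : sseries * sseries :=
  (opexp AM (powL0 a sx), opexp AM (powL0 a sphi)).

(* The series u converges to v at the point (ev x, od x). *)
Definition sconv (u : sseries) (x v : Lam) : Prop :=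
  exists v0 v1 : Lam,
  [/\ forall S, series (fun n => coef (u.1 n * ev x ^+ n) S) @ \oo --> coef v0 S,
      forall S, series (fun n => coef (u.2 n * ev x ^+ n) S) @ \oo --> coef v1 S
    & v = v0 + od x * v1].

Definition sconv2 (E : sseries * sseries) (x v : Lam) : Prop :=
  exists v0 v1, [/\ sconv E.1 x v0, sconv E.2 x v1 & v = v0 + v1].

Definition abs_conv_near0 (u : sseries) : Prop :=
  exists2 e : C, 0 < e & forall x, `|body x| < e ->
  [/\ forall S, cvgn (series (fun n => `|coef (u.1 n * ev x ^+ n) S|)),
      forall S, cvgn (series (fun n => `|coef (u.2 n * ev x ^+ n) S|))
    & exists v, sconv u x v].

Definition calH : set sseq :=
  [set AM | [/\ forall j, geven (AM.1 j), forall j, godd (AM.2 j),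
    abs_conv_near0 (Etilde AM).1 & abs_conv_near0 (Etilde AM).2]].

Definition sseq0 : sseq := (fun=> 0, fun=> 0).

End FormalSeries.

Section Moduli.
Variable R : realType.
Local Notation C := (cplx R).
Local Notation Lam := (Gr R).

(* Data ((z_k, theta_k)_(k < n); (A0, M0), (a_k, (A_k, M_k))_(k <= n)); index j
   stands for the (j+1)-st point or puncture. *)
Record sk_data (n : nat) := SKData {
  sk_pts : n.-1.-tuple Lam;
  sk_neg : sseq R;
  sk_pos : 'I_n -> Lam * sseq R }.

Definition SK (n : nat) : set (sk_data n) :=
  [set Q | [/\ (0 < n)%N,
      forall k, tnth (sk_pts Q) k \is a GRing.unit,
      forall k l, k != l ->
        body (tnth (sk_pts Q) k) != body (tnth (sk_pts Q) l),
      calH (sk_neg Q) &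
      forall j, [/\ geven (sk_pos Q j).1, (sk_pos Q j).1 \is a GRing.unit
        & calH (sk_pos Q j).2]]].

(* The last positively oriented puncture is 0: it is the default value of nth
   at n.-1. *)
Definition sk_pt n (Q : sk_data n) (j : 'I_n) : Lam := nth 0 (sk_pts Q) j.

(* Since I (I (w, rho)) = (w, - rho), the function I o Delta extends across
   infinity as (w, - rho), with (w, rho) = Upsilon. The coordinates relate a
   point to the value of the series wherever the latter converges; only their
   germs at the punctures matter. *)
Definition canonical n (Q : sk_data n) : tubed R n :=
  @Tubed R n (super_sphere R)
    (fun k => if unlift ord0 k is Some j then sphere_class (inl (sk_pt Q j))
              else sphere_class (inr 0))
    (fun k => if unlift ord0 k is Some j then
        fun p a => exists2 x, Delta p x &
          sconv2 (Ehat (sk_pos Q j).1 (sk_pos Q j).2)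
            (sshift (sk_pt Q j) x) a
      else
        fun p a => exists2 u, Upsilon p u &
          sconv2 (Etilde ((sk_neg Q).1, fun j => - 'i *: (sk_neg Q).2 j))
            (ev u - od u) a).

(* Equivalence classes are plain predicates, tubed R n being too large for the
   type constructor set. *)
Definition sk_class n (Q : sk_data n) : tubed R n -> Prop :=
  fun T => sphere_with_tubes T /\ tubed_equiv T (canonical Q).

Definition sk_std n (zs : n.-1.-tuple Lam) : sk_data n :=
  SKData zs (sseq0 R) (fun=> (1, sseq0 R)).

(* The image of the k-th coordinate contains the closed ball of radius r, and
   the k-th puncture is the only one in its preimage. *)
Definition tube_contains n (T : tubed R n) (k : 'I_n.+1) (r : C) : Prop :=
  (forall a, `|body a| <= r -> exists p, coord T k p a) /\
  (forall l a, coord T k (punct T l) a -> `|body a| <= r -> l = k).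

Section Sewing.
Variables (m n i : nat) (T1 : tubed R m) (T2 : tubed R n) (r1 r2 : C).
Let S1 := surf T1.
Let S2 := surf T2.
Let Om := coord T1 (inord i).
Let Xi := coord T2 ord0.

Definition sew_part1 : set (pt S1) :=
  carrier S1 `\` [set p | exists2 a, Om p a & `|body a| <= r2].

Definition sew_part2 : set (pt S2) :=
  carrier S2 `\` [set q | exists2 b, Xi q b & `|body b| <= r1^-1].

(* p ~ q iff q = Xi^-1 (I (Om p)) *)
Definition sew_rel (p : pt S1) (q : pt S2) : Prop :=
  exists a, [/\ Om p a, r2 < `|body a|, `|body a| < r1 & Xi q (sinv a)].

Let chart1 := @glue_chart1 R _ _ sew_part1 sew_part2 sew_rel.
Let chart2 := @glue_chart2 R _ _ sew_part1 sew_part2 sew_rel.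
Let cls := glue_class sew_part1 sew_part2 sew_rel.

Definition sew_surface : surface R :=
  Surface (glue_carrier sew_part1 sew_part2 sew_rel)
    ([set chart1 c | c in atlas S1] `|` [set chart2 c | c in atlas S2]).

(* The punctures p_0, ..., p_(i-1), q_1, ..., q_n, p_(i+1), ..., p_m *)
Definition sew : tubed R (m + n).-1 :=
  @Tubed R (m + n).-1 sew_surface
    (fun k => if (k < i)%N then cls (inl (punct T1 (inord k)))
      else if (k < i + n)%N then cls (inr (punct T2 (inord (k - i).+1)))
      else cls (inl (punct T1 (inord (k - n).+1))))
    (fun k => if (k < i)%N then chart1 (coord T1 (inord k))
      else if (k < i + n)%N then chart2 (coord T2 (inord (k - i).+1))
      else chart1 (coord T1 (inord (k - n).+1))).

End Sewing.

(* The partial operation induced on equivalence classes, as the set of all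
   superspheres obtained by sewing representatives (up to equivalence); it is
   empty if no representatives can be sewn. The inequalities on r1 and r2
   imply that the closed balls of radius r and r^-1 satisfy the conditions for
   sewing. *)
Definition sew_class m n (i : nat) (C1 : tubed R m -> Prop)
    (C2 : tubed R n -> Prop) : tubed R (m + n).-1 -> Prop :=
  fun T => sphere_with_tubes T /\
    exists T1 T2 (r r1 r2 : C),
    [/\ C1 T1, C2 T2,
        [/\ (0 < i <= m)%N, 0 < r2, r2 < r & r < r1],
        tube_contains T1 (inord i) r1 /\ tube_contains T2 ord0 r2^-1 &
        tubed_equiv T (sew i T1 T2 r1 r2)].

End Moduli.

Section SKstd.
Variable R : realType.
Local Notation C := (cplx R).
Local Notation Lam := (Gr R).

Fact ev0 : ev (0 : Lam) = 0.
Proof. by rewrite /ev msupp0 big_mkcond big_seq_fset0. Qed.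

Fact od0 : od (0 : Lam) = 0.
Proof. by rewrite /od msupp0 big_mkcond big_seq_fset0. Qed.

Fact opX0 (u : sseries R) : opX (sseq0 R) u = (fun=> 0, fun=> 0).
Proof.
rewrite /opX; congr pair; apply/funext => n;
  by rewrite big1 //= => j _; rewrite ?ev0 ?od0 ?subr0 !mul0r addr0.
Qed.

Fact iter_opX0 (u : sseries R) k :
  iter k.+1 (opX (sseq0 R)) u = (fun=> 0, fun=> 0).
Proof. by rewrite iterS opX0. Qed.

Fact opexp0 (u : sseries R) : opexp (sseq0 R) u = u.
Proof.
rewrite [RHS]surjective_pairing /opexp; congr pair; apply/funext => n;
  rewrite big_ord_recl expr0 fact0 divr1 scale1r big1 ?addr0 // => k _;
  by rewrite lift0 iter_opX0 scaler0.
Qed.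

Fact cvg_series_fin (u : nat -> C) (N : nat) :
  (forall n, (N <= n)%N -> u n = 0) -> series u @ \oo --> series u N.
Proof.
move=> uN; apply: cvg_near_cst; exists N => // n /= Nn.
rewrite /series /= (big_cat_nat _ Nn) //= -[RHS]addr0; congr (_ + _).
by rewrite big_nat big1 // => i /andP[/uN].
Qed.

Fact abs_conv_fin (u : sseries R) :
  (forall n, (1 < n)%N -> u.1 n = 0 /\ u.2 n = 0) -> abs_conv_near0 u.
Proof.
move=> u0; exists 1 => // x _.
have c0 S : coef (0 : Lam) S = 0 by exact: mcoeff0.
split.
- move=> S; apply/cvg_ex; eexists; apply: (@cvg_series_fin _ 2) => n n2.
  by rewrite (u0 n n2).1 mul0r c0 normr0.
- move=> S; apply/cvg_ex; eexists; apply: (@cvg_series_fin _ 2) => n n2.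
  by rewrite (u0 n n2).2 mul0r c0 normr0.
have sumE (v : nat -> Lam) S : (forall n, (1 < n)%N -> v n = 0) ->
    series (fun n => coef (v n * ev x ^+ n) S) @ \oo -->
    coef (v 0%N + v 1%N * ev x) S.
  move=> v0; have -> : coef (v 0%N + v 1%N * ev x) S =
      series (fun n => coef (v n * ev x ^+ n) S) 2.
    rewrite /series /= big_nat_recr //= big_nat1 expr0 mulr1 expr1.
    exact: mcoeffD.
  by apply: cvg_series_fin => n n2; rewrite v0 // mul0r c0.
by eexists; eexists; eexists; split; last by []; move=> S;
  apply: sumE => n n2; rewrite ?(u0 n n2).1 ?(u0 n n2).2.
Qed.

Fact calH0 : calH (sseq0 R).
Proof.
have c0 S : coef (0 : Lam) S = 0 by exact: mcoeff0.
by split; do ?[by move=> j S _; rewrite c0]; rewrite /Etilde /= opexp0;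
  apply: abs_conv_fin => -[|[|n]].
Qed.

Lemma sk_std_SK n (zs : n.-1.-tuple Lam) : (0 < n)%N ->
  (forall k, tnth zs k \is a GRing.unit) ->
  (forall k l, k != l -> body (tnth zs k) != body (tnth zs l)) ->
  SK (sk_std zs).
Proof.
move=> n0 zu zd; split => //=; first exact: calH0.
move=> j; split; [|exact: unitr1|exact: calH0].
move=> S; rewrite /= /coef mcoeffU; case: eqP => // <-.
by rewrite cardfs0.
Qed.
End SKstd.

(* Main.v *)
Require Import Defs.
From HB Require Import structures.
From mathcomp Require Import all_boot all_order all_algebra complex finmap.
From mathcomp Require Import all_classical all_reals.
From mathcomp Require Import topology normedtype sequences.
From mathcomp Require Import -(notations) monalg.
From mathcomp Require Import ring lra zify.
Require Import Defs.

Set Implicit Arguments.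
Unset Strict Implicit.
Unset Printing Implicit Defensive.

Import Order.TTheory GRing.Theory Num.Theory.
Import numFieldNormedType.Exports.

Local Open Scope classical_set_scope.
Local Open Scope ring_scope.

(* Write s_z for the superconformal shift taking z to 0. Given tubed superspheres
   T1 and T2 with isomorphisms f1 and f2 onto standard spheres, f1 on T1 and
   s_zeta^-1 o f2 on T2, where zeta is the i-th puncture of the first sphere,
   agree along the sewn annulus and so define an isomorphism from the sewn
   surface onto the standard sphere with the punctures of the first one and
   the shifted punctures of the second one. The new punctures come out as stated
   because s_(s_z(w)) o s_z = s_w.

   This requires f1 and f2 to match the coordinates on the whole discs that are
   removed or glued, and not just their germs: a transition function between
   superspheres that is the identity near the centre of a disc stays so by
   analytic continuation along radii, and cannot run into the point at
   infinity, where the other chart would have to vanish.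

   The analysis behind it (composition, gluing, identity principle) rests on the
   seminorms nrm D l, the l^1 norms of the components along subsets of D with
   the monomials of degree k weighted by l^k: they are submultiplicative, and
   small l makes the soul of a contribute little to nrm D l a. *)

(** Each identity is an equality of two predicates on tubed superspheres, and its two inclusions
    differ in depth. For one of them it is enough to sew the standard spheres themselves, where all
    discs are explicit. The other concerns arbitrary representatives, known only up to isomorphism
    and up to germs, and this is what forces the continuation.

    Superconformality as defined only asks that g + rho psi' is not identically 0, and a composite
    of such maps may degenerate. Transition functions are injective, however, so that the body of g
    vanishes nowhere; the calculus is carried out for maps with this property, which is stable under
    composition.

    Convergence is componentwise over infinitely many components, with no norm on the whole algebra.
    For composites the difficulty is a radius independent of D: it is found from the bodies alone,
    and only then is the weight l chosen, for each D separately.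

    The inequalities of the statement supply the sewing radii r2 < r1: between |z1 - z2| and |z2| in
    the first identity, between |z2| and |z1| in the second, taken on bodies. *)

Section Vanishing.
Variable R : realType.
Implicit Types u v : nat -> R.

(** One-sided, being meant for norms and for constants. An inequality passes to the limit by
    bounding the constant difference of its sides by a vanishing sequence and applying
    [vanishing_cst]. *)
Definition vanishing u : Prop :=
  forall e : R, 0 < e -> exists N, forall n, (N <= n)%N -> u n < e.

Lemma vanishing_le u v : (forall n, u n <= v n) -> vanishing v -> vanishing u.
Proof.
move=> uv v0 e /v0[N vN]; exists N => n /vN; exact: le_lt_trans.
Qed.

Lemma vanishing_near u v (N : nat) : (forall n, (N <= n)%N -> u n <= v n) ->
  vanishing v -> vanishing u.
Proof.
move=> uv v0 e /v0[M vM]; exists (maxn N M) => n; rewrite geq_max.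
by move=> /andP[/uv uvn /vM]; apply: le_lt_trans.
Qed.

Lemma vanishingD u v : vanishing u -> vanishing v ->
  vanishing (fun n => u n + v n).
Proof.
move=> u0 v0 e e0; have e20 : 0 < e / 2%:R by lra.
have [[N uN] [M vM]] := (u0 _ e20, v0 _ e20).
exists (maxn N M) => n; rewrite geq_max => /andP[/uN un /vM vn]; lra.
Qed.

Lemma vanishingM (c : R) u : 0 <= c -> vanishing u ->
  vanishing (fun n => c * u n).
Proof.
move=> c0 u0 e e0; have c1 : 0 < c + 1 by lra.
have [N uN] := u0 _ (divr_gt0 e0 c1); exists N => n /uN.
rewrite ltr_pdivlMr // mulrC => un.
have [u_ge0|u_lt0] := leP 0 (u n); nra.
Qed.

Lemma vanishing0 : vanishing (fun=> 0).
Proof. by move=> e e0; exists 0%N. Qed.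

Lemma vanishing_sum (I : Type) (r : seq I) (P : pred I) (f : I -> nat -> R) :
  (forall i, P i -> vanishing (f i)) ->
  vanishing (fun n => \sum_(i <- r | P i) f i n).
Proof.
move=> f0; elim: r => [|i r IH].
  by apply: vanishing_le vanishing0 => n; rewrite big_nil.
have [Pi|nPi] := boolP (P i).
  apply: vanishing_le (vanishingD (f0 _ Pi) IH) => n; by rewrite big_cons Pi.
by apply: vanishing_le IH => n; rewrite big_cons (negbTE nPi).
Qed.

Lemma vanishing_cst (c : R) : vanishing (fun=> c) -> c <= 0.
Proof.
move=> c0; rewrite leNgt; apply/negP => cp; have [N /(_ N (leqnn N))] := c0 _ cp.
by rewrite ltxx.
Qed.

Lemma vanishing_geo (t : R) : 0 <= t -> t < 1 -> vanishing (fun n => t ^+ n).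
Proof.
move=> t0 t1 e e0; have t1' : `|t| < 1 by rewrite ger0_norm.
have /cvgrPdist_lt/(_ e e0)[N _ tN] := cvg_expr t1'.
exists N => n /tN; rewrite sub0r normrN ger0_norm //; exact: exprn_ge0.
Qed.

Lemma vanishing_shift u k : vanishing u -> vanishing (fun n => u (n + k)%N).
Proof.
by move=> u0 e /u0[N uN]; exists N => n Nn; apply: uN; exact: leq_trans (leq_addr _ _).
Qed.

End Vanishing.

(** * Complex numbers with a real-valued norm *)

Section ComplexNorm.
Variable R : realType.
Local Notation C := (cplx R).
Implicit Types (z w : C).

(** The norm of [cplx R] takes its values in [cplx R] itself, which is only partially ordered; real
    values make [lra] and [nra] available. *)
Definition nC (z : C) : R := ComplexField.Normc.normc z.
Definition toC (x : R) : C := x%:C%C.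

Lemma normCE z : `|z| = toC (nC z). Proof. by []. Qed.
Lemma toC_inj : injective toC. Proof. by move=> x y []. Qed.
Lemma toC_le x y : (toC x <= toC y) = (x <= y). Proof. exact: lecR. Qed.
Lemma toC_lt x y : (toC x < toC y) = (x < y). Proof. exact: ltcR. Qed.
Lemma toC_gt0 (e : C) : 0 < e -> exists2 r : R, 0 < r & e = toC r.
Proof.
move=> e0; have := e0; rewrite ltcE => /andP[/eqP ei er].
exists (complex.Re e) => //; case: e {e0} ei er => a b /= -> _ //.
Qed.

Lemma toCD x y : toC (x + y) = toC x + toC y.
Proof. exact: (rmorphD (real_complex R)). Qed.
Lemma toCM x y : toC (x * y) = toC x * toC y.
Proof. exact: (rmorphM (real_complex R)). Qed.
Lemma toC0 : toC 0 = 0. Proof. by []. Qed.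
Lemma toCV x : toC x^-1 = (toC x)^-1.
Proof. exact: (fmorphV (real_complex R)). Qed.

Lemma nC_ge0 z : 0 <= nC z.
Proof. by rewrite -toC_le; exact: (@normr_ge0 _ C z). Qed.
Lemma nC0 : nC 0 = 0.
Proof. by apply: toC_inj; rewrite -normCE; exact: (@normr0 _ C). Qed.
Lemma nC1 : nC 1 = 1.
Proof. by apply: toC_inj; rewrite -normCE; exact: (@normr1 C). Qed.
Lemma nCM z w : nC (z * w) = nC z * nC w.
Proof. by apply: toC_inj; rewrite toCM -!normCE; exact: normrM. Qed.
Lemma nCD z w : nC (z + w) <= nC z + nC w.
Proof. by rewrite -toC_le toCD -!normCE; exact: ler_normD. Qed.
Lemma nCN z : nC (- z) = nC z.
Proof. by apply: toC_inj; rewrite -!normCE; exact: normrN. Qed.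
Lemma nCB z w : nC (z - w) <= nC z + nC w.
Proof. by rewrite -(nCN w); exact: nCD. Qed.
Lemma nC_dist z w : nC (z - w) = nC (w - z).
Proof. by rewrite -nCN opprB. Qed.
Lemma nC_lowerB z w : nC z - nC w <= nC (z - w).
Proof. by rewrite lerBlDr; apply: le_trans (nCD _ _); rewrite subrK. Qed.
Lemma nC_eq0 z : (nC z == 0) = (z == 0).
Proof. by rewrite -(inj_eq toC_inj) toC0 -normCE; exact: (@normr_eq0 _ C). Qed.
Lemma nC_gt0 z : (0 < nC z) = (z != 0).
Proof. by rewrite lt_neqAle nC_ge0 andbT eq_sym nC_eq0. Qed.
Lemma nC_toC x : nC (toC x) = `|x|.
Proof. by rewrite /nC /toC /= expr0n /= addr0 sqrtr_sqr. Qed.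
Lemma nCX z n : nC (z ^+ n) = nC z ^+ n.
Proof. by elim: n => [|n IH]; rewrite ?expr0 ?nC1 // !exprS nCM IH. Qed.
Lemma nCV z : nC z^-1 = (nC z)^-1.
Proof. by apply: toC_inj; rewrite toCV -!normCE; exact: (@normfV C). Qed.
Lemma nC_sum (I : Type) (r : seq I) (P : pred I) (f : I -> C) :
  nC (\sum_(i <- r | P i) f i) <= \sum_(i <- r | P i) nC (f i).
Proof.
elim/big_rec2: _ => [|i x y _ h]; first by rewrite nC0.
by apply: le_trans (nCD _ _) _; rewrite lerD2l.
Qed.
Lemma nCn (n : nat) : nC n%:R = n%:R.
Proof.
by apply: toC_inj; rewrite -normCE /toC (rmorph_nat (real_complex R)); exact: (@normr_nat C).
Qed.

Lemma normC_lt z (e : R) : (`|z| < toC e) = (nC z < e).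
Proof. by rewrite normCE toC_lt. Qed.
Lemma normC_le z (e : R) : (`|z| <= toC e) = (nC z <= e).
Proof. by rewrite normCE toC_le. Qed.

Lemma cvgCP (u : nat -> C) (l : C) :
  u @ \oo --> l <-> vanishing (fun n => nC (u n - l)).
Proof.
split=> [/cvgrPdist_lt ul e e0|ul].
  have /ul[N _ uN] : 0 < toC e by rewrite -toC0 toC_lt.
  by exists N => n /uN /=; rewrite normC_lt nC_dist.
apply/cvgrPdist_lt => e /toC_gt0[r r0 ->]; have [N uN] := ul _ r0.
by exists N => // n /uN /=; rewrite normC_lt nC_dist.
Qed.

Lemma openCP (V : set C) :
  open V <-> forall b, V b -> exists2 e : R, 0 < e & forall z, nC (z - b) < e -> V z.
Proof.
rewrite openE; split=> [oV b /oV|oV b /oV[e e0 eV]].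
  move=> /nbhs_ballP[e /= /toC_gt0[r r0 ->] eV]; exists r => // z zb.
  by apply: eV; rewrite /ball /= normC_lt nC_dist.
apply/nbhs_ballP; exists (toC e); first by rewrite /= -toC0 toC_lt.
by move=> z; rewrite /ball /= normC_lt nC_dist; apply: eV.
Qed.

Lemma Re_le z : `|complex.Re z| <= nC z.
Proof. by rewrite -toC_le -normCE; exact: normc_ge_Re. Qed.
(** Multiplication by - i keeps the modulus and turns the imaginary part into the real part. *)
Lemma Im_le z : `|complex.Im z| <= nC z.
Proof.
have <- : nC (- 'i%C * z) = nC z.
  by rewrite nCM nCN /nC /= expr0n expr1n add0r sqrtr1 mul1r.
apply: le_trans (Re_le _); case: z => a b /=.
by rewrite oppr0 mul0r mulN1r sub0r opprK.
Qed.
Lemma nC_ReIm z : nC z <= `|complex.Re z| + `|complex.Im z|.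
Proof.
rewrite {1}[z]complexE; apply: le_trans (nCD _ _) _.
rewrite nCM -/(toC _) -/(toC (complex.Im z)) !nC_toC.
by rewrite [nC 'i%C]/nC /= expr0n expr1n add0r sqrtr1 mul1r.
Qed.

Lemma real_summable (t : nat -> R) (B : R) :
  (forall M, \sum_(m < M) `|t m| <= B) ->
  exists l, vanishing (fun M => `|\sum_(m < M) t m - l|).
Proof.
move=> tB; have cn : cvgn [normed series t].
  apply: nondecreasing_is_cvgn.
    by apply/nondecreasing_seqP => n; rewrite /normed_series_of /series /= big_nat_recr //= lerDl.
  exists B => _ [n _ <-]; rewrite /normed_series_of /series /= big_mkord; exact: tB.
have /cvgrPdist_lt ct := normed_cvg cn.
exists (limn (series t)) => e /ct[N _ tN]; exists N => n /tN /=.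
by rewrite /series /= big_mkord distrC.
Qed.

(** Reduces to the completeness of the reals: real and imaginary parts are both dominated by
    [nC]. *)
Lemma abs_summable (t : nat -> C) (B : R) :
  (forall M, \sum_(m < M) nC (t m) <= B) ->
  exists l, vanishing (fun M => nC (\sum_(m < M) t m - l)).
Proof.
move=> tB.
have [x hx] : exists l, vanishing (fun M => `|\sum_(m < M) complex.Re (t m) - l|).
  apply: (@real_summable (fun m => complex.Re (t m)) B) => M; apply: le_trans (tB M); apply: ler_sum => i _.
  exact: Re_le.
have [y hy] : exists l, vanishing (fun M => `|\sum_(m < M) complex.Im (t m) - l|).
  apply: (@real_summable (fun m => complex.Im (t m)) B) => M; apply: le_trans (tB M); apply: ler_sum => i _.
  exact: Im_le.
exists (x +i* y)%C; apply: vanishing_le (vanishingD hx hy) => M.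
apply: le_trans (nC_ReIm _) _.
have -> : \sum_(m < M) t m = ((\sum_(m < M) complex.Re (t m)) +i* (\sum_(m < M) complex.Im (t m)))%C.
  elim: M => [|M IH]; first by rewrite !big_ord0.
  by rewrite !big_ord_recr /= IH; case: (t M).
by [].
Qed.

End ComplexNorm.

(** * The Grassmann algebra and its seminorms *)

Section GrassmannBasics.
Variable F : fieldType.
Local Notation G := (grassmann F).
Implicit Types (a b c : G) (S T U : {fset nat}).

Lemma coefD a b S : coef (a + b) S = coef a S + coef b S.
Proof. exact: mcoeffD. Qed.
Lemma coefN a S : coef (- a) S = - coef a S.
Proof. exact: mcoeffN. Qed.
Lemma coefB a b S : coef (a - b) S = coef a S - coef b S.
Proof. exact: mcoeffB. Qed.
Lemma coef0 S : coef (0 : G) S = 0.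
Proof. exact: mcoeff0. Qed.
Lemma coefZ (x : F) a S : coef (x *: a) S = x * coef a S.
Proof. exact: mcoeffZ. Qed.
Lemma coef1 S : coef (1 : G) S = (S == fset0)%:R.
Proof. by rewrite /coef /= [LHS](@mcoeffU _ _ fset0 1 S) eq_sym -mulr_natr mul1r. Qed.
Lemma coef_gmon S T (x : F) : coef (gmon S x) T = x *+ (S == T).
Proof. exact: mcoeffU. Qed.
Lemma coefP a b : (forall S, coef a S = coef b S) -> a = b.
Proof. by move=> h; apply/malgP. Qed.
Lemma coef_neq0 a S : (coef a S != 0) = (S \in msupp a).
Proof. exact: mcoeff_neq0. Qed.

Lemma bodyD a b : body (a + b) = body a + body b.
Proof. exact: coefD. Qed.
Lemma bodyN a : body (- a) = - body a.
Proof. exact: coefN. Qed.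
Lemma bodyB a b : body (a - b) = body a - body b.
Proof. exact: coefB. Qed.
Lemma bodyZ (x : F) a : body (x *: a) = x * body a.
Proof. exact: coefZ. Qed.
Lemma body0 : body (0 : G) = 0.
Proof. exact: coef0. Qed.
Lemma bodyA (x : F) : body (x%:A : G) = x.
Proof. by rewrite bodyZ body1 mulr1. Qed.
Lemma bodyX a n : body (a ^+ n) = body a ^+ n.
Proof. by elim: n => [|n IH]; rewrite ?expr0 ?body1 // !exprS bodyM IH. Qed.
Lemma body_sum (I : Type) (r : seq I) (P : pred I) (f : I -> G) :
  body (\sum_(i <- r | P i) f i) = \sum_(i <- r | P i) body (f i).
Proof. by elim/big_rec2: _ => [|i x y _ <-]; rewrite ?body0 ?bodyD. Qed.

Lemma coef_ev a S : coef (ev a) S = if odd #|` S| then 0 else coef a S.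
Proof.
rewrite /ev big_mkcond coef_sum.
rewrite (eq_bigr (fun T => if T == S then (if odd #|` S| then 0 else coef a S) else 0)).
  have [Sa|Sa] := boolP (S \in msupp a).
    by rewrite (big_fsetD1 S) //= eqxx big1_fset ?addr0 // => T;
      rewrite in_fsetD1 => /andP[/negbTE ->].
  rewrite big1_fset; last by move=> T Ta; case: eqP => // TS; rewrite -TS Ta in Sa.
  by move: Sa; rewrite -coef_neq0 negbK => /eqP ->; rewrite if_same.
move=> T _; have [->|TS] := eqVneq T S; case: ifP => odS;
  by rewrite ?coef0 ?coef_gmon ?eqxx ?(negbTE TS) ?mulr1n ?mulr0n //; move: odS; case: odd.
Qed.

Lemma coef_od a S : coef (od a) S = if odd #|` S| then coef a S else 0.
Proof.
rewrite /od big_mkcond coef_sum.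
rewrite (eq_bigr (fun T => if T == S then (if odd #|` S| then coef a S else 0) else 0)).
  have [Sa|Sa] := boolP (S \in msupp a).
    by rewrite (big_fsetD1 S) //= eqxx big1_fset ?addr0 // => T;
      rewrite in_fsetD1 => /andP[/negbTE ->].
  rewrite big1_fset; last by move=> T Ta; case: eqP => // TS; rewrite -TS Ta in Sa.
  by move: Sa; rewrite -coef_neq0 negbK => /eqP ->; rewrite if_same.
move=> T _; have [->|TS] := eqVneq T S; case: ifP => odS;
  by rewrite ?coef0 ?coef_gmon ?eqxx ?(negbTE TS) ?mulr1n ?mulr0n //; move: odS; case: odd.
Qed.

Lemma ev_od a : a = ev a + od a.
Proof. by apply: coefP => S; rewrite coefD coef_ev coef_od; case: odd; rewrite ?add0r ?addr0. Qed.
Lemma geven_ev a : geven (ev a).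
Proof. by move=> S oS; rewrite coef_ev oS. Qed.
Lemma godd_od a : godd (od a).
Proof. by move=> S /negbTE oS; rewrite coef_od oS. Qed.
Lemma ev_even a : geven a -> ev a = a.
Proof. by move=> ea; apply: coefP => S; rewrite coef_ev; case: ifP => // /ea. Qed.
Lemma od_odd a : godd a -> od a = a.
Proof. by move=> oa; apply: coefP => S; rewrite coef_od; case: ifP => // /negbT /oa. Qed.
Lemma ev_odd a : godd a -> ev a = 0.
Proof. by move=> oa; apply: coefP => S; rewrite coef_ev coef0; case: ifP => // /negbT /oa. Qed.
Lemma od_even a : geven a -> od a = 0.
Proof. by move=> ea; apply: coefP => S; rewrite coef_od coef0; case: ifP => // /ea. Qed.
Lemma evD a b : ev (a + b) = ev a + ev b.
Proof. by apply: coefP => S; rewrite !(coefD, coef_ev); case: ifP; rewrite ?addr0. Qed.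
Lemma odD a b : od (a + b) = od a + od b.
Proof. by apply: coefP => S; rewrite !(coefD, coef_od); case: ifP; rewrite ?addr0. Qed.
Lemma odB a b : od (a - b) = od a - od b.
Proof. by apply: coefP => S; rewrite !(coefB, coef_od); case: ifP; rewrite ?subr0. Qed.
Lemma evB a b : ev (a - b) = ev a - ev b.
Proof. by apply: coefP => S; rewrite !(coefB, coef_ev); case: ifP; rewrite ?subr0. Qed.
Lemma evZ (x : F) a : ev (x *: a) = x *: ev a.
Proof.
apply: coefP => S; rewrite coef_ev (coefZ x a) (coefZ x (ev a)) coef_ev.
by case: ifP => _; [rewrite mulr0 | ].
Qed.
Lemma odZ (x : F) a : od (x *: a) = x *: od a.
Proof.
apply: coefP => S; rewrite coef_od (coefZ x a) (coefZ x (od a)) coef_od.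
by case: ifP => _; [ | rewrite mulr0].
Qed.
Lemma ev0G : ev (0 : G) = 0.
Proof. by apply: coefP => S; rewrite !(coef0, coef_ev); case: ifP. Qed.
Lemma od0G : od (0 : G) = 0.
Proof. by apply: coefP => S; rewrite !(coef0, coef_od); case: ifP. Qed.
Lemma od_sum n (f : 'I_n -> G) : od (\sum_(i < n) f i) = \sum_(i < n) od (f i).
Proof. by elim/big_rec2: _ => [|i x y _ <-]; [exact: od0G|exact: odD]. Qed.

Lemma ev_add a b : geven a -> godd b -> ev (a + b) = a.
Proof. by move=> ea ob; rewrite evD ev_even // ev_odd // addr0. Qed.
Lemma od_add a b : geven a -> godd b -> od (a + b) = b.
Proof. by move=> ea ob; rewrite odD od_even // od_odd // add0r. Qed.
Lemma body_ev a : body (ev a) = body a.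
Proof. by rewrite /body coef_ev cardfs0. Qed.
Lemma body_odd a : godd a -> body a = 0.
Proof. by move=> oa; apply: oa; rewrite cardfs0. Qed.

Lemma geven0 : geven (0 : G). Proof. by move=> S _; rewrite coef0. Qed.
Lemma godd0 : godd (0 : G). Proof. by move=> S _; rewrite coef0. Qed.
Lemma geven1 : geven (1 : G).
Proof. by move=> S oS; rewrite coef1; case: eqP oS => // ->; rewrite cardfs0. Qed.
Lemma gevenD a b : geven a -> geven b -> geven (a + b).
Proof. by move=> ea eb S oS; rewrite coefD ea ?eb ?addr0. Qed.
Lemma goddD a b : godd a -> godd b -> godd (a + b).
Proof. by move=> ea eb S oS; rewrite coefD ea ?eb ?addr0. Qed.
Lemma gevenN a : geven a -> geven (- a).
Proof. by move=> ea S oS; rewrite coefN ea ?oppr0. Qed.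
Lemma goddN a : godd a -> godd (- a).
Proof. by move=> ea S oS; rewrite coefN ea ?oppr0. Qed.
Lemma gevenB a b : geven a -> geven b -> geven (a - b).
Proof. by move=> ea eb; apply/gevenD/gevenN. Qed.
Lemma goddB a b : godd a -> godd b -> godd (a - b).
Proof. by move=> ea eb; apply/goddD/goddN. Qed.
Lemma gevenZ x a : geven a -> geven (x *: a).
Proof. by move=> ea S oS; rewrite coefZ ea ?mulr0. Qed.
Lemma goddZ x a : godd a -> godd (x *: a).
Proof. by move=> ea S oS; rewrite coefZ ea ?mulr0. Qed.
Lemma gevenA (x : F) : geven (x%:A : G).
Proof. exact/gevenZ/geven1. Qed.

Lemma coefM_eq0 a b U : (forall S T, fdisjoint S T -> (S `|` T)%fset = U ->
  coef a S * coef b T = 0) -> coef (a * b) U = 0.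
Proof.
move=> h; rewrite coefM big1 // => S _; rewrite big1 // => T _.
case: eqP => // SU; rewrite mulr1n /gsgn; case: ifP => dST; last by rewrite mul0r.
by rewrite h ?mulr0.
Qed.

Lemma card_disjU S T : fdisjoint S T -> #|` (S `|` T)%fset| = (#|` S| + #|` T|)%N.
Proof. by move=> /eqP dST; rewrite cardfsU dST cardfs0 subn0. Qed.

Lemma gevenM a b : geven a -> geven b -> geven (a * b).
Proof.
move=> ea eb U oU; apply: coefM_eq0 => S T dST SU; move: oU.
rewrite -SU card_disjU // oddD; have [/ea -> _|] := boolP (odd #|` S|); first by rewrite mul0r.
by move=> _ /eb ->; rewrite mulr0.
Qed.
Lemma gevenMo a b : godd a -> godd b -> geven (a * b).
Proof.
move=> ea eb U oU; apply: coefM_eq0 => S T dST SU; move: oU.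
rewrite -SU card_disjU // oddD; have [oS|/ea -> _] := boolP (odd #|` S|); last by rewrite mul0r.
by move=> /eb ->; rewrite mulr0.
Qed.
Lemma goddMr a b : geven a -> godd b -> godd (a * b).
Proof.
move=> ea eb U oU; apply: coefM_eq0 => S T dST SU; move: oU.
rewrite -SU card_disjU // oddD; have [/ea ->|_ /eb ->] := boolP (odd #|` S|);
  by rewrite ?mul0r ?mulr0.
Qed.
Lemma goddMl a b : godd a -> geven b -> godd (a * b).
Proof.
move=> ea eb U oU; apply: coefM_eq0 => S T dST SU; move: oU.
rewrite -SU card_disjU // oddD; have [oS|/ea ->] := boolP (odd #|` S|); last by rewrite mul0r.
by rewrite addTb negbK => /eb ->; rewrite mulr0.
Qed.
Lemma gevenX a n : geven a -> geven (a ^+ n).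
Proof. by move=> ea; elim: n => [|n IH]; [exact: geven1|rewrite exprS; exact: gevenM]. Qed.
Lemma geven_sum (I : Type) (r : seq I) (P : pred I) (f : I -> G) :
  (forall i, P i -> geven (f i)) -> geven (\sum_(i <- r | P i) f i).
Proof. by move=> h; elim/big_rec: _ => [|i x Pi]; [exact: geven0|apply: gevenD; exact: h]. Qed.
Lemma godd_sum (I : Type) (r : seq I) (P : pred I) (f : I -> G) :
  (forall i, P i -> godd (f i)) -> godd (\sum_(i <- r | P i) f i).
Proof. by move=> h; elim/big_rec: _ => [|i x Pi]; [exact: godd0|apply: goddD; exact: h]. Qed.

(** As S and T are disjoint, each pair (s, t) in S x T is an inversion for exactly one of the two
    orders. *)
Lemma inversionsC S T : fdisjoint S T ->
  (inversions S T + inversions T S = #|` S| * #|` T|)%N.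
Proof.
move=> /fdisjointP dST; rewrite /inversions [X in (_ + X)%N]exchange_big /= -big_split /=.
rewrite -sum1_size big_distrl /= big_seq [RHS]big_seq; apply: eq_bigr => s sS.
rewrite mul1n -sum1_size -big_split /= big_seq [RHS]big_seq; apply: eq_bigr => t tT.
by case: ltngtP => // st; have := dST _ sS; rewrite -st tT.
Qed.

Lemma gsgnC S T : gsgn F S T = (-1) ^+ (#|` S| * #|` T|) * gsgn F T S.
Proof.
rewrite /gsgn fdisjoint_sym; case: ifP => dST; last by rewrite mulr0.
rewrite -inversionsC; last by rewrite fdisjoint_sym.
by rewrite exprD -mulrA -expr2 sqrr_sign mulr1.
Qed.

(** The sign of exchanging two monomials depends only on the parities of their degrees. It is
    therefore one scalar [s] when a factor is even ([s = 1]) or when both are odd ([s = -1]). *)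
Lemma gmul_comm (s : F) a b :
  (forall S T, coef a S * coef b T != 0 -> (-1) ^+ (#|` S| * #|` T|) = s) ->
  a * b = s *: (b * a).
Proof.
move=> h; apply: coefP => U; rewrite coefZ !coefM exchange_big /= mulr_sumr.
apply: eq_bigr => T _; rewrite mulr_sumr; apply: eq_bigr => S _.
rewrite fsetUC; case: (_ == U); rewrite ?mulr0n ?mulr0 // !mulr1n.
rewrite [coef b T * _]mulrC; have [->|/h <-] := eqVneq (coef a S * coef b T) 0.
  by rewrite !mulr0.
by rewrite gsgnC -!mulrA.
Qed.

Lemma even_comm a b : geven a -> a * b = b * a.
Proof.
move=> ea; rewrite (@gmul_comm 1) ?scale1r // => S T.
have [/ea ->|eS _] := boolP (odd #|` S|); first by rewrite mul0r eqxx.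
by rewrite -signr_odd oddM (negbTE eS).
Qed.

Lemma odd_anticomm a b : godd a -> godd b -> a * b = - (b * a).
Proof.
move=> oa ob; rewrite (@gmul_comm (-1)) ?scaleN1r // => S T.
have [eS|/oa ->] := boolP (odd #|` S|); last by rewrite mul0r eqxx.
have [eT _|/ob ->] := boolP (odd #|` T|); last by rewrite mulr0 eqxx.
by rewrite -signr_odd oddM eS eT.
Qed.

End GrassmannBasics.

Section GrassmannNorm.
Variable R : realType.
Local Notation C := (cplx R).
Local Notation Lam := (Gr R).
Implicit Types (a b x : Lam) (D S T : {fset nat}) (l : R).

(** Anticommuting with itself gives 2 a a = 0, and the components lie in a field of characteristic
    0. *)
Lemma sqr_odd a : godd a -> a * a = 0.
Proof.
move=> oa; have /eqP := odd_anticomm oa oa; rewrite -subr_eq0 opprK => /eqP h.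
apply: coefP => U; have /(congr1 (fun b : Lam => coef b U)) := h.
rewrite coefD coef0 => /eqP; rewrite -mulr2n -mulr_natl mulf_eq0.
by rewrite pnatr_eq0 => /eqP.
Qed.

Definition nrm D l a : R := \sum_(S <- fpowerset D) l ^+ #|` S| * nC (coef a S).

(** Lets the sum run over the support of [a], the index set in which products are expanded. *)
Lemma nrmE D l a (d : {fset {fset nat}}) : (msupp a `<=` d)%fset ->
  nrm D l a = \sum_(S <- d | (S `<=` D)%fset) l ^+ #|` S| * nC (coef a S).
Proof.
move=> ad; rewrite [RHS]big_mkcond /=.
have -> : nrm D l a = \sum_(S <- fpowerset D)
    if (S `<=` D)%fset then l ^+ #|` S| * nC (coef a S) else 0.
  by rewrite /nrm big_seq [RHS]big_seq; apply: eq_bigr => S; rewrite fpowersetE => ->.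
rewrite (big_fset_incl _ (fsubsetUl _ d)); last first.
  by move=> S _; rewrite fpowersetE => /negbTE ->.
rewrite [RHS](big_fset_incl _ (fsubsetUr (fpowerset D) d)) // => S _ Sd.
suff -> : coef a S = 0 by rewrite nC0 mulr0 if_same.
by apply/eqP; rewrite -[_ == _]negbK coef_neq0; apply: contra Sd => /(fsubsetP ad).
Qed.

Lemma nrm_ge0 D l a : 0 <= l -> 0 <= nrm D l a.
Proof. by move=> l0; apply: sumr_ge0 => S _; rewrite mulr_ge0 ?exprn_ge0 ?nC_ge0. Qed.
Lemma nrm0 D l : nrm D l 0 = 0.
Proof. by rewrite /nrm big1 // => S _; rewrite coef0 nC0 mulr0. Qed.
Lemma nrmN D l a : nrm D l (- a) = nrm D l a.
Proof. by apply: eq_bigr => S _; rewrite coefN nCN. Qed.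
Lemma nrmD D l a b : 0 <= l -> nrm D l (a + b) <= nrm D l a + nrm D l b.
Proof.
move=> l0; rewrite /nrm -big_split; apply: ler_sum => S _ /=.
by rewrite -mulrDr coefD ler_wpM2l ?exprn_ge0 ?nCD.
Qed.
Lemma nrmB D l a b : 0 <= l -> nrm D l (a - b) <= nrm D l a + nrm D l b.
Proof. by move=> l0; rewrite -(nrmN D l b); exact: nrmD. Qed.
Lemma nrm_dist D l a b : nrm D l (a - b) = nrm D l (b - a).
Proof. by rewrite -nrmN opprB. Qed.
Lemma nrm_sum D l (I : Type) (r : seq I) (P : pred I) (f : I -> Lam) : 0 <= l ->
  nrm D l (\sum_(i <- r | P i) f i) <= \sum_(i <- r | P i) nrm D l (f i).
Proof.
move=> l0; elim/big_rec2: _ => [|i u v _ h]; first by rewrite nrm0.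
by apply: le_trans (nrmD _ _ _ l0) _; rewrite lerD2l.
Qed.
Lemma nrmZ D l (z : C) a : nrm D l (z *: a) = nC z * nrm D l a.
Proof.
by rewrite /nrm mulr_sumr; apply: eq_bigr => S _; rewrite coefZ nCM mulrCA.
Qed.
Lemma nrm1 D l : nrm D l 1 = 1.
Proof.
rewrite /nrm (big_fsetD1 fset0) ?fpowersetE ?fsub0set //= big1_fset ?addr0.
  by rewrite coef1 eqxx ?cardfs0 expr0 nC1 mulr1.
by move=> S; rewrite in_fsetD1 coef1 => /andP[/negbTE -> _] _; rewrite nC0 mulr0.
Qed.
Lemma nrmA D l (z : C) : nrm D l z%:A = nC z.
Proof. by rewrite nrmZ nrm1 mulr1. Qed.

(** A union lies in D iff both of its parts do, and the cardinal of a disjoint union is a sum, which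
    makes the weights multiplicative. Non-disjoint pairs contribute 0 on the left. *)
Lemma nrmM D l a b : 0 <= l -> nrm D l (a * b) <= nrm D l a * nrm D l b.
Proof.
move=> l0; rewrite (nrmE D l (fsubset_refl (msupp a))) (nrmE D l (fsubset_refl (msupp b))).
rewrite [X in nrm D l X](gmulw (fsubset_refl (msupp a)) (fsubset_refl (msupp b))).
apply: le_trans (nrm_sum _ _ _ _ l0) _; rewrite big_distrl /= [leRHS]big_mkcond /=.
apply: ler_sum => S _; apply: le_trans (nrm_sum _ _ _ _ l0) _.
have -> : (if (S `<=` D)%fset then l ^+ #|` S| * nC (coef a S) *
    (\sum_(T <- msupp b | (T `<=` D)%fset) l ^+ #|` T| * nC (coef b T)) else 0) =
  \sum_(T <- msupp b) if (S `<=` D)%fset && (T `<=` D)%fset then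
    l ^+ #|` S| * nC (coef a S) * (l ^+ #|` T| * nC (coef b T)) else 0.
  by case: ifP => SD /=; [rewrite mulr_sumr big_mkcond | rewrite big1].
apply: ler_sum => T _.
have -> : nrm D l (gmon (S `|` T)%fset (gsgn C S T * (coef a S * coef b T))) =
   if (S `<=` D)%fset && (T `<=` D)%fset then l ^+ #|` (S `|` T)%fset| *
     nC (gsgn C S T * (coef a S * coef b T)) else 0.
  rewrite (@nrmE D l _ [fset (S `|` T)%fset]%fset) ?msuppU_le //.
  rewrite big_mkcond big_seq_fset1 fsubUset coef_gmon eqxx.
  by case: ifP.
case: ifP => // _; rewrite /gsgn; case: ifP => dST.
  rewrite card_disjU // !nCM nCX nCN nC1 expr1n mul1r exprD.
  by rewrite mulrACA.
by rewrite mul0r nC0 mulr0 !mulr_ge0 ?exprn_ge0 ?nC_ge0.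
Qed.

Lemma nrmX D l a n : 0 <= l -> nrm D l (a ^+ n) <= nrm D l a ^+ n.
Proof.
move=> l0; elim: n => [|n IH]; first by rewrite !expr0 nrm1.
rewrite !exprS; apply: le_trans (nrmM _ _ _ l0) _.
by apply: ler_wpM2l => //; exact: nrm_ge0.
Qed.

Lemma coef_nrm D S a : (S `<=` D)%fset -> nC (coef a S) <= nrm D 1 a.
Proof.
move=> SD; rewrite /nrm (big_fsetD1 S) ?fpowersetE //= expr1n mul1r lerDl.
by apply: sumr_ge0 => T _; rewrite mulr_ge0 ?exprn_ge0 ?nC_ge0.
Qed.

(** Each non-empty monomial has weight at most l, so the soul costs at most l times its norm of
    weight 1. *)
Lemma nrm_body D l a : 0 <= l -> l <= 1 -> nrm D l a <= nC (body a) + l * nrm D 1 a.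
Proof.
move=> l0 l1; rewrite /nrm (big_fsetD1 fset0) ?fpowersetE ?fsub0set //=.
rewrite ?cardfs0 expr0 mul1r lerD2l.
rewrite [X in _ <= l * X](big_fsetD1 fset0) ?fpowersetE ?fsub0set //= mulrDr.
rewrite -[leLHS]add0r lerD ?mulr_ge0 ?exprn_ge0 ?nC_ge0 // mulr_sumr.
rewrite big_seq [leRHS]big_seq; apply: ler_sum => S; rewrite in_fsetD1 => /andP[S0 _].
rewrite expr1n mul1r ler_wpM2r ?nC_ge0 //.
move: S0; rewrite -cardfs_eq0 -lt0n; case: #|` S| => // n _.
by rewrite exprS ler_piMr // exprn_ile1.
Qed.

Lemma nrm_le1 D l a : 0 <= l -> l <= 1 -> nrm D l a <= nrm D 1 a.
Proof.
move=> l0 l1; apply: ler_sum => S _; rewrite ler_wpM2r ?nC_ge0 //.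
by rewrite expr1n exprn_ile1.
Qed.

(** The way back to weight 1 costs a constant that depends on D and l only, hence is harmless in
    limits. *)
Lemma nrm1_le D l a : 0 < l -> l <= 1 -> nrm D 1 a <= l ^- #|` D| * nrm D l a.
Proof.
move=> l0 l1; rewrite /nrm mulr_sumr big_seq [leRHS]big_seq; apply: ler_sum => S.
rewrite fpowersetE => /fsubset_leq_card SD.
rewrite expr1n mulrA ler_wpM2r ?nC_ge0 // -(subnK SD) exprD invfM -mulrA mulVf ?mulr1.
  by rewrite invf_ge1 ?exprn_gt0 // exprn_ile1 // ltW.
by rewrite expf_neq0 // gt_eqF.
Qed.

Lemma nrm_eq0 a b : (forall D, nrm D 1 (a - b) <= 0) -> a = b.
Proof.
move=> h; apply/eqP; rewrite -subr_eq0; apply/eqP/coefP => S; rewrite coef0.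
apply/eqP; rewrite -nC_eq0; apply/eqP/le_anti; rewrite nC_ge0 andbT.
exact: le_trans (coef_nrm _ (fsubset_refl S)) (h S).
Qed.

(** The spectral radius of x is the modulus of its body. A small weight l brings [nrm D l x] below
    r; then powers are estimated with weight l, and the return to weight 1 costs the constant A. *)
Lemma nrmX_bound D x (r : R) : nC (body x) < r ->
  exists2 A : R, 0 <= A & forall k, nrm D 1 (x ^+ k) <= A * r ^+ k.
Proof.
move=> xr; set d := r - nC (body x); have d0 : 0 < d by rewrite /d; lra.
have n0 : 0 <= nrm D 1 x by exact: nrm_ge0.
(* The soul may add at most d, the gap between r and the body; the 1 in the denominator guards
   against norm 0. *)
pose l : R := Order.min 1 (d / (nrm D 1 x + 1)).
have l0 : 0 < l by rewrite lt_min ltr01 divr_gt0 //; lra.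
have l1 : l <= 1 by rewrite ge_min lexx.
have lx : l * nrm D 1 x <= d.
  have : l <= d / (nrm D 1 x + 1) by rewrite ge_min lexx orbT.
  rewrite ler_pdivlMr; [nra | lra].
have xlr : nrm D l x <= r by apply: le_trans (nrm_body _ _ (ltW l0) l1) _; rewrite /d in lx; lra.
exists (l ^- #|` D|); first by rewrite invr_ge0 exprn_ge0 // ltW.
move=> k; apply: le_trans (nrm1_le _ _ l0 l1) _; apply: ler_wpM2l.
  by rewrite invr_ge0 exprn_ge0 // ltW.
apply: le_trans (nrmX _ _ _ (ltW l0)) _; apply: lerXn2r => //; rewrite nnegrE.
  exact/nrm_ge0/ltW.
exact: le_trans (nC_ge0 _) (ltW xr).
Qed.

Lemma vanishing_nrm D l (u : nat -> Lam) :
  (forall S, vanishing (fun n => nC (coef (u n) S))) ->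
  0 <= l -> vanishing (fun n => nrm D l (u n)).
Proof.
move=> h l0; apply: vanishing_sum => S _; apply: vanishingM => //; exact: exprn_ge0.
Qed.

Lemma vanishing_coef S (u : nat -> Lam) :
  (forall D, vanishing (fun n => nrm D 1 (u n))) ->
  vanishing (fun n => nC (coef (u n) S)).
Proof.
by move=> h; apply: vanishing_le (h S) => n; exact: coef_nrm.
Qed.

End GrassmannNorm.

(** * Power series with Grassmann coefficients *)

Section PowerSeries.
Variable R : realType.
Local Notation C := (cplx R).
Local Notation Lam := (Gr R).
Implicit Types (a b x y v : Lam) (c d : nat -> Lam) (D S T : {fset nat}) (l r e : R) (h k z : C).

Lemma algX (z : C) n : (z%:A : Lam) ^+ n = (z ^+ n)%:A.
Proof. by rewrite exprZn expr1n. Qed.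
Lemma algM (z w : C) : (z%:A : Lam) * w%:A = (z * w)%:A.
Proof. by rewrite -scalerAl mul1r scalerA. Qed.
Lemma alg_comm (z : C) a : (z%:A : Lam) * a = a * z%:A.
Proof. by rewrite -scalerAl mul1r -scalerAr mulr1. Qed.
Lemma algD (z w : C) : ((z + w)%:A : Lam) = z%:A + w%:A.
Proof. exact: scalerDl. Qed.
Lemma algB (z w : C) : ((z - w)%:A : Lam) = z%:A - w%:A.
Proof. exact: scalerBl. Qed.
Lemma alg_inj (z w : C) : (z%:A : Lam) = w%:A -> z = w.
Proof. by move=> zw; rewrite -[LHS](@bodyA C) zw bodyA. Qed.
Lemma nrm_tri D a b v : nrm D 1 (a - v) <= nrm D 1 (a - b) + nrm D 1 (b - v).
Proof. by rewrite -(subrKA b a (- v)); exact: nrmD. Qed.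
Lemma nrm_tri_r D a b v : nrm D 1 (a - v) <= nrm D 1 (b - a) + nrm D 1 (b - v).
Proof. by rewrite (nrm_dist D 1 b a); exact: nrm_tri. Qed.
Lemma nrm_distD D a b v w :
  nrm D 1 ((a + b) - (v + w)) <= nrm D 1 (a - v) + nrm D 1 (b - w).
Proof. by rewrite opprD addrACA; exact: nrmD. Qed.
Lemma nrm_distB D a b v w :
  nrm D 1 ((a - b) - (v - w)) <= nrm D 1 (a - v) + nrm D 1 (b - w).
Proof. by apply: le_trans (nrm_distD _ _ _ _ _) _; rewrite -opprD nrmN. Qed.

Definition psum c x N : Lam := \sum_(n < N) c n * x ^+ n.
(** The same as convergence of every component, since a finite D has finitely many subsets
    ([vanishing_nrm]) and every S lies in some D ([coef_nrm]); seminorms are better suited to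
    products. *)
Definition scvg c x v := forall D, vanishing (fun N => nrm D 1 (psum c x N - v)).
Definition wsum D l r c N : R := \sum_(n < N) nrm D l (c n) * r ^+ n.

Lemma psumD c d x N : psum (fun n => c n + d n) x N = psum c x N + psum d x N.
Proof. by rewrite /psum -big_split; apply: eq_bigr => i _; rewrite mulrDl. Qed.
Lemma psumB c d x N : psum (fun n => c n - d n) x N = psum c x N - psum d x N.
Proof. by rewrite /psum -sumrB; apply: eq_bigr => i _; rewrite mulrBl. Qed.
Lemma psumS c x N : psum c x N.+1 = psum c x N + c N * x ^+ N.
Proof. by rewrite /psum big_ord_recr. Qed.
Lemma psum_nat c x N P : (N <= P)%N ->
  psum c x P = psum c x N + \sum_(N <= n < P) c n * x ^+ n.
Proof.
move=> NP; rewrite /psum -!(big_mkord xpredT (fun n => c n * x ^+ n)).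
exact: big_cat_nat.
Qed.

Lemma scvg_uniq c x v w : scvg c x v -> scvg c x w -> v = w.
Proof.
move=> cv cw; apply: nrm_eq0 => D; apply: vanishing_cst.
by apply: vanishing_le (vanishingD (cv D) (cw D)) => n; exact: nrm_tri_r.
Qed.

Lemma scvgB c d x v w : scvg c x v -> scvg d x w -> scvg (fun n => c n - d n) x (v - w).
Proof.
move=> cv dw D; apply: vanishing_le (vanishingD (cv D) (dw D)) => n.
by rewrite psumB; exact: nrm_distB.
Qed.

Lemma scvgD c d x v w : scvg c x v -> scvg d x w -> scvg (fun n => c n + d n) x (v + w).
Proof.
move=> cv dw D; apply: vanishing_le (vanishingD (cv D) (dw D)) => n.
by rewrite psumD; exact: nrm_distD.
Qed.

Lemma wsum_ge0 D l r c N : 0 <= l -> 0 <= r -> 0 <= wsum D l r c N.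
Proof. by move=> l0 r0; apply: sumr_ge0 => i _; rewrite mulr_ge0 ?nrm_ge0 ?exprn_ge0. Qed.

Lemma vanishing_bounded (u : nat -> R) : vanishing u -> exists B, forall n, u n <= B.
Proof.
move=> /(_ 1 ltr01)[N uN].
have [B hB] : exists B, forall n, (n < N)%N -> u n <= B.
  elim: N {uN} => [|N [B hB]]; first by exists 0.
  exists (Order.max B (u N)) => n; rewrite ltnS leq_eqVlt => /orP[/eqP ->|/hB nB].
    by rewrite le_max lexx orbT.
  by rewrite le_max nB.
exists (Order.max B 1) => n; have [/uN/ltW un|/hB un] := leqP N n.
  by rewrite le_max un orbT.
by rewrite le_max un.
Qed.

Lemma geo_sum_le (t : R) N : 0 <= t -> t < 1 -> \sum_(n < N) t ^+ n <= (1 - t)^-1.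
Proof.
move=> t0 t1; rewrite -[leRHS]mul1r ler_pdivlMr ?subr_gt0 //.
have -> : (\sum_(n < N) t ^+ n) * (1 - t) = 1 - t ^+ N.
  by rewrite mulrC -[RHS]opprB subrX1 -mulNr opprB.
by rewrite lerBlDr lerDl exprn_ge0.
Qed.

(** Abel's lemma: the terms at r' are differences of consecutive partial sums, hence bounded by some
    B, and the sums at r are compared with the geometric series of ratio r / r'. *)
Lemma scvg_wsum D c (r' r : R) v : scvg c (toC r')%:A v -> 0 <= r -> r < r' ->
  exists2 M, 0 <= M & forall N, wsum D 1 r c N <= M.
Proof.
move=> cv r0 rr'; have r'0 : 0 < r' by exact: le_lt_trans rr'.
have : vanishing (fun n => nrm D 1 (c n) * r' ^+ n).
  have := vanishingD (cv D) (vanishing_shift 1 (cv D)); apply: vanishing_le => n.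
  have -> : nrm D 1 (c n) * r' ^+ n = nrm D 1 (psum c (toC r')%:A n.+1 - psum c (toC r')%:A n).
    rewrite psumS [X in _ = nrm _ _ (X - _)]addrC addrK algX -scalerAr mulr1 nrmZ nCX nC_toC.
    by rewrite ger0_norm ?(ltW r'0) // mulrC.
  have := nrm_tri D (psum c (toC r')%:A n.+1) v (psum c (toC r')%:A n).
  by rewrite addn1 (nrm_dist D 1 v); lra.
move=> /vanishing_bounded[B hB]; have B0 : 0 <= B.
  by apply: le_trans (hB 0%N); rewrite mulr_ge0 ?nrm_ge0.
have t0 : 0 <= r / r' by rewrite divr_ge0 // ltW.
have t1 : r / r' < 1 by rewrite ltr_pdivrMr // mul1r.
exists (B * (1 - r / r')^-1) => [|N].
  by rewrite mulr_ge0 // invr_ge0 subr_ge0 ltW.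
apply: le_trans (ler_wpM2l B0 (geo_sum_le N t0 t1)); rewrite mulr_sumr.
apply: ler_sum => i _; rewrite expr_div_n mulrA ler_pdivlMr ?exprn_gt0 //.
by rewrite mulrAC ler_wpM2r ?exprn_ge0.
Qed.

(** Writing r0^n = (r0 / r)^n r^n splits each term into a geometric factor, at most (r0 / r)^N, and
    a term of the majorant at r. The constant A absorbs the soul of x, as in [nrmX_bound]. *)
Lemma psum_tail D l c x A r0 r M N P : 0 <= l -> (N <= P)%N ->
  0 <= r0 -> r0 <= r -> 0 < r -> 0 <= A ->
  (forall j, nrm D l (x ^+ j) <= A * r0 ^+ j) ->
  (forall K, wsum D l r c K <= M) ->
  nrm D l (psum c x P - psum c x N) <= A * M * (r0 / r) ^+ N.
Proof.
move=> l0 NP r00 r0r r1 A0 hA hM.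
have t0 : 0 <= r0 / r by rewrite divr_ge0 // ltW.
have t1 : r0 / r <= 1 by rewrite ler_pdivrMr // mul1r.
rewrite (psum_nat _ _ NP) [X in nrm _ _ (X - _)]addrC addrK.
apply: le_trans (nrm_sum _ _ _ _ l0) _.
apply: (@le_trans _ _ (\sum_(N <= n < P) A * (r0 / r) ^+ N * (nrm D l (c n) * r ^+ n))).
  rewrite big_nat [leRHS]big_nat; apply: ler_sum => n /andP[Nn _].
  apply: le_trans (nrmM _ _ _ l0) _.
  apply: le_trans (ler_wpM2l (nrm_ge0 _ _ l0) (hA n)) _.
  have -> : r0 ^+ n = (r0 / r) ^+ n * r ^+ n by rewrite -exprMn divfK ?gt_eqF.
  have : (r0 / r) ^+ n <= (r0 / r) ^+ N by exact: ler_wiXn2l.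
  have : 0 <= A * (nrm D l (c n) * r ^+ n).
    by rewrite !mulr_ge0 ?nrm_ge0 ?exprn_ge0 ?(ltW r1).
  move: (nrm D l (c n)) (r ^+ n) (_ ^+ n) (_ ^+ N) => u1 u2 u3 u4; nra.
rewrite -mulr_sumr mulrAC ler_wpM2r ?exprn_ge0 // ler_wpM2l //.
apply: le_trans (hM P); rewrite /wsum -(big_mkord xpredT (fun n => nrm D l (c n) * r ^+ n)).
rewrite [leRHS](big_cat_nat _ NP) //= lerDr; apply: sumr_ge0 => i _.
by rewrite mulr_ge0 ?nrm_ge0 ?exprn_ge0 // ltW.
Qed.

Lemma scvg_tail D c x v A r0 r M N : 
  0 <= r0 -> r0 <= r -> 0 < r -> 0 <= A -> scvg c x v ->
  (forall j, nrm D 1 (x ^+ j) <= A * r0 ^+ j) ->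
  (forall K, wsum D 1 r c K <= M) ->
  nrm D 1 (v - psum c x N) <= A * M * (r0 / r) ^+ N.
Proof.
move=> r00 r0r r1 A0 cv hA hM; rewrite -subr_le0; apply: vanishing_cst.
apply: (@vanishing_near _ _ _ N _ (cv D)) => P NP.
have := psum_tail ler01 NP r00 r0r r1 A0 hA hM.
have := nrm_tri_r D v (psum c x P) (psum c x N); lra.
Qed.

Lemma nrm_real D (t : R) j : 0 <= t -> nrm D 1 ((toC t)%:A ^+ j) <= 1 * t ^+ j.
Proof. by move=> t0; rewrite algX nrmA nCX nC_toC ger0_norm // mul1r. Qed.

(** Strong induction: if the coefficients below n vanish, the term c_n t^n is bounded by the tail
    after it, of order t^(n+1); dividing by t^n and letting t tend to 0 gives c_n = 0. Positive real
    arguments are enough for this. *)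
Lemma series_zero c e : 0 < e ->
  (forall t, 0 < t -> t < e -> scvg c (toC t)%:A 0) -> forall n, c n = 0.
Proof.
move=> e0 c0 n; apply: nrm_eq0 => D; rewrite subr0.
elim/ltn_ind: n => n IH.
have r0 : 0 < e / 4%:R by lra. set r := e / 4%:R in r0.
have [M M0 hM] : exists2 M, 0 <= M & forall N, wsum D 1 r c N <= M.
  apply: (@scvg_wsum _ _ (e / 2%:R) _ 0) => //; [apply: c0 | exact: ltW | rewrite /r]; lra.
rewrite leNgt; apply/negP => cn.
have h t : 0 < t -> t <= r -> nrm D 1 (c n) <= M / r ^+ n.+1 * t.
  move=> t0 tr; have te : t < e by apply: le_lt_trans tr _; rewrite /r; lra.
  have := @scvg_tail D c (toC t)%:A 0 1 t r M n.+1 (ltW t0) tr r0 ler01 (c0 t t0 te)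
    (fun j => nrm_real D j (ltW t0)) hM.
  rewrite sub0r nrmN mul1r.
  have : nrm D 1 (c n) * t ^+ n <= nrm D 1 (psum c (toC t)%:A n.+1).
    rewrite /psum big_ord_recr /= [_ + c n * _]addrC.
    have -> : nrm D 1 (c n) * t ^+ n = nrm D 1 (c n * (toC t)%:A ^+ n).
      by rewrite algX -scalerAr mulr1 nrmZ nCX nC_toC ger0_norm ?(ltW t0) // mulrC.
    set a := c n * _; set s := \sum_(i < n) _.
    have s0 : nrm D 1 s <= 0.
      apply: le_trans (nrm_sum _ _ _ _ ler01) _; apply: sumr_le0 => i _.
      apply: le_trans (nrmM _ _ _ ler01) _; rewrite mulr_le0_ge0 ?nrm_ge0 //.
      exact: IH.
    have := nrmB D (a + s) s ler01; rewrite addrK; lra.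
  move=> h1 /(le_trans h1); rewrite expr_div_n [t ^+ n.+1]exprS mulrA mulrAC.
  by rewrite mulrA ler_pM2r ?exprn_gt0.
pose B := M / r ^+ n.+1.
have B0 : 0 <= B by rewrite divr_ge0 // exprn_ge0 // ltW.
(* With this t the right-hand side B t of [h] is at most half of [nrm D 1 (c n)], a
   contradiction. *)
pose t := Order.min r (nrm D 1 (c n) / (2%:R * (B + 1))).
have t0 : 0 < t by rewrite lt_min r0 divr_gt0 //; lra.
have /(h _ t0) : t <= r by rewrite ge_min lexx.
have : t <= nrm D 1 (c n) / (2%:R * (B + 1)) by rewrite ge_min lexx orbT.
rewrite ler_pdivlMr -/B; [nra | lra].
Qed.

Lemma series_uniq c d e (F : R -> Lam) : 0 < e ->
  (forall t, 0 < t -> t < e -> scvg c (toC t)%:A (F t)) ->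
  (forall t, 0 < t -> t < e -> scvg d (toC t)%:A (F t)) -> c = d.
Proof.
move=> e0 hc hd; apply/funext => n; apply/eqP; rewrite -subr_eq0; apply/eqP.
apply: (@series_zero (fun n => c n - d n) e e0) => t t0 te.
by rewrite -(subrr (F t)); apply: scvgB; [exact: hc|exact: hd].
Qed.

Lemma binom_wide (a b : C) (m N : nat) : (m < N)%N ->
  (a + b) ^+ m = \sum_(i < N) (a ^+ (m - i) * b ^+ i) *+ 'C(m, i).
Proof.
move=> mN; rewrite exprDn (big_ord_widen N (fun i => (a ^+ (m - i) * b ^+ i) *+ 'C(m, i))) //.
rewrite big_mkcond; apply: eq_bigr => i _; case: ifP => // /negbT.
by rewrite -leqNgt => mi; rewrite bin_small // mulr0n.
Qed.

Lemma binom_wideR (a b : R) (m N : nat) : (m < N)%N ->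
  (a + b) ^+ m = \sum_(i < N) (a ^+ (m - i) * b ^+ i) *+ 'C(m, i).
Proof.
move=> mN; rewrite exprDn (big_ord_widen N (fun i => (a ^+ (m - i) * b ^+ i) *+ 'C(m, i))) //.
rewrite big_mkcond; apply: eq_bigr => i _; case: ifP => // /negbT.
by rewrite -leqNgt => mi; rewrite bin_small // mulr0n.
Qed.

Lemma nrm_1A D z : nrm D 1 (z%:A : Lam) = nC z. Proof. exact: nrmA. Qed.

Lemma psum_alg (f : nat -> C) z N :
  psum (fun n => (f n)%:A) z%:A N = (\sum_(n < N) f n * z ^+ n)%:A.
Proof.
rewrite /psum scaler_suml; apply: eq_bigr => i _.
by rewrite algX algM.
Qed.

Definition ccvg (f : nat -> C) z w := vanishing (fun N => nC (\sum_(n < N) f n * z ^+ n - w)).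

Lemma ccvgP f z w : ccvg f z w <-> scvg (fun n => (f n)%:A) z%:A w%:A.
Proof.
split=> [h D|/(_ fset0) h].
  by apply: vanishing_le h => n; rewrite psum_alg -algB nrm_1A.
by apply: vanishing_le h => n; rewrite psum_alg -algB nrm_1A.
Qed.

Lemma scvg_ccvg c z v S : scvg c z%:A v -> ccvg (fun n => coef (c n) S) z (coef v S).
Proof.
move=> cv; apply: vanishing_le (vanishing_coef S cv) => n.
rewrite coefB /psum coef_sum; under [X in _ <= nC (X - _)]eq_bigr do
  rewrite algX -scalerAr mulr1 coefZ mulrC.
by [].
Qed.

Lemma ccvg_scvg c z v : (forall S, ccvg (fun n => coef (c n) S) z (coef v S)) ->
  scvg c z%:A v.
Proof.
move=> h D; apply: vanishing_nrm => // S; apply: vanishing_le (h S) => n.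
rewrite coefB /psum coef_sum; under eq_bigr do
  rewrite algX -scalerAr mulr1 coefZ mulrC.
by [].
Qed.

(* Weierstrass' double series theorem for the recentering of a power series;
   the new coefficients converge absolutely, and are then identified by
   uniqueness. *)
Lemma ccvg_recenter_ex (f : nat -> C) (phi : C -> C) (e : R) h0 : nC h0 < e ->
  (forall h, nC h < e -> ccvg f h (phi h)) ->
  exists g : nat -> C,
    (forall n, vanishing (fun M => nC (\sum_(m < M) (f m * h0 ^+ (m - n)) *+ 'C(m, n) - g n))) /\
    forall k, nC k < (e - nC h0) / 4%:R -> ccvg g k (phi (h0 + k)).
Proof.
(* A quarter of the gap between |h0| and e leaves room for the majorant at r = |h0| + 2 dl, obtained
   from convergence at r + dl, which is still below e. *)
move=> h0e hf; pose dl := (e - nC h0) / 4%:R.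
have dl0 : 0 < dl by rewrite divr_gt0 ?subr_gt0.
have dle : dl <= (e - nC h0) / 4%:R by [].
pose r := nC h0 + 2%:R * dl; have n0 := nC_ge0 h0.
have [M0 M00 hM0] : exists2 M, 0 <= M & forall N,
    \sum_(n < N) nC (f n) * r ^+ n <= M.
  have [|||M M0 hM] := @scvg_wsum fset0 (fun n => (f n)%:A) (r + dl) r (phi (toC (r + dl)))%:A.
  - apply/ccvgP; apply: hf; rewrite nC_toC ger0_norm /r; lra.
  - by rewrite /r; lra.
  - by rewrite ltrDl.
  exists M => // N; apply: le_trans (hM N); apply: ler_sum => i _.
  by rewrite nrm_1A.
pose t j m : C := (f m * h0 ^+ (m - j)) *+ 'C(m, j).
have tE j m : nC (t j m) = nC (f m) * nC h0 ^+ (m - j) *+ 'C(m, j).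
  by rewrite /t -mulr_natr !nCM nCX nCn mulr_natr.
(* The part j < N <= m of the double series. By the binomial formula its sum over j is at most |f_m|
   (|h0| + k)^m, and |h0| + k stays below r. *)
have tail (k : R) N P : 0 <= k -> k <= 2%:R * dl -> (N <= P)%N ->
    \sum_(j < N) \sum_(N <= m < P) nC (t j m) * k ^+ j <= M0 * ((nC h0 + k) / r) ^+ N.
  move=> k0 kdl NP; rewrite exchange_big /=.
  have r0 : 0 < r by rewrite /r; lra.
  have q0 : 0 <= (nC h0 + k) / r by rewrite divr_ge0 //; lra.
  have q1 : (nC h0 + k) / r <= 1 by rewrite ler_pdivrMr // mul1r /r; lra.
  apply: (@le_trans _ _ (\sum_(N <= m < P) nC (f m) * r ^+ m * ((nC h0 + k) / r) ^+ N)).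
    rewrite big_nat [leRHS]big_nat; apply: ler_sum => m /andP[Nm _].
    apply: (@le_trans _ _ (nC (f m) * (nC h0 + k) ^+ m)).
      rewrite (@binom_wideR _ _ m m.+1) // mulr_sumr.
      rewrite (big_ord_widen m.+1 (fun j => nC (t j m) * k ^+ j)); last exact: leqW.
      rewrite big_mkcond; apply: ler_sum => j _; case: ifP => _.
        by rewrite tE mulrnAl -mulrA mulrnAr.
      by rewrite mulr_ge0 ?nC_ge0 // mulrn_wge0 // mulr_ge0 ?exprn_ge0.
    have -> : (nC h0 + k) ^+ m = ((nC h0 + k) / r) ^+ m * r ^+ m.
      by rewrite -exprMn divfK ?gt_eqF.
    rewrite -mulrA; apply: ler_wpM2l; first exact: nC_ge0.
    by rewrite mulrC; apply: ler_wpM2l; [rewrite exprn_ge0 // ltW | exact: ler_wiXn2l].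
  rewrite -mulr_suml ler_wpM2r ?exprn_ge0 //; apply: le_trans (hM0 P).
  rewrite -(big_mkord xpredT (fun n => nC (f n) * r ^+ n)) [leRHS](big_cat_nat _ NP) //= lerDr.
  by apply: sumr_ge0 => i _; rewrite mulr_ge0 ?nC_ge0 ?exprn_ge0 // ltW.
(* The term |t j m| dl^j is one of the summands in the binomial expansion of |f_m| (|h0| + dl)^m, so
   the series of the new j-th coefficient converges absolutely. *)
have sumt j M : \sum_(m < M) nC (t j m) <= M0 / dl ^+ j.
  rewrite ler_pdivlMr ?exprn_gt0 // mulr_suml.
  apply: le_trans (hM0 M); apply: ler_sum => m _.
  apply: (@le_trans _ _ (nC (f m) * (nC h0 + dl) ^+ m)); last first.
    apply: ler_wpM2l; first exact: nC_ge0.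
    by apply: lerXn2r; rewrite ?nnegrE /r; lra.
  have [mj|jm] := ltnP m j.
    rewrite /t bin_small // mulr0n nC0 mul0r.
    by rewrite mulr_ge0 ?nC_ge0 // exprn_ge0 //; lra.
  rewrite (@binom_wideR _ _ m m.+1) // mulr_sumr tE.
  rewrite (bigD1 (Ordinal (n:=m.+1) (m:=j) jm)) //= mulrnAl -mulrA mulrnAr lerDl.
  apply: sumr_ge0 => i _; rewrite mulr_ge0 ?nC_ge0 // mulrn_wge0 // mulr_ge0 ?exprn_ge0 //.
  exact: ltW.
have [g gP] : exists g : nat -> C, forall j,
    vanishing (fun M => nC (\sum_(m < M) t j m - g j)).
  exists (fun j => sval (cid (abs_summable (sumt j)))) => j.
  exact: svalP (cid (abs_summable (sumt j))).
have gphi k : nC k < dl -> ccvg g k (phi (h0 + k)).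
  move=> kdl; have hk : nC (h0 + k) < e by apply: le_lt_trans (nCD _ _) _; lra.
  have k0 := nC_ge0 k.
  have r0 : 0 < r by rewrite /r; lra.
  pose q := (nC h0 + nC k) / r.
  have q0 : 0 <= q by rewrite divr_ge0 //; lra.
  have q1 : q < 1 by rewrite ltr_pdivrMr // mul1r /r; lra.
  apply: vanishing_le (vanishingD (vanishingM M00 (vanishing_geo q0 q1)) (hf _ hk)) => N.
  pose T j N : C := \sum_(m < N) t j m.
  have -> : \sum_(m < N) f m * (h0 + k) ^+ m = \sum_(j < N) T j N * k ^+ j.
    under [RHS]eq_bigr do rewrite mulr_suml.
    rewrite exchange_big /=; apply: eq_bigr => m _.
    rewrite (@binom_wide _ _ _ N) // mulr_sumr; apply: eq_bigr => j _.
    by rewrite /t mulrnAl mulrnAr mulrA.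
  apply: (@le_trans _ _ (\sum_(j < N) nC (g j - T j N) * nC k ^+ j +
      nC (\sum_(j < N) T j N * k ^+ j - phi (h0 + k)))).
    rewrite -(subrKA (\sum_(j < N) T j N * k ^+ j)); apply: le_trans (nCD _ _) _.
    rewrite lerD2r -sumrB; apply: le_trans (nC_sum _ _ _) _; apply: ler_sum => j _.
    by rewrite -mulrBl nCM nCX.
  (* The coefficients g_j are replaced by partial sums up to a large P; what remains between N and P
     is bounded by [tail]. *)
  rewrite lerD2r -subr_le0; apply: vanishing_cst.
  have : vanishing (fun P => \sum_(j < N) nC k ^+ j * nC (T j P - g j)).
    by apply: vanishing_sum => j _; apply: vanishingM; [exact: exprn_ge0 | exact: gP].
  apply: (@vanishing_near _ _ _ N) => P NP.
  have kdl2 : nC k <= 2%:R * dl by lra.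
  have := tail _ _ _ k0 kdl2 NP; rewrite -/q => tl.
  rewrite lerBlDr; apply: le_trans (lerD (lexx _) tl); rewrite -big_split /=.
  apply: ler_sum => j _; rewrite -mulr_suml [nC k ^+ j * _]mulrC -mulrDl.
  rewrite ler_wpM2r ?exprn_ge0 // nC_dist -(subrKA (T j P)) addrC.
  apply: le_trans (nCD _ _) _; rewrite lerD2l nC_dist.
  rewrite /T -!(big_mkord xpredT (t j)) (big_cat_nat _ NP) //= addrAC subrr add0r.
  exact: nC_sum.
by exists g.
Qed.

Lemma ccvg_uniq (f f' : nat -> C) (phi : C -> C) (e : R) : 0 < e ->
  (forall t, 0 < t -> t < e -> ccvg f (toC t) (phi (toC t))) ->
  (forall t, 0 < t -> t < e -> ccvg f' (toC t) (phi (toC t))) -> f = f'.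
Proof.
move=> e0 hf hf'; have : (fun n => (f n)%:A : Lam) = (fun n => (f' n)%:A).
  apply: (@series_uniq _ _ e (fun s => (phi (toC s))%:A)) => // s s0 se;
    apply/ccvgP; [exact: hf | exact: hf'].
by move=> gf; apply/funext => j; apply: alg_inj; exact: (congr1 (@^~ j) gf).
Qed.

Lemma ccvg_recenter (f f' : nat -> C) (phi : C -> C) (e e' : R) h0 n : 
  nC h0 < e -> 0 < e' ->
  (forall h, nC h < e -> ccvg f h (phi h)) ->
  (forall k, nC k < e' -> ccvg f' k (phi (h0 + k))) ->
  vanishing (fun M => nC (\sum_(m < M) (f m * h0 ^+ (m - n)) *+ 'C(m, n) - f' n)).
Proof.
move=> h0e e'0 hf hf'; have [g [gP gphi]] := ccvg_recenter_ex h0e hf.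
suff -> : f' = g by [].
have d0 : 0 < (e - nC h0) / 4%:R by rewrite divr_gt0 ?subr_gt0.
apply: (@ccvg_uniq _ _ (fun k => phi (h0 + k)) (Order.min e' ((e - nC h0) / 4%:R))).
- by rewrite lt_min e'0.
- by move=> t t0; rewrite lt_min => /andP[h1 _]; apply: hf'; rewrite nC_toC ger0_norm // ltW.
- by move=> t t0; rewrite lt_min => /andP[_ h1]; apply: gphi; rewrite nC_toC ger0_norm // ltW.
Qed.

End PowerSeries.

(** * Super-analytic functions *)

Section SuperAnalytic.
Variable R : realType.
Local Notation C := (cplx R).
Local Notation Lam := (Gr R).
Implicit Types (a b x y s v w : Lam) (c d : nat -> Lam) (D S T : {fset nat}) (l r e : R) (h k z : C).
Implicit Types (F G H : Lam -> Lam) (V : set C).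

Definition soul x : Lam := x - (body x)%:A.

Lemma soulE x : x = (body x)%:A + soul x.
Proof. by rewrite /soul addrC subrK. Qed.
Lemma body_soul x : body (soul x) = 0.
Proof. by rewrite bodyB bodyA subrr. Qed.
Lemma geven_soul x : geven x -> geven (soul x).
Proof. by move=> ex; apply: gevenB => //; exact: gevenA. Qed.
Lemma body_zx z x : body (z%:A + x) = z + body x.
Proof. by rewrite bodyD bodyA. Qed.
Lemma soul_zx z x : soul (z%:A + x) = soul x.
Proof. by rewrite /soul body_zx algD opprD addrACA subrr add0r. Qed.

Lemma expr_ge0 s (L n : nat) : s ^+ L = 0 -> (L <= n)%N -> s ^+ n = 0.
Proof. by move=> sL Ln; rewrite -(subnK Ln) exprD sL mulr0. Qed.

Lemma sum_trunc (A : zmodType) (f : nat -> A) (N k : nat) :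
  (forall i, (N <= i)%N -> f i = 0) -> \sum_(i < N + k) f i = \sum_(i < N) f i.
Proof.
move=> f0; rewrite big_split_ord /= [X in _ + X]big1 ?addr0 // => i _.
by apply: f0; exact: leq_addr.
Qed.

Lemma psum_nilp c s (L N : nat) : s ^+ L = 0 -> (L <= N)%N -> psum c s N = psum c s L.
Proof.
move=> sL LN; rewrite -(subnKC LN) /psum (@sum_trunc _ (fun i => c i * s ^+ i)) //.
by move=> i Li; rewrite (expr_ge0 sL Li) mulr0.
Qed.

Lemma psum_nilp2 c s (L L' : nat) : s ^+ L = 0 -> s ^+ L' = 0 -> psum c s L = psum c s L'.
Proof.
move=> sL sL'; have [LL'|/ltnW L'L] := leqP L L'; first by rewrite -(psum_nilp c sL LL').
by rewrite (psum_nilp c sL' L'L).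
Qed.

Lemma alg_exprD h s (L m : nat) : s ^+ L = 0 ->
  (h%:A + s) ^+ m = \sum_(i < L) (h ^+ (m - i) *+ 'C(m, i)) *: s ^+ i.
Proof.
move=> sL; pose f i : Lam := (h ^+ (m - i) *+ 'C(m, i)) *: s ^+ i.
rewrite -(@sum_trunc _ f L m.+1); last by move=> i Li; rewrite /f (expr_ge0 sL Li) scaler0.
rewrite addnC sum_trunc; last by move=> i mi; rewrite /f bin_small // mulr0n scale0r.
rewrite exprDn_comm; last exact: alg_comm.
by apply: eq_bigr => i _; rewrite /f algX -scalerAl mul1r scalerMnl.
Qed.

(** Separates body from soul: a partial sum at h + s is a polynomial in s of degree below the fixed
    L, with partial sums of the series recentered at h as coefficients. *)
Lemma psum_soul c h s (L M : nat) : s ^+ L = 0 ->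
  psum c (h%:A + s) M =
  \sum_(i < L) (\sum_(m < M) (h ^+ (m - i) *+ 'C(m, i)) *: c m) * s ^+ i.
Proof.
move=> sL; rewrite /psum; under [RHS]eq_bigr do rewrite mulr_suml.
rewrite exchange_big /=; apply: eq_bigr => m _; rewrite (alg_exprD h m sL) mulr_sumr.
by apply: eq_bigr => i _; rewrite -scalerAr scalerAl.
Qed.

Lemma scvg_recenter c c' (phi : C -> Lam) (e e' : R) h0 n D :
  nC h0 < e -> 0 < e' ->
  (forall h, nC h < e -> scvg c h%:A (phi h)) ->
  (forall k, nC k < e' -> scvg c' k%:A (phi (h0 + k))) ->
  vanishing (fun M => nrm D 1 (\sum_(m < M) (h0 ^+ (m - n) *+ 'C(m, n)) *: c m - c' n)).
Proof.
move=> h0e e'0 hc hc'; apply: vanishing_nrm => // S.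
have := @ccvg_recenter R (fun m => coef (c m) S) (fun m => coef (c' m) S)
  (fun h => coef (phi h) S) e e' h0 n h0e e'0
  (fun h he => scvg_ccvg S (hc h he)) (fun k ke => scvg_ccvg S (hc' k ke)).
apply: vanishing_le => M; rewrite coefB coef_sum.
rewrite (eq_bigr (fun m : 'I_M => (coef (c m) S * h0 ^+ (m - n)) *+ 'C(m, n))) // => m _.
by rewrite coefZ mulrnAl mulrC.
Qed.

(* Unlike in taylor, the body and the soul of x vary together, so that no
   recentering is needed for products and compositions. *)
Definition ext e F z c := forall x, geven x -> nC (body x) < e -> scvg c x (F (z%:A + x)).

Lemma taylor_scvg F z c : taylor F z c ->
  exists2 e : R, 0 < e & forall h, nC h < e -> scvg c h%:A (F (z + h)%:A).
Proof.
move=> [[_ /toC_gt0[e e0 ->] he] _]; exists e => // h hlt.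
apply: ccvg_scvg => S; have /he/(_ S)/cvgCP : `|h| < toC e by rewrite normC_lt.
by apply: vanishing_le => n; rewrite /series /= big_mkord.
Qed.

Lemma taylor_uniq F z c d : taylor F z c -> taylor F z d -> c = d.
Proof.
move=> /taylor_scvg[e e0 hc] /taylor_scvg[e' e'0 hd].
apply: (@series_uniq R c d (Order.min e e') (fun t => F (z + toC t)%:A)).
- by rewrite lt_min e0.
- by move=> t t0; rewrite lt_min => /andP[te _]; apply: hc; rewrite nC_toC ger0_norm // ltW.
- by move=> t t0; rewrite lt_min => /andP[_ te]; apply: hd; rewrite nC_toC ger0_norm // ltW.
Qed.

Lemma ext_taylor e F z c : 0 < e -> ext e F z c -> taylor F z c.
Proof.
move=> e0 he; split.
  exists (toC e); first by rewrite -toC0 toC_lt.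
  move=> h; rewrite normC_lt => hlt S; apply/cvgCP.
  have := he h%:A (gevenA h); rewrite bodyA -algD => /(_ hlt)/(scvg_ccvg S).
  by apply: vanishing_le => n; rewrite /series /= big_mkord.
move=> s N es s0 sN; have : scvg c s (F (z%:A + s)).
  by apply: he; rewrite // s0 nC0.
move=> /scvg_uniq; apply => D e1 e10; exists N => n Nn.
by rewrite (psum_nilp c sN Nn) subrr nrm0.
Qed.

(** By [taylor] at the point z + body x, the value of F is a finite sum in the soul with
    coefficients c' i. The coefficients of [psum_soul] converge to exactly these, by recentering
    along the body. *)
Lemma taylor_ext V F z c e : super_analytic V F -> 
  (forall h, nC h < e -> V (z + h)) ->
  (forall h, nC h < e -> scvg c h%:A (F (z + h)%:A)) -> ext e F z c.
Proof.
move=> aF zV hc x ex xe; set h := body x.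
have [c' tc'] := aF _ (zV _ xe); have [e' e'0 hc'] := taylor_scvg tc'.
have [L sL] := soul_nilpotent (body_soul x).
have FE : F (z%:A + x) = psum c' (soul x) L.
  rewrite {1}[x]soulE addrA -algD; apply: (proj2 tc') => //; first exact: geven_soul.
  exact: body_soul.
move=> D; rewrite FE {1}[x]soulE.
have : vanishing (fun M => \sum_(i < L) nrm D 1 (soul x ^+ i) *
   nrm D 1 (\sum_(m < M) (h ^+ (m - i) *+ 'C(m, i)) *: c m - c' i)).
  apply: vanishing_sum => i _; apply: vanishingM; first exact: nrm_ge0.
  apply: (@scvg_recenter c c' (fun h => F (z + h)%:A) e e' h i D xe e'0 hc) => k ke.
  by rewrite addrA; exact: hc'.
apply: vanishing_le => M; rewrite (psum_soul _ _ _ sL) /psum -sumrB.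
apply: le_trans (nrm_sum _ _ _ _ ler01) _; apply: ler_sum => i _.
by rewrite -mulrBl mulrC; apply: nrmM.
Qed.

Lemma open_ball V z : open V -> V z ->
  exists2 e : R, 0 < e & forall h, nC h < e -> V (z + h).
Proof.
move=> /openCP oV /oV[e e0 eV]; exists e => // h he; apply: eV.
by rewrite addrC addKr.
Qed.

Lemma sa_ext V F z c : open V -> super_analytic V F -> V z -> taylor F z c ->
  exists2 e : R, 0 < e & ext e F z c /\ forall h, nC h < e -> V (z + h).
Proof.
move=> oV aF Vz /taylor_scvg[e e0 hc]; have [e' e'0 he'] := open_ball oV Vz.
exists (Order.min e e'); first by rewrite lt_min e0.
split; last by move=> h; rewrite lt_min => /andP[_]; exact: he'.
apply: taylor_ext aF _ _ => h; rewrite lt_min => /andP[h1 h2]; [exact: he'|exact: hc].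
Qed.

Lemma ext_le e e' F z c : e' <= e -> ext e F z c -> ext e' F z c.
Proof. by move=> ee' h x ex xe; apply: h => //; exact: lt_le_trans ee'. Qed.

Definition dcoef c n : Lam := c n.+1 *+ n.+1.

Lemma scaler_mulrnC (K : nzRingType) (W : lmodType K) (t : K) (v : W) (k n k' n' : nat) :
  (k * n = k' * n')%N -> (t *+ k) *: (v *+ n) = ((t *+ k') *: v) *+ n'.
Proof. by move=> E; rewrite -scalerMnr !scalerMnl -!mulrnA E. Qed.

(** Differentiation commutes with recentering, by (m + 1) C(m, i) = (i + 1) C(m + 1, i + 1); the
    term m = 0 of the longer sum vanishes. *)
Lemma dcoef_psum c h s (L M : nat) : s ^+ L = 0 ->
  psum (dcoef c) (h%:A + s) M =
  \sum_(i < L) ((\sum_(m < M.+1) (h ^+ (m - i.+1) *+ 'C(m, i.+1)) *: c m) *+ i.+1) * s ^+ i.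
Proof.
move=> sL; rewrite (psum_soul _ _ _ sL); apply: eq_bigr => i _; congr (_ * _).
rewrite big_ord_recl bin0n mulr0n scale0r add0r -sumrMnl; apply: eq_bigr => m _.
by rewrite lift0 subSS; apply: scaler_mulrnC; rewrite mulnC mul_bin_diag mulnC.
Qed.

(** Analyticity only gives coefficients point by point. The derivative is assembled by evaluating,
    at the soul of w, the derived Taylor series at the body of w; that it has Taylor expansions
    itself is again a matter of recentering. *)
Lemma sa_deriv V F : open V -> super_analytic V F ->
  exists F' : Lam -> Lam, super_deriv V F F' /\ super_analytic V F'.
Proof.
move=> oV aF.
pose P w v := exists c N, [/\ taylor F (body w) c, soul w ^+ N = 0 & v = psum (dcoef c) (soul w) N].
(* The candidate value depends neither on the choice of coefficients, which are unique, nor on the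
   truncation order, the soul being nilpotent. *)
have Pu w v v' : P w v -> P w v' -> v = v'.
  move=> [c [N [tc sN ->]]] [c' [N' [tc' sN' ->]]].
  by rewrite (taylor_uniq tc tc'); exact: psum_nilp2.
pose F' w := xget 0 [set v | P w v].
have F'E w v : P w v -> F' w = v.
  by move=> Pwv; apply: (Pu w _ _ _ Pwv); exact: (@xgetPex _ 0 [set v | P w v] (ex_intro _ v Pwv)).
exists F'.
have key z : V z -> exists2 c, taylor F z c & taylor F' z (dcoef c).
  move=> Vz; have [c tc] := aF _ Vz; exists c; first exact: tc.
  have [e e0 [ec eV]] := sa_ext oV aF Vz tc.
  apply: (ext_taylor e0) => x ex xe; set h := body x.
  have [c' tc'] := aF _ (eV _ xe); have [e' e'0 hc'] := taylor_scvg tc'.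
  have [L sL] := soul_nilpotent (body_soul x).
  have -> : F' (z%:A + x) = psum (dcoef c') (soul x) L.
    apply: F'E; exists c', L; rewrite body_zx soul_zx.
    by split; [exact: tc' | exact: sL | ].
  move=> D; rewrite {1}[x]soulE.
  have : vanishing (fun M => \sum_(i < L) nrm D 1 (soul x ^+ i) * (i.+1%:R *
     nrm D 1 (\sum_(m < M.+1) (h ^+ (m - i.+1) *+ 'C(m, i.+1)) *: c m - c' i.+1))).
    apply: vanishing_sum => i _; apply: vanishingM; first exact: nrm_ge0.
    apply: vanishingM => //.
    have hc g : nC g < e -> scvg c g%:A (F (z + g)%:A).
      by move=> ge; rewrite algD; apply: ec; [exact: gevenA|rewrite bodyA].
    have hc'' k : nC k < e' -> scvg c' k%:A (F (z + (h + k))%:A).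
      by rewrite addrA; exact: hc'.
    have := @scvg_recenter c c' (fun h => F (z + h)%:A) e e' h i.+1 D xe e'0 hc hc''.
    by move=> /(vanishing_shift 1); under eq_fun do rewrite addn1.
  apply: vanishing_le => M; rewrite (dcoef_psum _ _ _ sL) /psum -sumrB.
  apply: le_trans (nrm_sum _ _ _ _ ler01) _; apply: ler_sum => i _.
  rewrite -mulrBl /dcoef -mulrnBl -scaler_nat -scalerAl nrmZ nCn.
  rewrite [leRHS]mulrCA; apply: ler_wpM2l; first exact: ler0n.
  by rewrite [leRHS]mulrC; exact: nrmM.
split=> z Vz; first exact: key.
by have [c _ tc] := key z Vz; exists (dcoef c).
Qed.

End SuperAnalytic.

(** * Products and composites of power series through polynomial truncations *)

Section PolyNorm.
Variable R : realType.
Local Notation C := (cplx R).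
Local Notation Lam := (Gr R).
Implicit Types (a b x y s v w : Lam) (c d u q : nat -> Lam) (D S T : {fset nat}) (l r e : R) (h k z : C).
Implicit Types (F G H : Lam -> Lam) (V : set C) (P Q : {poly Lam}).

(** Keeping the norms of the terms as the coefficients of a real polynomial makes
    submultiplicativity of the majorant [wn] a comparison with a product of real polynomials
    evaluated at 1. *)
Definition npoly D l r P : {poly R} := \poly_(i < size P) (nrm D l P`_i * r ^+ i).
Definition wn D l r P : R := (npoly D l r P).[1].

Lemma coef_npoly D l r P i : (npoly D l r P)`_i = nrm D l P`_i * r ^+ i.
Proof.
rewrite coef_poly; case: ltnP => // iP.
by rewrite nth_default // nrm0 mul0r.
Qed.

Lemma wnE D l r P N : (size P <= N)%N -> wn D l r P = wsum D l r (fun i => P`_i) N.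
Proof.
move=> PN; rewrite /wn (@horner_coef_wide _ N).
  by apply: eq_bigr => i _; rewrite coef_npoly expr1n mulr1.
exact: leq_trans (size_poly _ _) PN.
Qed.

Lemma wsum_wn D l r P N : 0 <= l -> 0 <= r -> wsum D l r (fun i => P`_i) N <= wn D l r P.
Proof.
move=> l0 r0; rewrite (wnE _ _ _ (leq_maxl (size P) N)) /wsum.
rewrite -(big_mkord xpredT (fun i => nrm D l P`_i * r ^+ i)).
rewrite -(big_mkord xpredT (fun i => nrm D l P`_i * r ^+ i)).
rewrite [leRHS](big_cat_nat _ (leq_maxr (size P) N)) //= lerDl.
by apply: sumr_ge0 => i _; rewrite mulr_ge0 ?nrm_ge0 ?exprn_ge0.
Qed.

Lemma wn_ge0 D l r P : 0 <= l -> 0 <= r -> 0 <= wn D l r P.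
Proof. by move=> l0 r0; rewrite (wnE _ _ _ (leqnn _)); exact: wsum_ge0. Qed.

Lemma wnM D l r P Q : 0 <= l -> 0 <= r ->
  wn D l r (P * Q) <= wn D l r P * wn D l r Q.
Proof.
move=> l0 r0; rewrite /wn -hornerM.
set K := maxn (size (npoly D l r (P * Q))) (size (npoly D l r P * npoly D l r Q)).
rewrite (@horner_coef_wide _ K (npoly D l r (P * Q))) ?leq_maxl //.
rewrite (@horner_coef_wide _ K (_ * _)) ?leq_maxr //.
apply: ler_sum => n _; rewrite !expr1n !mulr1 coef_npoly !poly.coefM.
apply: le_trans (ler_wpM2r (exprn_ge0 _ r0) (nrm_sum _ _ _ _ l0)) _.
rewrite mulr_suml; apply: ler_sum => i _.
rewrite !coef_npoly mulrACA -exprD subnKC; last by rewrite -ltnS.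
by rewrite ler_wpM2r ?exprn_ge0 // nrmM.
Qed.

Lemma wn1 D l r : wn D l r 1 = 1.
Proof.
rewrite (wnE D l r (leqnn _)) size_poly1 /wsum big_ord1 expr0 mulr1 -polyC1 coefC /=.
exact: nrm1.
Qed.

Lemma wnX D l r P m : 0 <= l -> 0 <= r -> wn D l r (P ^+ m) <= wn D l r P ^+ m.
Proof.
move=> l0 r0; elim: m => [|m IH]; first by rewrite !expr0 wn1.
rewrite !exprS; apply: le_trans (wnM _ _ _ l0 r0) _.
by apply: ler_wpM2l => //; exact: wn_ge0.
Qed.

Definition tpoly c N : {poly Lam} := \poly_(i < N) c i.

Lemma tpolyE c x N : (tpoly c N).[x] = psum c x N.
Proof. exact: horner_poly. Qed.

Lemma wn_tpoly D l r c N : 0 <= l -> 0 <= r -> wn D l r (tpoly c N) = wsum D l r c N.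
Proof.
move=> l0 r0; rewrite (wnE D l r (size_poly N c)); apply: eq_bigr => i _.
by rewrite coef_poly ltn_ord.
Qed.

Lemma hornerMe P Q x : geven x -> (P * Q).[x] = P.[x] * Q.[x].
Proof. by move=> ex; apply: hornerM_comm; exact: even_comm. Qed.

Lemma hornerXe P x m : geven x -> (P ^+ m).[x] = P.[x] ^+ m.
Proof.
move=> ex; elim: m => [|m IH]; first by rewrite !expr0 -polyC1 hornerC.
by rewrite exprS [RHS]exprS -IH; exact: hornerMe.
Qed.

Lemma horner_psum P x N : (size P <= N)%N -> P.[x] = psum (fun i => P`_i) x N.
Proof. exact: horner_coef_wide. Qed.

Lemma poly_tail D l P x A r0 r M N : 0 <= l -> 0 <= r0 -> r0 <= r -> 0 < r -> 0 <= A ->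
  (forall j, nrm D l (x ^+ j) <= A * r0 ^+ j) -> wn D l r P <= M ->
  nrm D l (P.[x] - psum (fun i => P`_i) x N) <= A * M * (r0 / r) ^+ N.
Proof.
move=> l0 r00 r0r r1 A0 hA hM; rewrite (horner_psum x (leq_maxl (size P) N)).
apply: psum_tail => //; first exact: leq_maxr.
by move=> K; apply: le_trans hM; apply: wsum_wn => //; exact: ltW.
Qed.

Definition convs c d n : Lam := \sum_(i < n.+1) c i * d (n - i)%N.

Lemma psum_eq c d x N : (forall n, (n < N)%N -> c n = d n) -> psum c x N = psum d x N.
Proof. by move=> cd; apply: eq_bigr => i _; rewrite cd. Qed.

Lemma coef_tpolyM c d N n : (n < N)%N -> (tpoly c N * tpoly d N)`_n = convs c d n.
Proof.
move=> nN; rewrite poly.coefM; apply: eq_bigr => i _; have i_n : (i <= n)%N by rewrite -ltnS.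
rewrite !coef_poly (leq_ltn_trans i_n nN) (leq_ltn_trans _ nN) //.
exact: leq_subr.
Qed.

Lemma vanishing_mul (f g : nat -> R) : (forall n, 0 <= f n) -> (forall n, 0 <= g n) ->
  vanishing f -> vanishing g -> vanishing (fun n => f n * g n).
Proof.
move=> f0 g0 vf vg; have [B hB] := vanishing_bounded vg.
have B0 : 0 <= B by exact: le_trans (hB 0%N).
apply: vanishing_le (vanishingM B0 vf) => n; rewrite mulrC.
by apply: ler_wpM2r.
Qed.

Lemma vanishing_nrmM D l (f g : nat -> Lam) v w : 0 <= l ->
  vanishing (fun n => nrm D l (f n - v)) -> vanishing (fun n => nrm D l (g n - w)) ->
  vanishing (fun n => nrm D l (f n * g n - v * w)).
Proof.
move=> l0 hf hg.
have hfg := vanishing_mul (fun n => nrm_ge0 D (f n - v) l0) (fun n => nrm_ge0 D (g n - w) l0) hf hg.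
have h1 := vanishingM (nrm_ge0 D w l0) hf.
have h2 := vanishingM (nrm_ge0 D v l0) hg.
apply: vanishing_le (vanishingD hfg (vanishingD h1 h2)) => n.
have -> : f n * g n - v * w = (f n - v) * (g n - w) + ((f n - v) * w + v * (g n - w)).
  move: (f n) (g n) => a b.
  by rewrite mulrBr addrA subrK mulrBl mulrBr addrA subrK.
apply: le_trans (nrmD _ _ _ l0) _; apply: lerD; first exact: nrmM.
apply: le_trans (nrmD _ _ _ l0) _; apply: lerD; last exact: nrmM.
by rewrite mulrC; exact: nrmM.
Qed.

Lemma vanishing_nrmX D l (f : nat -> Lam) v m : 0 <= l ->
  vanishing (fun n => nrm D l (f n - v)) ->
  vanishing (fun n => nrm D l (f n ^+ m - v ^+ m)).
Proof.
move=> l0 hf; elim: m => [|m IH].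
  by apply: vanishing_le (@vanishing0 R) => n; rewrite !expr0 subrr nrm0.
have := vanishing_nrmM l0 hf IH; apply: vanishing_le => n.
by rewrite !exprS.
Qed.

Lemma ext_wsum D e F z c r : ext e F z c -> 0 <= r -> r < e ->
  exists2 M, 0 <= M & forall N, wsum D 1 r c N <= M.
Proof.
move=> he r0 re; pose r' := (r + e) / 2%:R.
have r'0 : 0 < r' by rewrite /r'; lra.
apply: (@scvg_wsum _ _ _ r' r (F (z%:A + (toC r')%:A))) => //; last by rewrite /r'; lra.
apply: he; first exact: gevenA.
by rewrite bodyA nC_toC ger0_norm ?(ltW r'0) // /r'; lra.
Qed.

(** The product of the truncations at N agrees with the Cauchy product below degree N; what it
    contains beyond is a tail, small uniformly by the product of the majorants. *)
Lemma ext_mul e F G z c d : ext e F z c -> ext e G z d ->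
  ext e (fun x => F x * G x) z (convs c d).
Proof.
move=> hF hG x ex xe D; have n0 := nC_ge0 (body x).
(* The two radii divide the interval from |body x| to e into thirds: powers of x grow like those of
   r0, the majorants are taken at r, and r0 / r < 1. *)
pose r := (nC (body x) + 2%:R * e) / 3%:R; pose r0 := (2%:R * nC (body x) + e) / 3%:R.
have [A A0 hA] : exists2 A, 0 <= A & forall j, nrm D 1 (x ^+ j) <= A * r0 ^+ j.
  by apply: nrmX_bound; rewrite /r0; lra.
have [M M0 hM] : exists2 M, 0 <= M & forall N, wsum D 1 r c N <= M.
  by apply: (ext_wsum D hF); rewrite /r; lra.
have [M' M'0 hM'] : exists2 M, 0 <= M & forall N, wsum D 1 r d N <= M.
  by apply: (ext_wsum D hG); rewrite /r; lra.
have r00 : 0 <= r0 by rewrite /r0; lra.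
have r1 : 0 < r by rewrite /r; lra.
have r0r : r0 < r by rewrite /r0 /r; lra.
have q0 : 0 <= r0 / r by rewrite divr_ge0 // ltW.
have q1 : r0 / r < 1 by rewrite ltr_pdivrMr // mul1r.
have v1 := vanishing_nrmM ler01 (hF x ex xe D) (hG x ex xe D).
have v2 := vanishingM (mulr_ge0 A0 (mulr_ge0 M0 M'0)) (vanishing_geo q0 q1).
apply: vanishing_le (vanishingD v2 v1) => N.
rewrite nrm_dist; apply: le_trans (nrm_tri_r _ _ (psum c x N * psum d x N) _) _.
rewrite addrC; apply: lerD => //.
have <- : psum (fun i => (tpoly c N * tpoly d N)`_i) x N = psum (convs c d) x N.
  by apply: psum_eq => n nN; exact: coef_tpolyM.
rewrite -(tpolyE c) -(tpolyE d) -hornerMe //.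
apply: (poly_tail N ler01 r00 (ltW r0r) r1 A0 hA).
apply: le_trans (wnM _ _ _ ler01 (ltW r1)) _.
by rewrite !wn_tpoly ?(ltW r1) //; apply: ler_pM; rewrite ?wsum_ge0 ?(ltW r1).
Qed.

Definition powc q (m k : nat) : Lam := (tpoly q k.+1 ^+ m)`_k.

Lemma coef_eqX P Q N m : (forall i, (i < N)%N -> P`_i = Q`_i) ->
  forall i, (i < N)%N -> (P ^+ m)`_i = (Q ^+ m)`_i.
Proof.
move=> PQ; elim: m => [|m IH] i iN; first by rewrite !expr0.
rewrite !exprS !poly.coefM; apply: eq_bigr => j _.
rewrite PQ ?IH //; apply: leq_ltn_trans iN; [exact: leq_subr | by rewrite -ltnS].
Qed.

Lemma coef_tpolyX q (m k N : nat) : (k < N)%N -> (tpoly q N ^+ m)`_k = powc q m k.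
Proof.
move=> kN; apply: (@coef_eqX _ _ k.+1) => // i ik.
by rewrite !coef_poly ik (leq_trans ik kN).
Qed.

(** Degree k uses at most k of the m factors with positive degree, so the nilpotent q_0 occurs at
    least n0 times. Each coefficient of a composite is thus a finite sum over m. *)
Lemma powc_nilp q (m k n0 : nat) : geven (q 0%N) -> q 0%N ^+ n0 = 0 -> (n0 + k <= m)%N ->
  powc q m k = 0.
Proof.
move=> eq0 qn; rewrite /powc; have -> : tpoly q k.+1 = (q 0%N)%:P + \poly_(i < k) q i.+1 * 'X.
  apply/polyP => i; rewrite poly.coefD coefC coefMX !coef_poly.
  by case: i => [|i] /=; rewrite ?addr0 ?add0r ?ltnS.
set B := \poly_(i < k) q i.+1; move=> nm.
have cq : GRing.comm (q 0%N)%:P (B * 'X).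
  apply/polyP => i; rewrite coefCM coefMC coefMX.
  exact: (even_comm _ eq0).
rewrite (exprDn_comm _ cq) poly.coef_sum big1 // => i _.
rewrite coefMn -polyC_exp coefCM; have [ik|ki] := leqP i k.
  rewrite (expr_ge0 qn) ?mul0r ?mul0rn // leq_subRL //.
    by apply: leq_trans nm; rewrite addnC leq_add2l.
  by rewrite (leq_trans ik) // (leq_trans _ nm) // leq_addl.
rewrite exprMn_comm; last exact: commr_polyX.
by rewrite coefMXn ki mulr0 mul0rn.
Qed.

Lemma psum_powc q x m N K : geven x -> (N <= K)%N ->
  psum (fun i => (tpoly q K ^+ m)`_i) x N = psum (powc q m) x N.
Proof.
by move=> ex NK; apply: psum_eq => n nN; apply: coef_tpolyX; exact: leq_trans NK.
Qed.

(** For large K the polynomial of the K-th truncation, raised to the power m, has the right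
    coefficients below N; its tail is bounded through M^m uniformly in K, while its value at x tends
    to y^m. *)
Lemma scvg_powc D l q x y A r0 r M m N : geven x -> 0 <= l -> l <= 1 ->
  0 <= r0 -> r0 <= r -> 0 < r -> 0 <= A ->
  (forall j, nrm D l (x ^+ j) <= A * r0 ^+ j) -> (forall K, wsum D l r q K <= M) ->
  scvg q x y ->
  nrm D l (y ^+ m - psum (powc q m) x N) <= A * M ^+ m * (r0 / r) ^+ N.
Proof.
move=> ex l0 l1 r00 r0r r1 A0 hA hM qy; rewrite -subr_le0; apply: vanishing_cst.
have hv : vanishing (fun n => nrm D l (psum q x n - y)).
  by apply: vanishing_le (qy D) => n; exact: nrm_le1.
apply: (@vanishing_near _ _ _ N _ (vanishing_nrmX m l0 hv)) => K NK.
have M0 : 0 <= M by apply: le_trans (hM 0%N); apply: wsum_ge0 => //; exact: ltW.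
have : nrm D l ((tpoly q K ^+ m).[x] - psum (fun i => (tpoly q K ^+ m)`_i) x N)
    <= A * M ^+ m * (r0 / r) ^+ N.
  apply: (poly_tail N l0 r00 r0r r1 A0 hA).
  apply: le_trans (wnX _ _ _ l0 (ltW r1)) _; rewrite wn_tpoly ?(ltW r1) //.
  by apply: lerXn2r; rewrite ?nnegrE // wsum_ge0 // ltW.
rewrite psum_powc // hornerXe // tpolyE.
move: (psum q x K ^+ m) (y ^+ m) (psum (powc q m) x N) => a b v.
have : nrm D l (b - v) <= nrm D l (a - b) + nrm D l (a - v).
  rewrite (nrm_dist D l a b) -(subrKA a b (- v)); exact: nrmD.
by move=> h1 h2; rewrite lerBlDr; apply: le_trans h1 _; rewrite lerD2l.
Qed.

Lemma coefM1 (A : nzRingType) (p1 p2 : {poly A}) :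
  (p1 * p2)`_1 = p1`_0 * p2`_1 + p1`_1 * p2`_0.
Proof. by rewrite poly.coefM !big_ord_recl big_ord0 addr0. Qed.

Lemma mulrnA3 (A : nzRingType) (a0 b0 c0 : A) (n : nat) :
  c0 * ((a0 * b0) *+ n) = (c0 *+ n) * a0 * b0.
Proof. by rewrite mulrnAr !mulrnAl mulrA. Qed.

Lemma powcS1 q (m : nat) : geven (q 0%N) -> powc q m.+1 1 = (q 0%N ^+ m * q 1%N) *+ m.+1.
Proof.
move=> e0; have p0 n : (tpoly q 2 ^+ n)`_0 = q 0%N ^+ n.
  elim: n => [|n IH]; first by rewrite !expr0 poly.coef1.
  by rewrite exprS poly.coefM big_ord1 subn0 IH coef_poly -exprS.
have c0 : (tpoly q 2)`_0 = q 0%N by rewrite coef_poly.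
have c1 : (tpoly q 2)`_1 = q 1%N by rewrite coef_poly.
rewrite /powc; elim: m => [|m IH].
  by rewrite expr1 coef_poly expr0 mul1r mulr1n.
rewrite exprS coefM1 IH p0 c0 c1.
have cm : q 1%N * q 0%N ^+ m.+1 = q 0%N ^+ m.+1 * q 1%N.
  by apply/esym; apply: even_comm; exact: gevenX.
by rewrite mulrnAr mulrA -exprS cm [RHS]mulrSr.
Qed.

Lemma sub_shift (A : zmodType) (a0 v0 z0 : A) : (a0 - z0) - (v0 - z0) = a0 - v0.
Proof. by rewrite opprB addrA subrK. Qed.

Lemma add_subC (A : zmodType) (a0 b0 : A) : a0 + (b0 - a0) = b0.
Proof. by rewrite addrCA subrr addr0. Qed.

Lemma sum_trunc_exchange (A : nzRingType) (c0 : nat -> A) (g0 : nat -> nat -> A) (x0 : A)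
    (n0 N M : nat) :
  (forall m k : nat, (n0 + k <= m)%N -> g0 m k = 0) -> (n0 + N <= M)%N ->
  \sum_(k < N) (\sum_(m < n0 + k) c0 m * g0 m k) * x0 ^+ k =
  \sum_(m < M) c0 m * \sum_(k < N) g0 m k * x0 ^+ k.
Proof.
move=> g00 nM; under [RHS]eq_bigr do rewrite mulr_sumr.
rewrite exchange_big /=; apply: eq_bigr => k _.
have kM : (n0 + k <= M)%N by apply: leq_trans nM; rewrite leq_add2l ltnW.
rewrite mulr_suml -(subnKC kM) -[LHS](@sum_trunc _ (fun m => c0 m * g0 m k * x0 ^+ k) _ (M - (n0 + k))).
  by apply: eq_bigr => m _; rewrite mulrA.
by move=> m km; rewrite g00 // mulr0 mul0r.
Qed.

Lemma psum_recl c x n : psum c x n.+1 = c 0%N + \sum_(i < n) c i.+1 * x ^+ i.+1.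
Proof. by rewrite /psum big_ord_recl expr0 mulr1. Qed.

Lemma nrm_fset0 l a : nrm fset0 l a = nC (body a).
Proof.
rewrite /nrm (_ : fpowerset fset0 = [fset fset0]%fset).
  by rewrite big_seq_fset1 cardfs0 expr0 mul1r.
by apply/fsetP => S; rewrite fpowersetE fsubset0 in_fset1.
Qed.

Lemma wsum_le D l r r' c N : 0 <= l -> 0 <= r -> r <= r' -> wsum D l r c N <= wsum D l r' c N.
Proof.
move=> l0 r0 rr'; apply: ler_sum => i _; apply: ler_wpM2l; first exact: nrm_ge0.
by apply: lerXn2r; rewrite ?nnegrE // (le_trans r0).
Qed.

(** Substitution of the series u, its constant term shifted by z2, into the series c. The majorant
    of the inner series has to stay below e2; its bodies are controlled by the radius r, its soul
    terms by the weight l. The formula for [d 1%N] is the source of the chain rule. *)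
Lemma ext_comp e1 e2 F1 F2 (b z2 : C) u c (n0 : nat) : 0 < e1 -> 0 < e2 ->
  ext e1 F1 b u -> ext e2 F2 z2 c -> body (u 0%N) = z2 -> (forall k : nat, geven (u k)) ->
  (forall x, geven x -> nC (body x) < e1 -> geven (F1 (b%:A + x))) ->
  (u 0%N - z2%:A) ^+ n0 = 0 ->
  exists e d, [/\ 0 < e, ext e (fun x => F2 (F1 x)) b d &
    d 1%N = psum (dcoef c) (u 0%N - z2%:A) n0 * u 1%N].
Proof.
move=> e10 e20 hF1 hF2 bu eu evF1 q0n.
(* Removing z2 leaves a constant term of body 0, hence a nilpotent one. *)
pose q (k : nat) : Lam := if k is 0%N then u 0%N - z2%:A else u k.
have eq0 : geven (q 0%N) by apply: gevenB => //; exact: gevenA.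
have bq0 : body (q 0%N) = 0 by rewrite /q bodyB bodyA bu subrr.
pose d (k : nat) : Lam := \sum_(m < n0 + k) c m * powc q m k.
have qcv x : geven x -> nC (body x) < e1 -> scvg q x (F1 (b%:A + x) - z2%:A).
  move=> ex xe D; apply: (@vanishing_near _ _ _ 1 _ (hF1 x ex xe D)) => -[//|n] _.
  have -> : psum q x n.+1 = psum u x n.+1 - z2%:A by rewrite !psum_recl addrAC.
  by rewrite sub_shift.
pose r1 := e1 / 2%:R; have r10 : 0 < r1 by rewrite /r1; lra.
have r1e : r1 < e1 by rewrite /r1; lra.
have wq D : exists2 M, 0 <= M & forall N, wsum D 1 r1 q N <= M.
  pose r' := (r1 + e1) / 2%:R; have r'0 : 0 < r' by rewrite /r'; lra.
  apply: (@scvg_wsum _ _ _ r' r1 (F1 (b%:A + (toC r')%:A) - z2%:A)).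
  - apply: qcv; first exact: gevenA.
    by rewrite bodyA nC_toC ger0_norm ?(ltW r'0) // /r'; lra.
  - exact: ltW.
  - by rewrite /r'; lra.
have [M0 M00 hM0] := wq fset0.
(* Since the body of q_0 is 0, shrinking the radius from r1 to r multiplies the majorant of the
   bodies by at most r / r1 and brings it below e2 / 3. No D enters, so r serves all seminorms. *)
pose r := Order.min r1 (r1 * (e2 / 3%:R) / (M0 + 1)).
have r0 : 0 < r by rewrite lt_min r10 divr_gt0 ?mulr_gt0 ?divr_gt0 //; lra.
have rr1 : r <= r1 by rewrite ge_min lexx.
have rM : r / r1 * M0 <= e2 / 3%:R.
  have : r <= r1 * (e2 / 3%:R) / (M0 + 1) by rewrite ge_min lexx orbT.
  rewrite ler_pdivlMr; last lra.
  move=> h; rewrite mulrAC ler_pdivrMr //; nra.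
have wbody N : \sum_(k < N) nC (body (q k)) * r ^+ k <= e2 / 3%:R.
  apply: le_trans rM; apply: le_trans (ler_wpM2l _ (hM0 N)); last by rewrite divr_ge0 // ltW.
  rewrite mulr_sumr; apply: ler_sum => k _; rewrite nrm_fset0.
  case: k => -[|k] /= kN; first by rewrite bq0 nC0 !mul0r mulr0.
  rewrite mulrCA; apply: ler_wpM2l; first exact: nC_ge0.
  rewrite mulrAC ler_pdivlMr // !exprS [leLHS]mulrAC -mulrA; apply: ler_wpM2l; first exact: ltW.
  apply: ler_wpM2l; first exact: ltW.
  by apply: lerXn2r; rewrite ?nnegrE // ltW.
exists r, d; split=> //; last first.
  rewrite /d addn1 big_ord_recl {1}/powc expr0 poly.coef1 /= mulr0 add0r /psum mulr_suml.
  apply: eq_bigr => m _; have -> : bump 0 m = m.+1 by [].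
  by rewrite (powcS1 m eq0); exact: mulrnA3.
move=> x ex xr; have xe1 : nC (body x) < e1 by apply: lt_trans (le_lt_trans rr1 r1e).
have ey0 : geven (F1 (b%:A + x) - z2%:A) by apply: gevenB; [exact: evF1 | exact: gevenA].
have n0x := nC_ge0 (body x).
have := qcv x ex xe1; have : z2%:A + (F1 (b%:A + x) - z2%:A) = F1 (b%:A + x) by exact: add_subC.
move: (F1 (b%:A + x) - z2%:A) ey0 => y ey yE qy.
have ye2 : nC (body y) < e2.
  suff : nC (body y) <= e2 / 3%:R by lra.
  rewrite -subr_le0; apply: vanishing_cst; apply: vanishing_le (qy fset0) => N.
  rewrite nrm_fset0 bodyB lerBlDr.
  have hN : nC (body (psum q x N)) <= e2 / 3%:R.
    apply: le_trans (wbody N); rewrite /psum body_sum; apply: le_trans (nC_sum _ _ _) _.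
    apply: ler_sum => k _; rewrite bodyM bodyX nCM nCX; apply: ler_wpM2l; first exact: nC_ge0.
    by apply: lerXn2r; rewrite ?nnegrE // ltW.
  have := nC_lowerB (body y) (body (psum q x N)); rewrite nC_dist; lra.
have cy : scvg c y (F2 (F1 (b%:A + x))).
  by rewrite -yE; exact: (hF2 y ey ye2).
(* Two thirds of e2: one for the bodies, one for the soul terms; the majorant of the outer series at
   [ka] is finite because [ka < e2]. *)
pose ka := e2 * 2%:R / 3%:R; have ka0 : 0 <= ka by rewrite /ka; lra.
have kae : ka < e2 by rewrite /ka; lra.
move=> D.
have [Mc Mc0 hMc] := ext_wsum D hF2 ka0 kae.
have [Mq Mq0 hMq] := wq D.
(* Now D is fixed, and l makes the soul terms of the inner series contribute at most e2 / 3. *)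
pose l := Order.min 1 (e2 / 3%:R / (Mq + 1)).
have l0 : 0 < l by rewrite lt_min ltr01 !divr_gt0 //; lra.
have l1 : l <= 1 by rewrite ge_min lexx.
have lM : l * Mq <= e2 / 3%:R.
  have : l <= e2 / 3%:R / (Mq + 1) by rewrite ge_min lexx orbT.
  by rewrite ler_pdivlMr; [nra | lra].
have wl K : wsum D l r q K <= ka.
  apply: (@le_trans _ _ (\sum_(k < K) nC (body (q k)) * r ^+ k + l * wsum D 1 r q K)).
    rewrite /wsum mulr_sumr -big_split; apply: ler_sum => k _ /=.
    rewrite mulrA -mulrDl ler_wpM2r ?exprn_ge0 ?(ltW r0) //.
    exact: (nrm_body D (q k) (ltW l0) l1).
  have := wbody K.
  have : l * wsum D 1 r q K <= l * Mq.
    apply: ler_wpM2l; first exact: ltW.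
    exact: le_trans (wsum_le _ _ _ ler01 (ltW r0) rr1) (hMq K).
  by rewrite /ka; lra.
pose r2 := (nC (body x) + r) / 2%:R.
have r20 : 0 <= r2 by rewrite /r2; lra.
have r2r : r2 < r by rewrite /r2; lra.
have [A A0 hA1] : exists2 A, 0 <= A & forall j, nrm D 1 (x ^+ j) <= A * r2 ^+ j.
  by apply: nrmX_bound; rewrite /r2; lra.
have hA j : nrm D l (x ^+ j) <= A * r2 ^+ j.
  by apply: le_trans (hA1 j); apply: nrm_le1 => //; exact: ltW.
have t0 : 0 <= r2 / r by rewrite divr_ge0 // ltW.
have t1 : r2 / r < 1 by rewrite ltr_pdivrMr // mul1r.
(* The outer series is cut at M >= n0 + N, where all the finite sums defining [d] below N are
   complete; each power y^m is then compared with its own truncation, with error A ka^m (r2 /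
   r)^N. *)
have main N : nrm D l (F2 (F1 (b%:A + x)) - psum d x N) <= A * Mc * (r2 / r) ^+ N.
  rewrite -subr_le0; apply: vanishing_cst.
  apply: (@vanishing_near _ _ _ (n0 + N) _ (cy D)) => M nM.
  have dE : psum d x N = \sum_(m < M) c m * psum (powc q m) x N.
    rewrite /psum /d.
    exact: (@sum_trunc_exchange _ c (powc q) x n0 N M (fun m (j : nat) => @powc_nilp q m j n0 eq0 q0n) nM).
  have h1 : nrm D l (psum c y M - psum d x N) <= A * Mc * (r2 / r) ^+ N.
    rewrite dE /psum -sumrB; apply: le_trans (nrm_sum _ _ _ _ (ltW l0)) _.
    rewrite mulrAC [leRHS]mulrC; apply: le_trans (ler_wpM2r _ (hMc M)); last first.
      by rewrite mulr_ge0 // exprn_ge0.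
    rewrite /wsum mulr_suml; apply: ler_sum => m _; rewrite -mulrBr.
    apply: le_trans (nrmM _ _ _ (ltW l0)) _; rewrite -mulrA.
    apply: ler_pM; rewrite ?nrm_ge0 ?(ltW l0) //; first by apply: nrm_le1 => //; exact: ltW.
    rewrite mulrA [ka ^+ m * A]mulrC.
    exact: (scvg_powc m N ex (ltW l0) l1 r20 (ltW r2r) r0 A0 hA wl qy).
  have h2 : nrm D l (psum c y M - F2 (F1 (b%:A + x))) <= nrm D 1 (psum c y M - F2 (F1 (b%:A + x))).
    by apply: nrm_le1 => //; exact: ltW.
  have h3 (v w a : Lam) : nrm D l (v - w) <= nrm D l (a - v) + nrm D l (a - w).
    by rewrite (nrm_dist D l a v) -(subrKA a v (- w)); exact: nrmD (ltW l0).
  have := h3 (F2 (F1 (b%:A + x))) (psum d x N) (psum c y M).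
  by rewrite lerBlDr => h4; apply: le_trans h4 _; apply: lerD.
have lD : 0 <= l ^- #|` D| by rewrite invr_ge0 exprn_ge0 // ltW.
have v := vanishingM (mulr_ge0 lD (mulr_ge0 A0 Mc0)) (vanishing_geo t0 t1).
apply: vanishing_le v => N; rewrite nrm_dist.
apply: le_trans (nrm1_le _ _ l0 l1) _; rewrite -mulrA.
by apply: ler_wpM2l => //; exact: main.
Qed.

End PolyNorm.

(** * Calculus of super-analytic functions *)

Section Analytic.
Variable R : realType.
Local Notation C := (cplx R).
Local Notation Lam := (Gr R).
Implicit Types (a x y s v w : Lam) (c d u : nat -> Lam) (r e : R) (h z b : C).
Implicit Types (F G H : Lam -> Lam) (V W : set C).

Lemma sd_sa V F F' : super_deriv V F F' -> super_analytic V F.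
Proof. by move=> sd b /sd[c tc _]; exists c. Qed.
Lemma sd_sa' V F F' : super_deriv V F F' -> super_analytic V F'.
Proof. by move=> sd b /sd[c _ tc]; exists (dcoef c). Qed.

Lemma taylor0 F b c : taylor F b c -> F b%:A = c 0%N.
Proof.
move=> [_ /(_ 0 1%N (@geven0 C) (@body0 C))]; rewrite expr1 addr0 => -> //.
by rewrite big_ord1 expr0 mulr1.
Qed.

Lemma taylor_soul F b c s n : taylor F b c -> geven s -> body s = 0 -> s ^+ n = 0 ->
  F (b%:A + s) = psum c s n.
Proof. by move=> [_ h] es s0 sn; exact: h. Qed.

Lemma deriv_at V F F' b c : super_deriv V F F' -> V b -> taylor F b c -> F' b%:A = c 1%N.
Proof.
move=> sd Vb tc; have [c' tc' td] := sd b Vb.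
by rewrite (taylor0 td) (taylor_uniq tc tc').
Qed.

Lemma taylor_eqP F G b c d e : 0 < e -> taylor F b c -> taylor G b d ->
  (forall t, 0 < t -> t < e -> F (b + toC t)%:A = G (b + toC t)%:A) -> c = d.
Proof.
move=> e0 /taylor_scvg[e1 e10 h1] /taylor_scvg[e2 e20 h2] FG.
apply: (@series_uniq R c d (Order.min e (Order.min e1 e2)) (fun t => F (b + toC t)%:A)).
- by rewrite !lt_min e0 e10 e20.
- move=> t t0; rewrite !lt_min => /and3P[_ t1 _].
  by apply: h1; rewrite nC_toC ger0_norm // ltW.
- move=> t t0; rewrite !lt_min => /and3P[te _ t2].
  by rewrite FG //; apply: h2; rewrite nC_toC ger0_norm // ltW.
Qed.

(** Values at scalars near the body determine the Taylor coefficients, and these determine the value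
    at every soul. Identities between analytic functions need therefore be checked at scalars
    only. *)
Lemma sa_agree V F G w : open V -> super_analytic V F -> super_analytic V G ->
  (forall b, V b -> F b%:A = G b%:A) -> geven w -> V (body w) -> F w = G w.
Proof.
move=> oV aF aG FG ew Vw; have [c tc] := aF _ Vw; have [d td] := aG _ Vw.
have [e e0 eV] := open_ball oV Vw.
have cd : c = d.
  apply: (taylor_eqP e0 tc td) => t t0 te; apply: FG; apply: eV.
  by rewrite nC_toC ger0_norm // ltW.
have [n sn] := soul_nilpotent (body_soul w).
rewrite [w]soulE (taylor_soul tc (geven_soul ew) (body_soul w) sn) cd.
by rewrite (taylor_soul td (geven_soul ew) (body_soul w) sn).
Qed.

Lemma sa_sub V W F : W `<=` V -> super_analytic V F -> super_analytic W F.
Proof. by move=> WV aF b /WV /aF. Qed.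
Lemma sd_sub V W F F' : W `<=` V -> super_deriv V F F' -> super_deriv W F F'.
Proof. by move=> WV aF b /WV /aF. Qed.

Lemma taylor_eq F G b c e : 0 < e ->
  (forall x, geven x -> nC (body x - b) < e -> F x = G x) -> taylor F b c -> taylor G b c.
Proof.
move=> e0 FG [[e1 /toC_gt0[r1 r10 ->] h1] h2]; split.
  exists (toC (Order.min r1 e)); first by rewrite -toC0 toC_lt lt_min r10.
  move=> h; rewrite normC_lt lt_min => /andP[hr he] S; rewrite -FG.
  - by apply: h1; rewrite normC_lt.
  - exact: gevenA.
  - by rewrite bodyA addrC addKr.
move=> s N es s0 sN; rewrite -FG; first exact: h2.
- by apply: gevenD => //; exact: gevenA.
- by rewrite body_zx s0 addr0 subrr nC0.
Qed.

Lemma taylor_add V F G b c d : open V -> super_analytic V F -> super_analytic V G -> V b ->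
  taylor F b c -> taylor G b d -> taylor (fun x => F x + G x) b (fun n => c n + d n).
Proof.
move=> oV aF aG Vb tc td.
have [e e0 [ec _]] := sa_ext oV aF Vb tc; have [e' e'0 [ed _]] := sa_ext oV aG Vb td.
have m0 : 0 < Order.min e e' by rewrite lt_min e0.
apply: (ext_taylor m0) => x ex; rewrite lt_min => /andP[h1 h2].
by apply: scvgD; [exact: ec | exact: ed].
Qed.

Lemma taylor_mul V F G b c d : open V -> super_analytic V F -> super_analytic V G -> V b ->
  taylor F b c -> taylor G b d -> taylor (fun x => F x * G x) b (convs c d).
Proof.
move=> oV aF aG Vb tc td.
have [e e0 [ec _]] := sa_ext oV aF Vb tc; have [e' e'0 [ed _]] := sa_ext oV aG Vb td.
have m0 : 0 < Order.min e e' by rewrite lt_min e0.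
apply: (ext_taylor m0); apply: ext_mul.
  by apply: ext_le ec; rewrite ge_min lexx.
by apply: ext_le ed; rewrite ge_min lexx orbT.
Qed.

Lemma sa_add V F G : open V -> super_analytic V F -> super_analytic V G ->
  super_analytic V (fun x => F x + G x).
Proof.
move=> oV aF aG b Vb; have [c tc] := aF _ Vb; have [d td] := aG _ Vb.
by eexists; exact: (taylor_add oV aF aG Vb tc td).
Qed.

Lemma sa_mul V F G : open V -> super_analytic V F -> super_analytic V G ->
  super_analytic V (fun x => F x * G x).
Proof.
move=> oV aF aG b Vb; have [c tc] := aF _ Vb; have [d td] := aG _ Vb.
by eexists; exact: (taylor_mul oV aF aG Vb tc td).
Qed.

Lemma nrm_od D a : nrm D 1 (od a) <= nrm D 1 a.
Proof.
apply: ler_sum => S _; rewrite coef_od; case: ifP => // _.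
by rewrite nC0 mulr0 mulr_ge0 ?exprn_ge0 ?nC_ge0.
Qed.
Lemma nrm_ev D a : nrm D 1 (ev a) <= nrm D 1 a.
Proof.
apply: ler_sum => S _; rewrite coef_ev; case: ifP => // _.
by rewrite nC0 mulr0 mulr_ge0 ?exprn_ge0 ?nC_ge0.
Qed.
Lemma mul_alg a (t : C) : a * t%:A = t *: a.
Proof. by rewrite -scalerAr mulr1. Qed.

Lemma od_psum c (t : C) N : od (psum c t%:A N) = psum (fun n => od (c n)) t%:A N.
Proof.
rewrite /psum od_sum; apply: eq_bigr => i _.
by rewrite algX !mul_alg odZ.
Qed.

(** The odd parts of the coefficients form a series with sum 0 at small positive arguments, because
    taking odd parts commutes with multiplication by scalars. *)
Lemma taylor_even V F b c : open V -> V b -> maps_to V F (@geven C) -> taylor F b c ->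
  forall n : nat, geven (c n).
Proof.
move=> oV Vb eF /taylor_scvg[e e0 hc]; have [e' e'0 eV] := open_ball oV Vb.
have od0n : forall n : nat, od (c n) = 0.
  have m0 : 0 < Order.min e e' by rewrite lt_min e0.
  apply: (@series_zero R (fun n => od (c n)) _ m0) => t t0; rewrite lt_min => /andP[te te'].
  have nt : nC (toC t) = t by rewrite nC_toC ger0_norm // ltW.
  have h : od (F (b + toC t)%:A) = 0.
    apply: od_even; apply: eF; first exact: gevenA.
    by rewrite bodyA; apply: eV; rewrite nt.
  have hc' : nC (toC t) < e by rewrite nt.
  move=> D; apply: vanishing_le (hc _ hc' D) => N.
  by rewrite -h -od_psum -odB; exact: nrm_od.
by move=> n; rewrite [c n]ev_od od0n addr0; exact: geven_ev.
Qed.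

(** For D empty the seminorm is the modulus of the body; the tail estimate after one term bounds |F
    (z) - F (b)| on bodies by a multiple of |z - b|. *)
Lemma open_pre V1 V2 F : open V1 -> super_analytic V1 F -> open V2 ->
  open [set b | V1 b /\ V2 (body (F b%:A))].
Proof.
move=> oV1 aF oV2; apply/openCP => b [Vb V2b].
have [c tc] := aF _ Vb; have [e e0 [ec eV]] := sa_ext oV1 aF Vb tc.
have /openCP/(_ _ V2b)[e2 e20 h2] := oV2.
have e20' : 0 <= e / 2%:R by lra.
have ee : e / 2%:R < e by lra.
have [M M0 hM] := ext_wsum fset0 ec e20' ee.
pose r := Order.min (e / 2%:R) (e2 * (e / 2%:R) / (M + 1)).
have r0 : 0 < r by rewrite lt_min; apply/andP; split; [lra | rewrite divr_gt0 ?mulr_gt0 //; lra].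
exists r; [exact: r0 | move=> z zb; have hz := esym (add_subC b z)].
have n0 := nC_ge0 (z - b).
have zle : nC (z - b) <= e / 2%:R by apply: ltW; apply: lt_le_trans zb _; rewrite ge_min lexx.
have ze : nC (z - b) < e by lra.
split; first by rewrite hz; apply: eV.
apply: h2; rewrite -bodyB -(nrm_fset0 1).
have := ec _ (gevenA (z - b)); rewrite bodyA => /(_ ze) sc.
have nrmz j : nrm fset0 1 ((z - b)%:A ^+ j : Lam) <= 1 * nC (z - b) ^+ j.
  by rewrite algX nrmA nCX mul1r.
have e4 : 0 < e / 2%:R by lra.
have := scvg_tail 1 n0 zle e4 ler01 sc nrmz hM.
rewrite -algD -hz psumS /psum big_ord0 add0r expr0 mulr1 -(taylor0 tc) mul1r expr1.
move=> h3; apply: le_lt_trans h3 _.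
have : nC (z - b) < e2 * (e / 2%:R) / (M + 1) by apply: lt_le_trans zb _; rewrite ge_min lexx orbT.
rewrite ltr_pdivlMr; last lra.
move=> h4; rewrite mulrA ltr_pdivrMr //; nra.
Qed.

(** [ext_comp] at the body of F1 b, the required nilpotent being the soul of F1 b. The derived outer
    series at that soul is the value of F2' at F1 b. *)
Lemma comp_taylor V1 V2 F1 F1' F2 F2' b : open V1 -> open V2 ->
  super_deriv V1 F1 F1' -> super_deriv V2 F2 F2' -> maps_to V1 F1 (@geven C) ->
  V1 b -> V2 (body (F1 b%:A)) ->
  exists d, taylor (fun x => F2 (F1 x)) b d /\ d 1%N = F2' (F1 b%:A) * F1' b%:A.
Proof.
move=> oV1 oV2 s1 s2 eF1 Vb V2b.
have [u tu tu'] := s1 _ Vb; have [c tc tc'] := s2 _ V2b.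
have [e1 e10 [h1 h1V]] := sa_ext oV1 (sd_sa s1) Vb tu.
have [e2 e20 [h2 _]] := sa_ext oV2 (sd_sa s2) V2b tc.
have u0 := taylor0 tu.
have sE : u 0%N - (body (F1 b%:A))%:A = soul (F1 b%:A) by rewrite -u0.
have [n sn] := soul_nilpotent (body_soul (F1 b%:A)).
have eF1b : geven (F1 b%:A) by apply: eF1; [exact: gevenA | rewrite bodyA].
have bu : body (u 0%N) = body (F1 b%:A) by rewrite -u0.
have evF x : geven x -> nC (body x) < e1 -> geven (F1 (b%:A + x)).
  move=> ex xe; apply: eF1; first by apply: gevenD => //; exact: gevenA.
  by rewrite body_zx; apply: h1V.
have sn' : (u 0%N - (body (F1 b%:A))%:A) ^+ n = 0 by rewrite sE; exact: sn.
have [e [d [e0 hd d1]]] := ext_comp e10 e20 h1 h2 bu (taylor_even oV1 Vb eF1 tu) evF sn'.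
exists d; split; first exact: ext_taylor e0 hd.
rewrite d1 (taylor0 tu') sE [X in F2' X]soulE.
rewrite (taylor_soul tc' (geven_soul eF1b) (body_soul _) sn).
by congr (_ * _); exact/esym/mulr1n.
Qed.

Lemma exprD_nil2 (A : nzRingType) (s0 y0 : A) (m : nat) : s0 * y0 = y0 * s0 -> y0 * y0 = 0 ->
  (s0 + y0) ^+ m.+1 = s0 ^+ m.+1 + (s0 ^+ m * y0) *+ m.+1.
Proof.
move=> sy yy; elim: m => [|m IH]; first by rewrite !expr1 expr0 mul1r mulr1n.
rewrite exprSr IH mulrDr !mulrDl -exprSr !mulrnAl -!mulrA yy mulr0 mul0rn addr0.
by rewrite -sy mulrA -exprSr -addrA -mulrSr.
Qed.

Lemma mulrnA3D (A : nzRingType) (p0 a0 b0 c0 : A) (n : nat) :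
  c0 * (p0 + (a0 * b0) *+ n) = c0 * p0 + (c0 *+ n) * a0 * b0.
Proof. by rewrite mulrDr mulrnA3. Qed.

(** Taylor's formula stops after the linear term when the increment has square 0. It is applied to
    increments rho xi with rho and xi odd. *)
Lemma sd_nil2 V F F' w y : super_deriv V F F' -> geven w -> V (body w) ->
  geven y -> body y = 0 -> y * y = 0 -> F (w + y) = F w + F' w * y.
Proof.
move=> sd ew Vw ey y0 yy; have [c tc tc'] := sd _ Vw.
have [n sn] := soul_nilpotent (body_soul w); have es := geven_soul ew.
set s := soul w in sn es *.
have sy m := exprD_nil2 m (even_comm y es) yy.
have syn : (s + y) ^+ n.+1 = 0.
  by rewrite sy exprS sn mulr0 mul0r mul0rn addr0.
have sn1 : s ^+ n.+1 = 0 by rewrite exprS sn mulr0.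
have E1 : F (w + y) = psum c (s + y) n.+1.
  have -> : w + y = (body w)%:A + (s + y) by rewrite addrA -soulE.
  apply: (taylor_soul tc _ _ syn); first exact: gevenD.
  by rewrite bodyD y0 body_soul addr0.
have E2 : F w = psum c s n.+1.
  by rewrite {1}[w]soulE; exact: (taylor_soul tc es (body_soul w) sn1).
have E3 : F' w = psum (dcoef c) s n.
  by rewrite {1}[w]soulE; exact: (taylor_soul tc' es (body_soul w) sn).
rewrite E1 E2 E3 !psum_recl -[RHS]addrA; congr (_ + _).
rewrite /psum mulr_suml -big_split /=; apply: eq_bigr => i _.
by rewrite sy /dcoef; exact: mulrnA3D.
Qed.

End Analytic.

(** * Identities behind the composition of superconformal maps *)

Section RingIdentities.
Variables (A : nzRingType) (r p a b g1 g2 F : A).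
Hypotheses (cg1 : forall x, g1 * x = x * g1) (cg2 : forall x, g2 * x = x * g2)
  (cF : forall x, F * x = x * F).
Hypotheses (rr : r * r = 0) (pp : p * p = 0) (pr : p * r = - (r * p))
  (bp : b * p = - (p * b)) (br : b * r = - (r * b)) (ba : b * a = - (a * b)).
Hypothesis (g22 : g2 ^+ 2 = F + a * b).

(** Here r is the odd variable, p and g1 are psi and g of the inner map, and a, b, g2, F are psi,
    psi', g, f' of the outer map at the value of the inner f. The left side is g psi of the
    composite, the right side its xi as found by substitution. *)
Lemma comp_xi_identity :
  (g1 * p * b + g1 * g2) * (a + p * g2) = g1 * p * F + g1 * (g2 * a).
Proof.
have e1 : g1 * p * b * a = - (g1 * p * (a * b)) by rewrite -[LHS]mulrA ba mulrN.
have e2 : g1 * p * b * (p * g2) = 0.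
  rewrite -!mulrA [b * _]mulrA bp mulNr !mulrN [p * (_ * _)]mulrA [p * (_ * _)]mulrA pp.
  by rewrite !mul0r mulr0 oppr0.
have e3 : g1 * g2 * (p * g2) = g1 * p * F + g1 * p * (a * b).
  by rewrite -mulrDr -g22 expr2 -!mulrA cg2 -!mulrA.
rewrite mulrDr !mulrDl e1 e2 e3 add0r -[g1 * g2 * a]mulrA.
by rewrite addrC addrA addrK.
Qed.

(** The element eta is the increment rho xi of the inner f, and X, Y are the derivatives of the
    outer xi and g. *)
Lemma comp_val_identity (f2 X Y eta : A) :
  eta = r * (g1 * p) -> (forall x, eta * x = x * eta) ->
  f2 + F * eta + (p + r * g1) * (g2 * a + X * eta) +
    (a + b * eta + (p + r * g1) * (g2 + Y * eta)) =
  f2 + p * (g2 * a) + r * ((g1 * p * b + g1 * g2) * (a + p * g2)) +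
    (a + p * g2 + r * (g1 * p * b + g1 * g2)).
Proof.
move=> etaE ceta.
(* The element eta contains both r and p as factors, so either summand of p + r g1 kills it; the
   derivatives X and Y drop out. *)
have K0 Z : (p + r * g1) * (Z * eta) = 0.
  rewrite -ceta mulrA mulrDl; suff [-> ->] : p * eta = 0 /\ r * g1 * eta = 0.
    by rewrite addr0 mul0r.
  rewrite etaE; split.
    by rewrite mulrA pr mulNr cg1 -!mulrA [p * (p * _)]mulrA pp mul0r mulr0 oppr0.
  by rewrite -!mulrA cg1 -!mulrA [r * (r * _)]mulrA rr mul0r.
rewrite ![(p + r * g1) * (_ + _)]mulrDr !K0 !addr0 comp_xi_identity !mulrDl !mulrDr.
have -> : F * eta = r * (g1 * p * F) by rewrite cF etaE !mulrA.
have -> : b * eta = r * (g1 * p * b).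
  by rewrite etaE mulrA br mulNr -!mulrA [b * _]mulrA -cg1 -mulrA bp !mulrN opprK.
rewrite -[r * g1 * _]mulrA -[r * g1 * g2]mulrA.
by congr (_ + _); exact: addrACA.
Qed.

End RingIdentities.

(** The relation g^2 = f' + psi psi' of a composite. The letters U, W, Z, S, T stand for products of
    two odd elements (see [super_square]), which are even and commute, so that [ring] can do the
    expansion. *)
Lemma unit_square_identity (A : comNzRingType) (g1 g2 F K G U W Z S T : A) :
  g1 ^+ 2 = K + Z -> g2 ^+ 2 = F + W -> U * U = 0 -> Z * U = 0 ->
  (g1 * U + g1 * g2) ^+ 2 =
  F * K + (T * (G * K) + U * (g2 * K) + S * g2) +
    (W * K - T * (G * K) - S * g2 + U * (g2 * K) + Z * g2 ^+ 2).
Proof.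
move=> h1 h2 h3 h4.
have -> : (g1 * U + g1 * g2) ^+ 2 = g1 ^+ 2 * (U * U + 2%:R * (g2 * U) + g2 ^+ 2) by ring.
rewrite h3 h1 add0r h2.
have -> : (K + Z) * (2%:R * (g2 * U) + (F + W)) =
  K * (2%:R * (g2 * U)) + 2%:R * g2 * (Z * U) + (K + Z) * (F + W) by ring.
by rewrite h4; ring.
Qed.

Section EvenRing.
Variable R : realType.
Local Notation C := (cplx R).
Local Notation Lam := (Gr R).

Definition evenb : {pred Lam} := fun x => `[< geven x >].

Fact evenb_subring : subring_closed evenb.
Proof.
split; first by apply/asboolP; exact: geven1.
  by move=> x y /asboolP ex /asboolP ey; apply/asboolP; exact: gevenB.
by move=> x y /asboolP ex /asboolP ey; apply/asboolP; exact: gevenM.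
Qed.

HB.instance Definition _ := GRing.isSubringClosed.Build Lam evenb evenb_subring.

(** Even elements as a commutative ring, to which the identity above can be transported. *)
Definition evenT : Type := {x : Lam | x \in evenb}.
HB.instance Definition _ := SubChoice.on evenT.
HB.instance Definition _ := [SubChoice_isSubNzRing of evenT by <:].
Fact evenT_comm : commutative (@GRing.mul evenT).
Proof.
by move=> x y; apply: val_inj; apply: even_comm; apply/asboolP; exact: (valP x).
Qed.
HB.instance Definition _ := GRing.PzRing_hasCommutativeMul.Build evenT evenT_comm.

Lemma even_val (x : Lam) : geven x -> exists X : evenT, x = val X.
Proof.
move=> ex; have hx : x \in evenb by apply/asboolP.
by exists (exist _ x hx).
Qed.

End EvenRing.

(** * Superconformal maps *)

Section Superconformal.
Variable R : realType.
Local Notation C := (cplx R).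
Local Notation Lam := (Gr R).
Implicit Types (a x y s v w : Lam) (c d u : nat -> Lam) (r e : R) (h z b : C).
Implicit Types (F G H : Lam -> Lam) (V W U : set C).

(** The conditions of [superconformal] other than nondegeneracy, with the component functions
    exposed: composition, gluing and uniqueness are statements about these components. *)
Definition sconf V H (f xi psi g f' psi' : Lam -> Lam) : Prop :=
  [/\ [/\ maps_to V f (@geven C), maps_to V g (@geven C),
          maps_to V xi (@godd C) & maps_to V psi (@godd C)],
      [/\ super_deriv V f f', super_deriv V psi psi',
          super_analytic V xi & super_analytic V g],
      forall x, dewitt V x ->
        H x = (f (ev x) + od x * xi (ev x)) + (psi (ev x) + od x * g (ev x)) &
      forall w, geven w -> V (body w) ->
        xi w = g w * psi w /\ g w ^+ 2 = f' w + psi w * psi' w].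

(* Superconformal maps that are locally invertible; unlike superconformal, this
   allows an empty V. *)
Definition scu V H := exists f xi psi g f' psi',
  sconf V H f xi psi g f' psi' /\
  forall w, geven w -> V (body w) -> body (g w) != 0.

Lemma scu_superconformal V H : V !=set0 -> scu V H -> superconformal V H.
Proof.
move=> [b Vb] [f [xi [psi [g [f' [psi' [[h1 h2 h3 h4] h5]]]]]]].
exists f, xi, psi, g, f', psi'; split => //; exists b%:A.
  by rewrite /dewitt /= bodyA.
rewrite od_even ?ev_even ?mul0r ?addr0; [|exact: gevenA|exact: gevenA].
apply/eqP => g0; have := h5 _ (gevenA b); rewrite bodyA => /(_ Vb).
by rewrite g0 body0 eqxx.
Qed.

Lemma fset_fresh (D : {fset nat}) : exists N, N \notin D.
Proof.
exists (\max_(i <- D) i).+1; apply/negP => h.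
have : ((\max_(i <- D) i).+1 <= \max_(i <- D) i)%N.
  exact: (@leq_bigmax_seq _ _ xpredT id _ h isT).
by rewrite ltnn.
Qed.

Lemma coef_gmonM (S U : {fset nat}) (t : C) a :
  coef (gmon S t * a) U = \sum_(T <- msupp a)
    (gsgn C S T * (t * coef a T)) *+ ((S `|` T)%fset == U).
Proof.
rewrite [X in coef X _](gmulw msuppU_le (fsubset_refl (msupp a))) big_seq_fset1.
rewrite (coef_sum (msupp a)); apply: eq_bigr => T _.
by rewrite coef_gmon [coef (gmon S t) S]coef_gmon eqxx.
Qed.

(* A monomial in an odd number of generators comprising all those of a. *)
Lemma kill_odd a : body a = 0 -> exists2 rho : Lam, godd rho /\ rho != 0 & rho * a = 0.
Proof.
move=> a0; pose D := (\bigcup_(S <- msupp a) S)%fset.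
have [N ND] := fset_fresh D.
pose S := if odd #|` D| then D else (N |` D)%fset.
have DS : (D `<=` S)%fset by rewrite /S; case: ifP => _; [exact: fsubset_refl|exact: fsubsetUr].
have oS : odd #|` S|.
  by rewrite /S; case: ifP => // /negbT nD; rewrite cardfsU1 ND add1n oddS.
exists (gmon S 1); first split.
- move=> T nT; rewrite coef_gmon; case: eqP => // ST; by rewrite -ST oS in nT.
- by apply/eqP => /(congr1 (fun x : Lam => coef x S)) /eqP; rewrite coef_gmon eqxx coef0 oner_eq0.
apply: coefP => U; rewrite coef_gmonM coef0 big1_fset // => T Ta _.
rewrite /gsgn; case: ifP => dST; last by rewrite mul0r mul0rn.
have TS : (T `<=` S)%fset by apply: fsubset_trans DS; apply: bigfcup_sup.
have T0 : T = fset0.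
  apply/eqP; rewrite -fsubset0; rewrite fdisjoint_sym in dST.
  by move/eqP: dST; rewrite (fsetIidPl TS) => ->.
by move: Ta; rewrite -coef_neq0 T0 -/(body a) a0 eqxx.
Qed.

(* It suffices to take for rho a generator that does not occur in a - v. *)
Lemma odd_cancel a v : (forall rho : Lam, godd rho -> rho * a = rho * v) -> a = v.
Proof.
move=> h; apply/eqP; rewrite -subr_eq0; apply/eqP.
have {h} h rho : godd rho -> rho * (a - v) = 0 by move=> /h; rewrite mulrBr => ->; rewrite subrr.
move: (a - v) h => {}a h; apply: coefP => S; rewrite coef0.
have [N ND] := fset_fresh (S `|` \bigcup_(T <- msupp a) T)%fset.
have oN : godd (gmon [fset N]%fset 1 : Lam).
  by move=> T; rewrite coef_gmon; case: eqP => // <-; rewrite cardfs1.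
have := congr1 (fun x : Lam => coef x (N |` S)%fset) (h _ oN).
rewrite coef_gmonM coef0; move: ND; rewrite in_fsetU negb_or => /andP[NS ND].
have [Sa|Sa] := boolP (S \in msupp a); last first.
  by move: Sa; rewrite -coef_neq0 negbK => /eqP.
rewrite (big_fsetD1 S) //= eqxx big1_fset ?addr0; last first.
  move=> T; rewrite in_fsetD1 => /andP[TS Ta] _; case: eqP => // E.
  case/negP: TS; apply/eqP.
  have NT : N \notin T.
    by apply: contra ND => NT; apply/bigfcupP; exists T; rewrite ?Ta.
  have := congr1 (fun X => X `\ N)%fset E; rewrite !fsetU1K //.
rewrite /gsgn; have -> : fdisjoint [fset N]%fset S.
  by apply/fdisjointP => i; rewrite in_fset1 => /eqP ->.
move/eqP; rewrite mulf_eq0 mul1r signr_eq0 => /eqP //.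
Qed.

Lemma sconf_at V H f xi psi g f' psi' w (rho : Lam) : sconf V H f xi psi g f' psi' ->
  geven w -> V (body w) -> godd rho ->
  H (w + rho) = (f w + rho * xi w) + (psi w + rho * g w).
Proof.
move=> [_ _ h _] ew Vw orho; rewrite h ?ev_add ?od_add //.
by rewrite /dewitt /= bodyD (body_odd orho) addr0.
Qed.

Lemma sconf_at0 V H f xi psi g f' psi' w : sconf V H f xi psi g f' psi' ->
  geven w -> V (body w) -> H w = f w + psi w.
Proof.
move=> sc ew Vw; have := sconf_at sc ew Vw (@godd0 C).
by rewrite addr0 !mul0r !addr0.
Qed.

(* If g had body 0 at w, some odd rho <> 0 would kill it, hence also
   xi = g psi, and H would take the same value at w and w + rho. *)
Lemma superconformal_unit V H : superconformal V H ->
  (forall x y, dewitt V x -> dewitt V y -> H x = H y -> x = y) -> scu V H.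
Proof.
move=> [f [xi [psi [g [f' [psi' [h1 h2 h3 h4 _]]]]]]] inj.
exists f, xi, psi, g, f', psi'; split => // w ew Vw; apply/eqP => g0.
have [rho [orho /eqP rho0] rg] := kill_odd g0.
have Vwr : V (body (w + rho)) by rewrite bodyD (body_odd orho) addr0.
apply: rho0; suff E : w + rho = w.
  by apply: (@addrI _ w); rewrite E addr0.
apply: inj; [exact: Vwr | exact: Vw | ].
have sc : sconf V H f xi psi g f' psi' by split.
rewrite (sconf_at sc ew Vw orho) (sconf_at0 sc ew Vw) (h4 w ew Vw).1 mulrA rg.
by rewrite mul0r !addr0.
Qed.

Lemma even_odd_eq a a' v v' : geven a -> geven a' -> godd v -> godd v' ->
  a + v = a' + v' -> a = a' /\ v = v'.
Proof.
move=> ea ea' ov ov' E; split.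
  by rewrite -(ev_add ea ov) E ev_add.
by rewrite -(od_add ea ov) E od_add.
Qed.

(** At rho = 0 the parities separate f from psi. After that rho xi and rho g are determined for all
    odd rho, and [odd_cancel] removes rho. *)
Lemma sconf_uniq V H f xi psi g f' psi' V2 H2 f2 xi2 psi2 g2 f2' psi2' w :
  sconf V H f xi psi g f' psi' -> sconf V2 H2 f2 xi2 psi2 g2 f2' psi2' ->
  geven w -> V (body w) -> V2 (body w) ->
  (forall rho : Lam, godd rho -> H (w + rho) = H2 (w + rho)) ->
  [/\ f w = f2 w, xi w = xi2 w, psi w = psi2 w & g w = g2 w].
Proof.
move=> s1 s2 ew Vw V2w HH.
have [[ef eg oxi opsi] _ _ _] := s1; have [[ef2 eg2 oxi2 opsi2] _ _ _] := s2.
have key rho : godd rho -> f w + rho * xi w = f2 w + rho * xi2 w /\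
    psi w + rho * g w = psi2 w + rho * g2 w.
  move=> orho; have := HH _ orho.
  rewrite (sconf_at s1 ew Vw orho) (sconf_at s2 ew V2w orho); apply: even_odd_eq.
  - by apply: gevenD; [exact: ef|apply: gevenMo => //; exact: oxi].
  - by apply: gevenD; [exact: ef2|apply: gevenMo => //; exact: oxi2].
  - by apply: goddD; [exact: opsi|apply: goddMl => //; exact: eg].
  - by apply: goddD; [exact: opsi2|apply: goddMl => //; exact: eg2].
have [ff pp] := key 0 (@godd0 C); rewrite !mul0r !addr0 in ff pp.
split=> //; apply: odd_cancel => rho /key[].
  by rewrite ff => /addrI.
by rewrite pp => _ /addrI.
Qed.

Lemma sd_uniq V F F' V2 F2 F2' w : open V -> open V2 -> super_deriv V F F' ->
  super_deriv V2 F2 F2' -> geven w -> V (body w) -> V2 (body w) ->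
  (forall v, geven v -> V (body v) -> V2 (body v) -> F v = F2 v) -> F' w = F2' w.
Proof.
move=> oV oV2 s1 s2 ew Vw V2w FF.
have [c tc tc'] := s1 _ Vw; have [d td td'] := s2 _ V2w.
have [e e0 eV] := open_ball oV Vw; have [e2 e20 eV2] := open_ball oV2 V2w.
have m0 : 0 < Order.min e e2 by rewrite lt_min e0.
have cd : c = d.
  apply: (taylor_eqP m0 tc td) => t t0; rewrite lt_min => /andP[te te2].
  have nt : nC (toC t) = t by rewrite nC_toC ger0_norm // ltW.
  by apply: FF; rewrite ?bodyA; [exact: gevenA|apply: eV; rewrite nt|apply: eV2; rewrite nt].
have [n sn] := soul_nilpotent (body_soul w).
rewrite [w]soulE (taylor_soul tc' (geven_soul ew) (body_soul w) sn).
by rewrite cd (taylor_soul td' (geven_soul ew) (body_soul w) sn).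
Qed.

End Superconformal.

(** * Composition of superconformal maps *)

Section SuperconformalCalculus.
Variable R : realType.
Local Notation C := (cplx R).
Local Notation Lam := (Gr R).
Implicit Types (a x y s v w : Lam) (c d u : nat -> Lam) (r e : R) (h z b : C).
Implicit Types (F G H : Lam -> Lam) (V W U : set C).

Lemma scu_sub V W H : W `<=` V -> scu V H -> scu W H.
Proof.
move=> WV [f [xi [psi [g [f' [psi' [[[e1 e2 e3 e4] [s1 s2 s3 s4] hH hr] hu]]]]]]].
exists f, xi, psi, g, f', psi'; split; last by move=> w ew /WV; exact: hu.
split.
- by split=> w ew /WV; [exact: e1|exact: e2|exact: e3|exact: e4].
- by split; [exact: sd_sub s1|exact: sd_sub s2|exact: sa_sub s3|exact: sa_sub s4].
- by move=> x /WV; exact: hH.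
- by move=> w ew /WV; exact: hr.
Qed.

Lemma scu_eq V H H' : (forall x, V (body x) -> H x = H' x) -> scu V H -> scu V H'.
Proof.
move=> HH [f [xi [psi [g [f' [psi' [[h1 h2 hH hr] hu]]]]]]].
exists f, xi, psi, g, f', psi'; split; last exact: hu.
by split=> // x Vx; rewrite -HH //; exact: hH.
Qed.

Lemma body_addr0 a v : body v = 0 -> body (a + v) = body a.
Proof. by move=> v0; apply: etrans (bodyD _ _) _; rewrite v0 addr0. Qed.
Lemma body_oddM a v : godd a -> body (a * v) = 0.
Proof. by move=> oa; apply: etrans (bodyM _ _) _; rewrite (body_odd oa) mul0r. Qed.

Lemma body_add0l a v : body v = 0 -> body (v + a) = body a.
Proof. by move=> v0; apply: etrans (bodyD _ _) _; rewrite v0 add0r. Qed.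

Lemma body_form (a1 a2 a3 a4 r0 : Lam) : godd r0 ->
  body ((a1 + r0 * a2) + (a3 + r0 * a4)) = body a1 + body a3.
Proof.
move=> or0; apply: etrans (bodyD _ _) _.
by congr (_ + _); apply: body_addr0; exact: body_oddM.
Qed.

(** Souls and odd terms do not affect the body, so H induces a map on bodies, given by the body of f
    at scalars; domains of composites can be described on bodies. *)
Lemma sconf_body V H f xi psi g f' psi' x : open V -> sconf V H f xi psi g f' psi' -> V (body x) ->
  body (H x) = body (f (body x)%:A).
Proof.
move=> oV [[ef eg oxi opsi] [s1 _ _ _] hH _] Vx.
have eew := geven_ev x; have Vw : V (body (ev x)) by rewrite body_ev.
rewrite (hH x Vx) body_form ?(body_odd (opsi _ eew Vw)) ?addr0; last exact: godd_od.
have [c tc _] := s1 _ Vx; have [n sn] := soul_nilpotent (body_soul (ev x)).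
rewrite {1}[ev x]soulE body_ev (taylor_soul tc (geven_soul eew) (body_soul _) sn).
have n0 : (0 < n)%N.
  rewrite lt0n; apply/eqP => n0; move: sn; rewrite n0 expr0 => /eqP.
  by rewrite oner_eq0.
rewrite -(prednK n0) psum_recl bodyD (taylor0 tc) body_sum big1 ?addr0 // => i _.
by rewrite bodyM bodyX body_soul expr0n /= mulr0.
Qed.

Lemma scu_body V H x : open V -> scu V H -> V (body x) ->
  body (H x) = body (H (body x)%:A).
Proof.
move=> oV [f [xi [psi [g [f' [psi' [sc _]]]]]]] Vx.
by rewrite (sconf_body oV sc Vx) (sconf_body oV sc) bodyA.
Qed.

Lemma scu_open V1 V2 H : open V1 -> open V2 -> scu V1 H ->
  open [set b | V1 b /\ V2 (body (H b%:A))].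
Proof.
move=> oV1 oV2 [f [xi [psi [g [f' [psi' [sc _]]]]]]].
have [_ [/sd_sa aF _ _ _] _ _] := sc.
have -> : [set b | V1 b /\ V2 (body (H b%:A))] = [set b | V1 b /\ V2 (body (f b%:A))].
  apply/seteqP; split=> b /= [Vb]; have Vb' : V1 (body b%:A) by rewrite bodyA.
    by rewrite (sconf_body oV1 sc Vb') bodyA.
  by rewrite (sconf_body oV1 sc Vb') bodyA.
exact: (open_pre oV1 aF oV2).
Qed.

Lemma bd (x : Lam) : (body x)%:A = x - soul x.
Proof. by rewrite /soul opprB addrC subrK. Qed.

Lemma sa_comp V1 V2 F1 F2 : open V1 -> open V2 -> super_analytic V1 F1 ->
  super_analytic V2 F2 -> maps_to V1 F1 (@geven C) ->
  super_analytic [set b | V1 b /\ V2 (body (F1 b%:A))] (fun x => F2 (F1 x)).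
Proof.
move=> oV1 oV2 a1 a2 eF b /= [Vb V2b].
have [F1' [s1 _]] := sa_deriv oV1 a1; have [F2' [s2 _]] := sa_deriv oV2 a2.
by have [d [td _]] := comp_taylor oV1 oV2 s1 s2 eF Vb V2b; exists d.
Qed.

Lemma ev_sum n (f : 'I_n -> Lam) : ev (\sum_(i < n) f i) = \sum_(i < n) ev (f i).
Proof. by elim/big_rec2: _ => [|i x y _ <-]; [exact: ev0G|exact: evD]. Qed.

Lemma ev_psum c (t : C) N : ev (psum c t%:A N) = psum (fun n => ev (c n)) t%:A N.
Proof.
rewrite /psum ev_sum; apply: eq_bigr => i _.
by rewrite algX !mul_alg evZ.
Qed.

Lemma taylor_odd V F b c : open V -> V b -> maps_to V F (@godd C) -> taylor F b c ->
  forall n : nat, godd (c n).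
Proof.
move=> oV Vb eF /taylor_scvg[e e0 hc]; have [e' e'0 eV] := open_ball oV Vb.
have ev0n : forall n : nat, ev (c n) = 0.
  have m0 : 0 < Order.min e e' by rewrite lt_min e0.
  apply: (@series_zero R (fun n => ev (c n)) _ m0) => t t0; rewrite lt_min => /andP[te te'].
  have nt : nC (toC t) = t by rewrite nC_toC ger0_norm // ltW.
  have h : ev (F (b + toC t)%:A) = 0.
    apply: ev_odd; apply: eF; first exact: gevenA.
    by rewrite bodyA; apply: eV; rewrite nt.
  have hc' : nC (toC t) < e by rewrite nt.
  move=> D; apply: vanishing_le (hc _ hc' D) => N.
  by rewrite -h -ev_psum -evB; exact: nrm_ev.
by move=> n; rewrite [c n]ev_od ev0n add0r; exact: godd_od.
Qed.

Lemma gevenMn a n : geven a -> geven (a *+ n).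
Proof. by move=> ea; rewrite -scaler_nat; exact: gevenZ. Qed.
Lemma goddMn a n : godd a -> godd (a *+ n).
Proof. by move=> ea; rewrite -scaler_nat; exact: goddZ. Qed.

Lemma sd_even V F F' : open V -> super_deriv V F F' -> maps_to V F (@geven C) ->
  maps_to V F' (@geven C).
Proof.
move=> oV sF eF w ew Vw; have [c tc tc'] := sF _ Vw.
have [n sn] := soul_nilpotent (body_soul w).
rewrite [w]soulE (taylor_soul tc' (geven_soul ew) (body_soul w) sn).
apply: geven_sum => i _; apply: gevenM; last exact/gevenX/geven_soul.
exact/gevenMn/(taylor_even oV Vw eF tc).
Qed.

Lemma sd_odd V F F' : open V -> super_deriv V F F' -> maps_to V F (@godd C) ->
  maps_to V F' (@godd C).
Proof.
move=> oV sF eF w ew Vw; have [c tc tc'] := sF _ Vw.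
have [n sn] := soul_nilpotent (body_soul w).
rewrite [w]soulE (taylor_soul tc' (geven_soul ew) (body_soul w) sn).
apply: godd_sum => i _; apply: goddMl; last exact/gevenX/geven_soul.
exact/goddMn/(taylor_odd oV Vw eF tc).
Qed.

Lemma sum_conv2 (A : nzRingType) (c0 d0 : nat -> A) :
  \sum_(i < 2) c0 i * d0 (1 - i)%N = c0 0%N * d0 1%N + c0 1%N * d0 0%N.
Proof. by rewrite !big_ord_recl big_ord0 addr0. Qed.

Lemma nil_square (A : nzRingType) (r0 x0 y0 : A) : r0 * r0 = 0 -> x0 * r0 = - (r0 * x0) ->
  r0 * x0 * (r0 * y0) = 0.
Proof.
by move=> rr xr; rewrite mulrA -(mulrA r0) xr mulrN mulrA rr mul0r oppr0 mul0r.
Qed.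

Lemma convs1 c d : convs c d 1%N = c 0%N * d 1%N + c 1%N * d 0%N.
Proof. exact: sum_conv2. Qed.

(** At scalars the derivative is the first Taylor coefficient, and that of a product is read off the
    Cauchy product; [sa_agree] extends the formula to even points. P is only tied to the product on
    V, as in xi = g psi and w w^-1 = 1. *)
Lemma product_rule V F F' G G' P P' w : open V -> super_deriv V F F' -> super_deriv V G G' ->
  super_deriv V P P' -> super_analytic V P' ->
  (forall v, geven v -> V (body v) -> P v = F v * G v) ->
  geven w -> V (body w) -> P' w = F w * G' w + F' w * G w.
Proof.
move=> oV sF sG sP aP' PFG ew Vw.
have [aF aF' aG aG'] := And4 (sd_sa sF) (sd_sa' sF) (sd_sa sG) (sd_sa' sG).
apply: (@sa_agree _ V P' (fun w => F w * G' w + F' w * G w) w oV aP' _ _ ew Vw).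
  by apply: sa_add => //; apply: sa_mul.
move=> b Vb; have [c tc tc'] := sF _ Vb; have [d td td'] := sG _ Vb.
have tP : taylor P b (convs c d).
  have [e e0 eV] := open_ball oV Vb.
  apply: (@taylor_eq _ _ _ b _ e e0 _ (taylor_mul oV aF aG Vb tc td)) => v ev0 vb.
  by apply/esym; apply: PFG => //; rewrite -(add_subC b (body v)); exact: eV.
rewrite (deriv_at sP Vb tP) convs1.
by rewrite (taylor0 tc) (taylor0 td) (deriv_at sF Vb tc) (deriv_at sG Vb td).
Qed.

(** Sorts the noncommutative side into products of two adjacent odd factors, preparing the passage
    to commuting unknowns in [super_square]. *)
Lemma square_expand (A : nzRingType) (p a0 b0 d0 g0 G0 K0 : A) :
  (forall x : A, g0 * x = x * g0) -> (forall x : A, G0 * x = x * G0) -> (forall x : A, K0 * x = x * K0) ->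
  p * p = 0 -> a0 * p = - (p * a0) -> a0 * d0 = - (d0 * a0) ->
  p * ((g0 * b0 + G0 * a0) * K0) + d0 * (g0 * a0) =
    p * a0 * (G0 * K0) + p * b0 * (g0 * K0) + d0 * a0 * g0 /\
  (a0 + p * g0) * (b0 * K0 + (p * (G0 * K0) + d0 * g0)) =
  a0 * b0 * K0 - p * a0 * (G0 * K0) - d0 * a0 * g0 + p * b0 * (g0 * K0) + p * d0 * g0 ^+ 2.
Proof.
move=> cg cG cK pp ap ad; split.
  rewrite mulrDl mulrDr addrC [X in _ + X]addrC addrC; congr (_ + _ + _).
  - by rewrite cG -!mulrA.
  - by rewrite cg -!mulrA.
  - by rewrite cg -!mulrA.
rewrite mulrDl !mulrDr -!addrA; congr (_ + _); first exact: mulrA.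
congr (_ + _); first by rewrite mulrA ap mulNr.
congr (_ + _); first by rewrite mulrA ad mulNr.
congr (_ + _); first by rewrite -!mulrA [g0 * _]mulrA cg -!mulrA.
have -> : p * g0 * (p * (G0 * K0)) = 0 by rewrite -cg -!mulrA [p * (p * _)]mulrA pp mul0r mulr0.
by rewrite add0r expr2 -!mulrA [g0 * (d0 * _)]mulrA cg -!mulrA.
Qed.

Lemma sum_subst (A : nzRingType) (x1 x2 y1 y2 t g0 p0 b0 h0 : A) : x1 = y1 /\ x2 = y2 ->
  (g0 * (p0 * b0) + h0) ^+ 2 = t + y1 + y2 ->
  (g0 * p0 * b0 + h0) * (g0 * p0 * b0 + h0) = t + x1 + x2.
Proof. by move=> [-> ->] <-; rewrite expr2 -mulrA. Qed.

Lemma super_square (a b0 p d0 G1 G2 F K G : Lam) :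
  godd a -> godd b0 -> godd p -> godd d0 -> geven G1 -> geven G2 -> geven F ->
  geven K -> geven G -> G1 ^+ 2 = K + p * d0 -> G2 ^+ 2 = F + a * b0 ->
  (G1 * p * b0 + G1 * G2) * (G1 * p * b0 + G1 * G2) =
  F * K + (p * ((G2 * b0 + G * a) * K) + d0 * (G2 * a)) +
  (a + p * G2) * (b0 * K + (p * (G * K) + d0 * G2)).
Proof.
move=> oa ob op od' e1 e2 eF eK eG g12 g22.
have E := square_expand b0 (fun x => even_comm x e2) (fun x => even_comm x eG)
  (fun x => even_comm x eK) (sqr_odd op) (odd_anticomm oa op) (odd_anticomm oa od').
apply: (sum_subst E) => {E}.
have UU : p * b0 * (p * b0) = 0 by exact: nil_square (sqr_odd op) (odd_anticomm ob op).
have ZU : p * d0 * (p * b0) = 0.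
  exact: nil_square (sqr_odd op) (odd_anticomm od' op).
have eU := gevenMo op ob; have eW := gevenMo oa ob; have eZ := gevenMo op od'.
have eS := gevenMo od' oa; have eT := gevenMo op oa.
move: (p * b0) (a * b0) (p * d0) (d0 * a) (p * a) UU ZU eU eW eZ eS eT g12 g22.
move=> U W Z S T UU ZU eU eW eZ eS eT g12 g22.
have [U' UE] := even_val eU; have [W' WE] := even_val eW; have [Z' ZE] := even_val eZ.
have [S' SE] := even_val eS; have [T' TE] := even_val eT; have [G1' G1E] := even_val e1.
have [G2' G2E] := even_val e2; have [F'' FE] := even_val eF; have [K' KE] := even_val eK.
have [G' GE] := even_val eG.
have h1 : G1' ^+ 2 = K' + Z' by apply: val_inj; rewrite expr2; move: g12; rewrite expr2 G1E KE ZE.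
have h2 : G2' ^+ 2 = F'' + W' by apply: val_inj; rewrite expr2; move: g22; rewrite expr2 G2E FE WE.
have h3 : U' * U' = 0 by apply: val_inj; move: UU; rewrite UE.
have h4 : Z' * U' = 0 by apply: val_inj; move: ZU; rewrite ZE UE.
have := congr1 val (unit_square_identity G' S' T' h1 h2 h3 h4).
by rewrite UE WE ZE SE TE G1E G2E FE KE GE !expr2.
Qed.

Section Comp.
Variables (V1 V2 : set C) (H1 H2 : Lam -> Lam).
Variables (f1 xi1 psi1 g1 f1' psi1' f2 xi2 psi2 g2 f2' psi2' : Lam -> Lam).
Hypotheses (oV1 : open V1) (oV2 : open V2).
Hypothesis sc1 : sconf V1 H1 f1 xi1 psi1 g1 f1' psi1'.
Hypothesis sc2 : sconf V2 H2 f2 xi2 psi2 g2 f2' psi2'.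

Definition cdom := [set b | V1 b /\ V2 (body (f1 b%:A))].
(** Read off from the substitution of H1 in H2: [cf] and [cpsi] are the even and odd values at rho =
    0, and [cg] is the coefficient of rho in the odd part. With [cxi] defined as a product the first
    superconformal relation holds by definition, and [cvalue] has to show that it is the right
    coefficient. *)
Definition cf w := f2 (f1 w) + psi1 w * xi2 (f1 w).
Definition cpsi w := psi2 (f1 w) + psi1 w * g2 (f1 w).
Definition cg w := xi1 w * psi2' (f1 w) + g1 w * g2 (f1 w).
Definition cxi w := cg w * cpsi w.

Lemma open_cdom : open cdom.
Proof. by have [_ [/sd_sa a1 _ _ _] _ _] := sc1; exact: (open_pre oV1 a1 oV2). Qed.

Lemma cdom1 : cdom `<=` V1. Proof. by move=> b []. Qed.

Lemma cdomE w : geven w -> cdom (body w) -> V1 (body w) /\ V2 (body (f1 w)).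
Proof.
move=> ew [Vw]; rewrite -(sconf_body oV1 sc1 Vw) (sconf_at0 sc1 ew Vw) bodyD.
have [[_ _ _ op] _ _ _] := sc1.
by rewrite (body_odd (op _ ew Vw)) addr0.
Qed.

Lemma cparity : [/\ maps_to cdom cf (@geven C), maps_to cdom cg (@geven C),
  maps_to cdom cxi (@godd C) & maps_to cdom cpsi (@godd C)].
Proof.
have [[ef1 eg1 ox1 op1] _ _ _] := sc1; have [[ef2 eg2 ox2 op2] [_ sp2 _ _] _ _] := sc2.
have op2' := sd_odd oV2 sp2 op2.
have eg : maps_to cdom cg (@geven C).
  move=> w ew /(cdomE ew)[h1 h2]; have ef := ef1 w ew h1; apply: gevenD.
    by apply: gevenMo; [exact: ox1|exact: op2'].
  by apply: gevenM; [exact: eg1|exact: eg2].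
have op : maps_to cdom cpsi (@godd C).
  move=> w ew /(cdomE ew)[h1 h2]; have ef := ef1 w ew h1; apply: goddD; first exact: op2.
  by apply: goddMl; [exact: op1|exact: eg2].
split; [ | exact: eg | | exact: op].
  move=> w ew /(cdomE ew)[h1 h2]; have ef := ef1 w ew h1; apply: gevenD; first exact: ef2.
  by apply: gevenMo; [exact: op1|exact: ox2].
by move=> w ew Vw; apply: goddMr; [exact: eg | exact: op].
Qed.

Lemma canalytic : [/\ super_analytic cdom cf, super_analytic cdom cg,
  super_analytic cdom cxi & super_analytic cdom cpsi].
Proof.
have [[ef1 _ _ _] [sf1 sp1 ax1 ag1] _ _] := sc1; have [_ [sf2 sp2 ax2 ag2] _ _] := sc2.
have oc := open_cdom; have af1 := sd_sa sf1.
have cmp F : super_analytic V2 F -> super_analytic cdom (fun x => F (f1 x)).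
  by move=> aF; exact: sa_comp.
have sub F : super_analytic V1 F -> super_analytic cdom F by apply: sa_sub cdom1.
have ag : super_analytic cdom cg.
  apply: sa_add => //; apply: sa_mul => //; [exact: sub|exact: cmp (sd_sa' sp2)|exact: sub|exact: cmp].
have ap : super_analytic cdom cpsi.
  apply: sa_add => //; first exact: cmp (sd_sa sp2).
  by apply: sa_mul => //; [exact: sub (sd_sa sp1) | exact: cmp].
split; [ | exact: ag | | exact: ap].
  apply: sa_add => //; first exact: cmp (sd_sa sf2).
  by apply: sa_mul => //; [exact: sub (sd_sa sp1) | exact: cmp].
exact: sa_mul.
Qed.

(** The outer components at f1 + rho xi1 are expanded exactly to first order, since (rho xi1)^2 = 0;
    the rest is [comp_val_identity]. *)
Lemma cvalue x : dewitt cdom x ->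
  H2 (H1 x) = (cf (ev x) + od x * cxi (ev x)) + (cpsi (ev x) + od x * cg (ev x)).
Proof.
move=> Vx; have [[ef1 eg1 ox1 op1] _ _ hr1] := sc1; have [[ef2 eg2 ox2 op2] [sf2 sp2 ax2 ag2] _ hr2] := sc2.
have eew := geven_ev x; have oor := godd_od x; set w := ev x in eew *; set r := od x in oor *.
have Vw : cdom (body w) by rewrite body_ev.
have [V1w V2w] := cdomE eew Vw; have ef := ef1 w eew V1w.
have [X [sX _]] := sa_deriv oV2 ax2; have [Y [sY _]] := sa_deriv oV2 ag2.
have [x1E _] := hr1 w eew V1w; have [x2E g22] := hr2 _ ef V2w.
have oxi1 := ox1 w eew V1w; have opsi1 := op1 w eew V1w; have eg1w := eg1 w eew V1w.
have eeta : geven (r * xi1 w) by apply: gevenMo.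
have beta : body (r * xi1 w) = 0 by rewrite bodyM (body_odd oor) mul0r.
have etaeta : r * xi1 w * (r * xi1 w) = 0.
  exact: nil_square (sqr_odd oor) (odd_anticomm oxi1 oor).
have V2e : V2 (body (f1 w + r * xi1 w)) by rewrite bodyD beta addr0.
have orho : godd (psi1 w + r * g1 w) by exact: (goddD opsi1 (goddMl oor eg1w)).
have H1E : H1 x = (f1 w + r * xi1 w) + (psi1 w + r * g1 w).
  by rewrite {1}[x]ev_od; exact: (sconf_at sc1 eew V1w oor).
have ee : geven (f1 w + r * xi1 w) by exact: (gevenD ef eeta).
rewrite H1E (sconf_at sc2 ee V2e orho).
rewrite (sd_nil2 sf2 ef V2w eeta beta etaeta) (sd_nil2 sX ef V2w eeta beta etaeta).
rewrite (sd_nil2 sp2 ef V2w eeta beta etaeta) (sd_nil2 sY ef V2w eeta beta etaeta).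
rewrite /cf /cxi /cpsi /cg x2E x1E.
have e2 := eg2 _ ef V2w; have op2w := op2 _ ef V2w.
have op2' := sd_odd oV2 sp2 op2 ef V2w; have ef2' := sd_even oV2 sf2 ef2 ef V2w.
apply: comp_val_identity.
- by move=> y; exact: even_comm.
- by move=> y; exact: even_comm.
- by move=> y; exact: even_comm.
- exact: sqr_odd.
- exact: sqr_odd.
- exact: odd_anticomm.
- exact: odd_anticomm.
- exact: odd_anticomm.
- exact: odd_anticomm.
- exact: g22.
- reflexivity.
- by move=> y; rewrite -x1E; exact: even_comm.
Qed.

(** Both sides are analytic, so scalars suffice. There the derivatives of the composites are first
    Taylor coefficients, given by the chain and product rules, and the relation becomes
    [super_square]. *)
Lemma csquare F' P' w : super_deriv cdom cf F' -> super_analytic cdom F' ->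
  super_deriv cdom cpsi P' -> super_analytic cdom P' -> geven w -> cdom (body w) ->
  cg w ^+ 2 = F' w + cpsi w * P' w.
Proof.
move=> sF' aF' sP' aP' ew Vw.
have [af ag _ ap] := canalytic; have oc := open_cdom.
have a2 : super_analytic cdom (fun w => cg w * cg w) by apply: sa_mul.
have a3 : super_analytic cdom (fun w => F' w + cpsi w * P' w).
  exact: (sa_add oc aF' (sa_mul oc ap aP')).
rewrite expr2; apply: (@sa_agree _ cdom (fun w => cg w * cg w) _ w oc a2 a3 _ ew Vw).
move=> b {w ew Vw} Vb; have [Vb1 Vb2] := Vb; set w := b%:A; have ew : geven w := gevenA b.
have Vw : V1 (body w) by rewrite /w bodyA.
have [[ef1 eg1 ox1 op1] [sf1 sp1 ax1 ag1] _ hr1] := sc1.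
have [[ef2 eg2 ox2 op2] [sf2 sp2 ax2 ag2] _ hr2] := sc2.
have ef := ef1 w ew Vw.
have [X [sX aX]] := sa_deriv oV2 ax2; have [Y [sY _]] := sa_deriv oV2 ag2.
(* The derivative of the outer xi is eliminated by differentiating xi = g psi. *)
have XE : X (f1 w) = g2 (f1 w) * psi2' (f1 w) + Y (f1 w) * psi2 (f1 w).
  apply: (product_rule oV2 sY sp2 sX aX _ ef Vb2) => v ev0 Vv.
  exact: (proj1 (hr2 v ev0 Vv)).
have [x1E g12] := hr1 w ew Vw; have [x2E g22] := hr2 _ ef Vb2.
have [T1 [tT1 T11]] := comp_taylor oV1 oV2 sf1 sf2 ef1 Vb1 Vb2.
have [T2 [tT2 T21]] := comp_taylor oV1 oV2 sf1 sp2 ef1 Vb1 Vb2.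
have [T3 [tT3 T31]] := comp_taylor oV1 oV2 sf1 sX ef1 Vb1 Vb2.
have [T4 [tT4 T41]] := comp_taylor oV1 oV2 sf1 sY ef1 Vb1 Vb2.
have [tp ttp ttp'] := sp1 _ Vb1.
have sub F : super_analytic V1 F -> super_analytic cdom F by apply: sa_sub cdom1.
have af1 := sd_sa sf1.
have cmp F : super_analytic V2 F -> super_analytic cdom (fun x => F (f1 x)).
  by move=> aF; exact: sa_comp.
have asp1 := sub _ (sd_sa sp1).
have tcf : taylor cf b (fun n => T1 n + convs tp T3 n).
  apply: (taylor_add oc (cmp _ (sd_sa sf2)) (sa_mul oc asp1 (cmp _ ax2)) Vb tT1).
  exact: (taylor_mul oc asp1 (cmp _ ax2) Vb ttp tT3).
have tcp : taylor cpsi b (fun n => T2 n + convs tp T4 n).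
  apply: (taylor_add oc (cmp _ (sd_sa sp2)) (sa_mul oc asp1 (cmp _ ag2)) Vb tT2).
  exact: (taylor_mul oc asp1 (cmp _ ag2) Vb ttp tT4).
rewrite (deriv_at sF' Vb tcf) (deriv_at sP' Vb tcp) !convs1 T11 T21 T31 T41.
rewrite -(taylor0 tT3) -(taylor0 tT4) -(taylor0 ttp) -(deriv_at sp1 Vb1 ttp) -/w.
rewrite /cg /cpsi XE x2E x1E.
have oa := op2 _ ef Vb2; have ob := sd_odd oV2 sp2 op2 ef Vb2.
have op := op1 w ew Vw; have od' := sd_odd oV1 sp1 op1 ew Vw.
have e1 := eg1 w ew Vw; have e2 := eg2 _ ef Vb2; have eF := sd_even oV2 sf2 ef2 ef Vb2.
have eK := sd_even oV1 sf1 ef1 ew Vw; have eG := sd_even oV2 sY eg2 ef Vb2.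
move: (psi2 (f1 w)) (psi2' (f1 w)) (psi1 w) (psi1' w) (g1 w) (g2 (f1 w)) (f2' (f1 w))
  (f1' w) (Y (f1 w)) oa ob op od' e1 e2 eF eK eG g12 g22.
move=> a b0 p d0 G1 G2 F K G oa ob op od' e1 e2 eF eK eG g12 g22.
exact: super_square.
Qed.

Lemma cscu : (forall w, geven w -> V1 (body w) -> body (g1 w) != 0) ->
  (forall w, geven w -> V2 (body w) -> body (g2 w) != 0) ->
  scu cdom (fun x => H2 (H1 x)).
Proof.
move=> u1 u2; have [af ag axi ap] := canalytic.
have [F' [sF' aF']] := sa_deriv open_cdom af; have [P' [sP' aP']] := sa_deriv open_cdom ap.
exists cf, cxi, cpsi, cg, F', P'; split.
  split; [exact: cparity | by split | exact: cvalue | ].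
  by move=> w ew Vw; split; [reflexivity | exact: csquare].
move=> w ew Vw; have [h1 h2] := cdomE ew Vw.
have [[ef1 _ ox1 _] _ _ _] := sc1.
have -> : body (cg w) = body (g1 w) * body (g2 (f1 w)).
  exact: etrans (body_add0l _ (body_oddM _ (ox1 w ew h1))) (bodyM _ _).
by rewrite mulf_neq0 ?u1 ?u2 //; exact: ef1.
Qed.

End Comp.

Lemma scu_comp V1 V2 H1 H2 : open V1 -> open V2 -> scu V1 H1 -> scu V2 H2 ->
  scu [set b | V1 b /\ V2 (body (H1 b%:A))] (fun x => H2 (H1 x)).
Proof.
move=> oV1 oV2 [f1 [xi1 [psi1 [g1 [f1' [psi1' [sc1 u1]]]]]]].
move=> [f2 [xi2 [psi2 [g2 [f2' [psi2' [sc2 u2]]]]]]].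
have := cscu oV1 oV2 sc1 sc2 u1 u2; apply: scu_sub => b /= [Vb].
have Vb' : V1 (body b%:A) by rewrite bodyA.
by rewrite (sconf_body oV1 sc1 Vb') bodyA.
Qed.

End SuperconformalCalculus.

(** * Local nature of superconformality and the identity principle *)

Section Locality.
Variable R : realType.
Local Notation C := (cplx R).
Local Notation Lam := (Gr R).
Implicit Types (a x y s v w : Lam) (c d u : nat -> Lam) (r e : R) (h z b : C).
Implicit Types (F G H : Lam -> Lam) (V W U : set C).

(** Choose component functions near each b, and evaluate at w those chosen for the body of w. By
    uniqueness they coincide on overlaps, derivatives included, so near b they are the ones chosen
    for b. *)
Lemma scu_glue V H :
  (forall b, V b -> exists U, [/\ open U, U b, U `<=` V & scu U H]) -> scu V H.
Proof.
move=> loc.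
(* All the local data in one tuple, so that a single choice picks them coherently. *)
pose data := (set C * (Lam -> Lam) * (Lam -> Lam) * (Lam -> Lam) * (Lam -> Lam) * (Lam -> Lam) * (Lam -> Lam))%type.
pose P b (D : data) := let: (U, f, xi, psi, g, f', psi') := D in
  [/\ open U, U b, U `<=` V, sconf U H f xi psi g f' psi' &
  forall w, geven w -> U (body w) -> body (g w) != 0].
have [D hD] : exists D : C -> data, forall b, V b -> P b (D b).
  suff h b : exists D, V b -> P b D.
    by exists (fun b => sval (cid (h b))) => b; exact: svalP (cid (h b)).
  have [Vb|nVb] := pselect (V b); last first.
    by exists (set0, id, id, id, id, id, id) => /nVb.
  have [U [oU Ub UV [f [xi [psi [g [f' [psi' [sc u]]]]]]]]] := loc b Vb.
  by exists (U, f, xi, psi, g, f', psi').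
pose U b := (D b).1.1.1.1.1.1.
pose f b := (D b).1.1.1.1.1.2.
pose xi b := (D b).1.1.1.1.2.
pose psi b := (D b).1.1.1.2.
pose g b := (D b).1.1.2.
pose f' b := (D b).1.2.
pose psi' b := (D b).2.
have {}hD b : V b -> [/\ open (U b), U b b, U b `<=` V,
    sconf (U b) H (f b) (xi b) (psi b) (g b) (f' b) (psi' b) &
    forall w, geven w -> U b (body w) -> body (g b w) != 0].
  move=> /hD; rewrite /P /U /f /xi /psi /g /f' /psi'.
  by case: (D b) => [[[[[[? ?] ?] ?] ?] ?] ?].
have agree b w : V b -> geven w -> U b (body w) ->
   [/\ f (body w) w = f b w, xi (body w) w = xi b w, psi (body w) w = psi b w
     & g (body w) w = g b w].
  move=> Vb ew Uw; have [_ _ UV sc _] := hD b Vb; have Vw := UV _ Uw.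
  have [_ Uww _ sc' _] := hD _ Vw.
  by apply: (sconf_uniq sc' sc ew Uww Uw) => rho _.
have agree' b w : V b -> geven w -> U b (body w) ->
    f' (body w) w = f' b w /\ psi' (body w) w = psi' b w.
  move=> Vb ew Uw; have [oU _ UV sc _] := hD b Vb; have Vw := UV _ Uw.
  have [oU' Uww UV' sc' _] := hD _ Vw.
  have [_ [s1 s2 _ _] _ _] := sc; have [_ [s1' s2' _ _] _ _] := sc'.
  split; [apply: (sd_uniq oU' oU s1' s1 ew Uww Uw)|apply: (sd_uniq oU' oU s2' s2 ew Uww Uw)];
    by move=> v ev0 Uv Uv2; have [] := sconf_uniq sc' sc ev0 Uv Uv2 (fun rho _ => erefl).
have tr (F0 : C -> Lam -> Lam) b c : V b ->
    (forall w, geven w -> U b (body w) -> F0 (body w) w = F0 b w) ->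
    taylor (F0 b) b c -> taylor (fun w => F0 (body w) w) b c.
  move=> Vb FE; have [oU Ub _ _ _] := hD b Vb; have [e e0 eU] := open_ball oU Ub.
  apply: (taylor_eq e0) => x ex xe; apply/esym; apply: FE => //.
  by rewrite -(add_subC b (body x)); exact: eU.
exists (fun w => f (body w) w), (fun w => xi (body w) w), (fun w => psi (body w) w),
  (fun w => g (body w) w), (fun w => f' (body w) w), (fun w => psi' (body w) w).
split; last by move=> w ew Vw; have [_ Uw _ _ h] := hD _ Vw; exact: h.
split.
- by split=> w ew Vw; have [_ Uw _ [[h1 h2 h3 h4] _ _ _] _] := hD _ Vw;
    [exact: h1 | exact: h2 | exact: h3 | exact: h4].
- split=> b Vb; have [oU Ub UV [_ [s1 s2 s3 s4] _ _] _] := hD b Vb.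
  + have [c tc tc'] := s1 b Ub; exists c.
      by apply: tr tc => // w ew Uw; have [] := agree b w Vb ew Uw.
    by apply: tr tc' => // w ew Uw; have [] := agree' b w Vb ew Uw.
  + have [c tc tc'] := s2 b Ub; exists c.
      by apply: tr tc => // w ew Uw; have [] := agree b w Vb ew Uw.
    by apply: tr tc' => // w ew Uw; have [] := agree' b w Vb ew Uw.
  + have [c tc] := s3 b Ub; exists c.
    by apply: tr tc => // w ew Uw; have [] := agree b w Vb ew Uw.
  + have [c tc] := s4 b Ub; exists c.
    by apply: tr tc => // w ew Uw; have [] := agree b w Vb ew Uw.
- move=> x Vx; have [_ Ux _ [_ _ h _] _] := hD _ Vx.
  by rewrite body_ev; exact: h.
- by move=> w ew Vw; have [_ Uw _ [_ _ _ h] _] := hD _ Vw; exact: h.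
Qed.

(** The radius e is fixed before b': agreement on a short real segment starting at any point of the
    disc spreads to the whole disc, its centre included. This uniformity is what a closedness
    argument needs. The difference of the two series, recentered at b', has zero coefficients. *)
Lemma ident_local V F G b : open V -> super_analytic V F -> super_analytic V G -> V b ->
  exists2 e : R, 0 < e & forall b', nC (b' - b) < e ->
    (exists2 dl : R, 0 < dl & forall t, 0 < t -> t < dl ->
       F (b' + toC t)%:A = G (b' + toC t)%:A) ->
    forall w, geven w -> nC (body w - b) < e -> F w = G w.
Proof.
move=> oV aF aG Vb; have [c tc] := aF b Vb; have [d td] := aG b Vb.
have [e1 e10 [h1 hV]] := sa_ext oV aF Vb tc; have [e2 e20 [h2 _]] := sa_ext oV aG Vb td.
pose e0 := Order.min e1 e2; have e00 : 0 < e0 by rewrite lt_min e10.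
(* Two points of the disc of radius e around b are less than 2 e apart, while recentering at one of
   them is valid at least up to (10 e - e) / 4. *)
pose e := e0 / 10%:R; have ep : 0 < e by rewrite divr_gt0.
exists e => // b' b'e [dl dl0 FG].
have FGC h : nC h < e -> F (b + h)%:A = G (b + h)%:A.
  move=> he; apply: coefP => S; apply/eqP; rewrite -subr_eq0; apply/eqP.
  pose f n := coef (c n - d n) S; pose phi h := coef (F (b + h)%:A - G (b + h)%:A) S.
  have hf k : nC k < e0 -> ccvg f k (phi k).
    rewrite lt_min => /andP[k1 k2]; apply: scvg_ccvg; rewrite /phi algD.
    by apply: scvgB; [apply: h1|apply: h2]; rewrite ?bodyA //; exact: gevenA.
  pose h0 := b' - b; have h0e : nC h0 < e0.
    by apply: lt_trans b'e _; rewrite /e ltr_pdivrMr // ltr_pMr // ltr1n.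
  have [g [_ gphi]] := ccvg_recenter_ex h0e hf.
  have rad : 0 < (e0 - nC h0) / 4%:R by rewrite divr_gt0 ?subr_gt0.
  have g0 : g = (fun=> 0).
    apply: (@ccvg_uniq R _ _ (fun k => phi (h0 + k)) (Order.min dl ((e0 - nC h0) / 4%:R))).
    - by rewrite lt_min dl0.
    - by move=> t t0; rewrite lt_min => /andP[_ tr]; apply: gphi; rewrite nC_toC ger0_norm // ltW.
    - move=> t t0; rewrite lt_min => /andP[tdl _].
      have -> : phi (h0 + toC t) = 0.
        by rewrite /phi addrA /h0 add_subC FG // subrr coef0.
      apply: vanishing_le (@vanishing0 R) => N; rewrite subr0 big1 ?nC0 // => i _.
      by rewrite mul0r.
  have hh0 : nC (h - h0) < (e0 - nC h0) / 4%:R.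
    have := nCB h h0; have : e0 = 10%:R * e by rewrite /e; field.
    move: he b'e; rewrite -/h0 ltr_pdivlMr //; move: (nC h) (nC h0) (nC _) => x1 x2 x3; lra.
  have := gphi _ hh0; rewrite g0 add_subC => hz.
  rewrite -coefB -/(phi h); apply/eqP; rewrite -nC_eq0; apply/eqP/le_anti.
  rewrite nC_ge0 andbT; apply: vanishing_cst; apply: vanishing_le hz => N.
  rewrite big1 ?sub0r ?nCN // => i _; by rewrite mul0r.
move=> w ew we; pose W := [set z | nC (z - b) < e].
have oW : open W.
  apply/openCP => z Wz; exists (e - nC (z - b)); first by rewrite subr_gt0.
  by move=> y yz; rewrite /W /= -(subrKA z); apply: le_lt_trans (nCD _ _) _; lra.
have WV : W `<=` V.
  move=> z Wz; rewrite -(add_subC b z); apply: hV; apply: lt_le_trans Wz _.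
  apply: (@le_trans _ _ e0); last by rewrite ge_min lexx.
  by rewrite /e ler_pdivrMr // ler_peMr ?(ltW e00) // ler1n.
apply: (sa_agree oW (sa_sub WV aF) (sa_sub WV aG)) => // z Wz.
by rewrite -(add_subC b z); exact: FGC.
Qed.

Lemma scu_ident V H H2 b : open V -> scu V H -> scu V H2 -> V b ->
  exists2 e : R, 0 < e & forall b', nC (b' - b) < e ->
    (exists2 dl : R, 0 < dl & forall x, nC (body x - b') < dl -> H x = H2 x) ->
    forall x, nC (body x - b) < e -> H x = H2 x.
Proof.
move=> oV [f1 [xi1 [psi1 [g1 [f1' [psi1' [sc1 _]]]]]]].
move=> [f2 [xi2 [psi2 [g2 [f2' [psi2' [sc2 _]]]]]]] Vb.
have [_ [/sd_sa af1 /sd_sa ap1 ax1 ag1] hH1 _] := sc1.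
have [_ [/sd_sa af2 /sd_sa ap2 ax2 ag2] hH2 _] := sc2.
have [e1 e10 h1] := ident_local oV af1 af2 Vb.
have [e2 e20 h2] := ident_local oV ax1 ax2 Vb.
have [e3 e30 h3] := ident_local oV ap1 ap2 Vb.
have [e4 e40 h4] := ident_local oV ag1 ag2 Vb.
have [e5 e50 hV] := open_ball oV Vb.
exists (Order.min e5 (Order.min (Order.min e1 e2) (Order.min e3 e4))).
  by rewrite !lt_min e10 e20 e30 e40 e50.
move=> b'; rewrite !lt_min => /and3P[b5 /andP[b1 b2] /andP[b3 b4]] [dl dl0 HH].
have Vb' : V b' by rewrite -(add_subC b b'); exact: hV.
have [e6 e60 hV'] := open_ball oV Vb'.
have near t : 0 < t -> t < Order.min dl e6 ->
    [/\ f1 (b' + toC t)%:A = f2 (b' + toC t)%:A, xi1 (b' + toC t)%:A = xi2 (b' + toC t)%:A,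
      psi1 (b' + toC t)%:A = psi2 (b' + toC t)%:A & g1 (b' + toC t)%:A = g2 (b' + toC t)%:A].
  move=> t0; rewrite lt_min => /andP[tdl t6].
  have nt : nC (toC t) = t by rewrite nC_toC ger0_norm // ltW.
  have Vt : V (body (b' + toC t)%:A) by rewrite bodyA; apply: hV'; rewrite nt.
  apply: (sconf_uniq sc1 sc2 (gevenA _) Vt Vt) => rho orho; apply: HH.
  by rewrite (body_addr0 _ (body_odd orho)) bodyA addrC addKr nt.
have m0 : 0 < Order.min dl e6 by rewrite lt_min dl0.
move=> x; rewrite !lt_min => /and3P[x5 /andP[x1 x2] /andP[x3 x4]].
have Vx : V (body x) by rewrite -(add_subC b (body x)); exact: hV.
have eew := geven_ev x; have be := body_ev x.
rewrite (hH1 x Vx) (hH2 x Vx).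
have E1 : f1 (ev x) = f2 (ev x).
  apply: (h1 b' b1 _ _ eew); last by rewrite be.
  by exists (Order.min dl e6); [exact: m0 | move=> t t0 tm; have [] := near t t0 tm].
have E2 : xi1 (ev x) = xi2 (ev x).
  apply: (h2 b' b2 _ _ eew); last by rewrite be.
  by exists (Order.min dl e6); [exact: m0 | move=> t t0 tm; have [] := near t t0 tm].
have E3 : psi1 (ev x) = psi2 (ev x).
  apply: (h3 b' b3 _ _ eew); last by rewrite be.
  by exists (Order.min dl e6); [exact: m0 | move=> t t0 tm; have [] := near t t0 tm].
have E4 : g1 (ev x) = g2 (ev x).
  apply: (h4 b' b4 _ _ eew); last by rewrite be.
  by exists (Order.min dl e6); [exact: m0 | move=> t t0 tm; have [] := near t t0 tm].
by rewrite E1 E2 E3 E4.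
Qed.

Lemma scu_cont V H b e : open V -> scu V H -> V b -> 0 < e ->
  exists2 dl : R, 0 < dl & forall z, nC (z - b) < dl ->
    V z /\ nC (body (H z%:A) - body (H b%:A)) < e.
Proof.
move=> oV sH Vb e0; pose W := [set z | nC (z - body (H b%:A)) < e].
have oW : open W.
  apply/openCP => z Wz; exists (e - nC (z - body (H b%:A))); first by rewrite subr_gt0.
  by move=> y yz; rewrite /W /= -(subrKA z); apply: le_lt_trans (nCD _ _) _; lra.
have /openCP/(_ b)[] := scu_open oV oW sH.
  by split=> //; rewrite /W /= subrr nC0.
by move=> dl dl0 h; exists dl => // z /h.
Qed.

End Locality.

(** * Compatibility of charts *)

Section Relations.
Variable R : realType.
Local Notation C := (cplx R).
Local Notation Lam := (Gr R).
Implicit Types (a x y : Lam) (V W U : set C) (Rl : Lam -> Lam -> Prop).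

(* The graph of a transition function on a DeWitt open set, possibly empty. *)
Definition srel Rl : Prop := exists V H,
  [/\ open V, forall a, (exists a', Rl a a') <-> V (body a), scu V H &
    forall a a', Rl a a' -> a' = H a].

Lemma srel_eq Rl Rl' : (forall a a', Rl a a' <-> Rl' a a') -> srel Rl -> srel Rl'.
Proof.
move=> E [V [H [oV VE sH hH]]]; exists V, H; split=> //.
  by move=> a; rewrite -VE; split=> -[a' /E]; exists a'.
by move=> a a' /E; exact: hH.
Qed.

Lemma scu0 H : scu (set0 : set C) H.
Proof.
exists id, id, id, id, id, id; split=> [|w _ []].
split=> [| |x []|w _ []].
  by split=> w _ [].
by split=> b [].
Qed.

Lemma srel_restr_l Rl W : open W -> srel Rl -> srel (fun a a' => Rl a a' /\ W (body a)).
Proof.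
move=> oW [V [H [oV VE sH hH]]]; exists (V `&` W), H; split.
- exact: openI.
- move=> a; split=> [[a' [ra Wa]]|[/VE[a' ra] Wa]]; last by exists a'.
  by split=> //; apply/VE; exists a'.
- by apply: scu_sub sH => b [].
- by move=> a a' [/hH].
Qed.

Lemma srel_restr_r Rl W : open W -> srel Rl -> srel (fun a a' => Rl a a' /\ W (body a')).
Proof.
move=> oW [V [H [oV VE sH hH]]]; exists [set b | V b /\ W (body (H b%:A))], H; split.
- exact: (scu_open oV oW sH).
- move=> a; split=> [[a' [ra Wa]]|[/= Va Wa]].
    have Va : V (body a) by apply/VE; exists a'.
    by split=> //; rewrite -(scu_body oV sH Va) -(hH _ _ ra).
  have /VE[a' ra] := Va; exists a'; split=> //.
  by rewrite (hH _ _ ra) (scu_body oV sH Va).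
- by apply: scu_sub sH => b [].
- by move=> a a' [/hH].
Qed.

Lemma srel_graph V H : open V -> scu V H -> srel (fun a a' => V (body a) /\ a' = H a).
Proof.
move=> oV sH; exists V, H; split=> //; last by move=> a a' [].
by move=> a; split=> [[a' []]|Va] //; exists (H a).
Qed.

(** Different points may pass through different intermediate charts, whence the index [i]. Each
    choice gives a composite near one point; since [Rl] is functional these agree, and [scu_glue]
    joins them. *)
Lemma srel_comp (I : Type) (R1 R2 : I -> Lam -> Lam -> Prop) Rl :
  (forall i, srel (R1 i)) -> (forall i, srel (R2 i)) ->
  (forall a a'', Rl a a'' <-> exists i a', R1 i a a' /\ R2 i a' a'') ->
  (forall a b b', Rl a b -> Rl a b' -> b = b') -> srel Rl.
Proof.
move=> s1 s2 E fR.
pose V := [set b | exists a, body a = b /\ exists a', Rl a a'].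
pose H a := xget 0 [set a' | Rl a a'].
have HE a a' : Rl a a' -> a' = H a.
  move=> ra; apply: (fR a) => //.
  exact: (@xgetPex _ 0 [set a' | Rl a a'] (ex_intro _ a' ra)).
have loc b : V b -> exists U H', [/\ open U, U b, scu U H' &
    forall a, U (body a) -> Rl a (H' a)].
  move=> [a [<- [a'' /E[i [a' [r1 r2]]]]]].
  have [V1 [H1 [oV1 V1E sH1 hH1]]] := s1 i; have [V2 [H2 [oV2 V2E sH2 hH2]]] := s2 i.
  exists [set b | V1 b /\ V2 (body (H1 b%:A))], (fun x => H2 (H1 x)).
  split.
  - exact: (scu_open oV1 oV2 sH1).
  - have V1a : V1 (body a) by apply/V1E; exists a'.
    split=> //; rewrite -(scu_body oV1 sH1 V1a) -(hH1 _ _ r1).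
    by apply/V2E; exists a''.
  - exact: (scu_comp oV1 oV2 sH1 sH2).
  - move=> x [/= V1x V2x]; have /V1E[x' rx] := V1x.
    have : V2 (body x') by rewrite (hH1 _ _ rx) (scu_body oV1 sH1 V1x).
    move=> /V2E[x'' rx']; apply/E; exists i, x'; split=> //.
    by rewrite -(hH1 _ _ rx) -(hH2 _ _ rx').
have VE a : (exists a', Rl a a') <-> V (body a).
  split=> [ra|]; first by exists a.
  move=> Va; have [U [H' [_ Ua _ h]]] := loc _ Va.
  by exists (H' a); exact: h.
have UV b U H' : (forall a, U (body a) -> Rl a (H' a)) -> U b -> V b.
  move=> h Ub; exists b%:A; rewrite bodyA; split=> //; exists (H' b%:A).
  by apply: h; rewrite bodyA.
exists V, H; split=> //.
- apply/openCP => b Vb; have [U [H' [/openCP oU Ub _ h]]] := loc _ Vb.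
  have [e e0 he] := oU b Ub; exists e => // z /he; exact: UV h.
- apply: scu_glue => b Vb; have [U [H' [oU Ub sU h]]] := loc _ Vb.
  exists U; split=> //; first by move=> z; exact: UV h.
  by apply: scu_eq sU => x Ux; apply: HE; exact: h.
Qed.

End Relations.

Section Charts.
Variable R : realType.
Local Notation C := (cplx R).
Local Notation Lam := (Gr R).
Implicit Types (a x y : Lam) (V W U : set C).

Definition crel (T : Type) (c c' : pchart R T) a a' : Prop := exists p, c p a /\ c' p a'.

Definition pinj (T : Type) (c : pchart R T) : Prop :=
  (forall p a b, c p a -> c p b -> a = b) /\ (forall p q a, c p a -> c q a -> p = q).

(** For an empty overlap [compatible] says nothing, and the empty domain serves. Otherwise the
    injectivity of the transition function makes it locally invertible, by [superconformal_unit]. *)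
Lemma compat_srel (T : Type) (c c' : pchart R T) :
  (forall a b a', crel c c' a a' -> crel c c' b a' -> a = b) ->
  compatible c c' -> srel (crel c c').
Proof.
move=> inj cc; have [ne|ne] := pselect (exists a a', crel c c' a a'); last first.
  exists set0, id; split; [exact: open0| |exact: scu0|].
    by move=> a; split=> // -[a' ra]; case: ne; exists a, a'.
  by move=> a a' ra; case: ne; exists a, a'.
have [V [H [oV ovE sH hH]]] : exists V H, [/\ open V,
   [set a | exists p a', c p a /\ c' p a'] = dewitt V, superconformal V H &
    forall p a a', c p a -> c' p a' -> a' = H a].
  by apply: cc; move: ne => [a [a' [p h]]]; exists a, p, a'.
have VE a : (exists a', crel c c' a a') <-> V (body a).
  have -> : V (body a) = [set a | exists p a', c p a /\ c' p a'] a by rewrite ovE.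
  by split=> [[a' [p h]]|[p [a' h]]]; [exists p, a' | exists a', p].
exists V, H; split=> //; last by move=> a a' [p [h1 h2]]; exact: hH h1 h2.
apply: superconformal_unit sH _ => x y /VE[x' rx] /VE[y' ry] Hxy.
have ex : x' = H x by case: rx => p [h1 h2]; exact: hH h1 h2.
have ey : y' = H y by case: ry => p [h1 h2]; exact: hH h1 h2.
by apply: (inj _ _ x' rx); rewrite ex Hxy -ey.
Qed.

Lemma srel_compat (T : Type) (c c' : pchart R T) : srel (crel c c') -> compatible c c'.
Proof.
move=> [V [H [oV VE sH hH]]]; rewrite /compatible /= => -[a0 [p0 [a0' h0]]].
exists V, H; split=> //.
- apply/seteqP; split=> a /=.
    by move=> [p [a' h]]; apply/VE; exists a', p.
  by move=> /VE[a' [p h]]; exists p, a'.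
- apply: scu_superconformal sH; exists (body a0); apply/VE; exists a0'.
  by exists p0.
- by move=> p a a' h1 h2; apply: hH; exists p.
Qed.

Lemma crel_inj (T : Type) (c c' : pchart R T) : pinj c -> pinj c' ->
  forall a b a', crel c c' a a' -> crel c c' b a' -> a = b.
Proof.
move=> [f1 _] [_ i2] a b a' [p [h1 h2]] [q [h3 h4]].
by apply: (f1 p) => //; rewrite (i2 _ _ _ h2 h4).
Qed.

Lemma crel_fun (T : Type) (c c' : pchart R T) : pinj c -> pinj c' ->
  forall a b b', crel c c' a b -> crel c c' a b' -> b = b'.
Proof.
move=> [_ i1] [f2 _] a b b' [p [h1 h2]] [q [h3 h4]].
by apply: (f2 p) => //; rewrite (i1 _ _ _ h1 h3).
Qed.

Lemma pinj_srel (T : Type) (c c' : pchart R T) : pinj c -> pinj c' ->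
  compatible c c' -> srel (crel c c').
Proof. by move=> i1 i2; apply: compat_srel; exact: crel_inj. Qed.

Lemma srel_via (T : Type) (Fam : set (pchart R T)) (c c'' : pchart R T) :
  pinj c -> pinj c'' ->
  (forall d, Fam d -> pinj d) ->
  (forall p a a'', c p a -> c'' p a'' -> exists d a', Fam d /\ d p a') ->
  (forall d, Fam d -> srel (crel c d) /\ srel (crel d c'')) ->
  srel (crel c c'').
Proof.
move=> i1 i2 ifam cover sfam.
apply: (@srel_comp R {d | Fam d} (fun d => crel c (sval d)) (fun d => crel (sval d) c'')).
- by move=> [d Fd]; exact: (sfam d Fd).1.
- by move=> [d Fd]; exact: (sfam d Fd).2.
- move=> a a''; split=> [[p [h1 h2]]|[[d Fd] [a' [[p [h1 h2]] [q [h3 h4]]]]]].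
    have [d [a' [Fd h3]]] := cover _ _ _ h1 h2.
    by exists (exist _ d Fd), a'; split; exists p.
  exists p; split=> //; have [_ i] := ifam d Fd.
  by rewrite (i _ _ _ h2 h3).
- exact: crel_fun.
Qed.

(** A map of surfaces is unconstrained off the carrier, so a chart pulled back along it becomes
    injective after restriction to the carrier. *)
Definition crestr (T : Type) (A : set T) (c : pchart R T) : pchart R T :=
  fun p a => A p /\ c p a.

Lemma pinj_pullback (T T' : Type) (A : set T) (f : T -> T') (c : pchart R T') :
  set_inj A f -> pinj c -> pinj (crestr A (fun p => c (f p))).
Proof.
move=> fi [fc ic]; split=> [p a b [_ h] [_ h']|p q a [Ap h] [Aq h']]; first exact: fc h h'.
by apply: fi; rewrite ?inE //; exact: ic h h'.
Qed.

(* The part of super_riemann that is needed of the sewn surface, for which the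
   compatibility of the charts then comes from the isomorphism. *)
Definition wsurf (S : surface R) : Prop :=
  [/\ forall c, atlas S c -> pinj c,
      forall c p a, atlas S c -> c p a -> carrier S p &
      forall p, carrier S p -> exists c a, atlas S c /\ c p a].

Lemma super_riemann_wsurf S : super_riemann S -> wsurf S.
Proof.
move=> [h1 h2 _]; split=> [c /h1[_ f i _]|c p a /h1[h _ _ _] /h|] //.
Qed.

Lemma iso_srel (S S' : surface R) f c c' : wsurf S -> wsurf S' ->
  superconformal_iso f -> atlas S c -> atlas S' c' ->
  srel (crel c (fun p => c' (f p))) /\ srel (crel (fun p => c' (f p)) c).
Proof.
move=> [i1 car1 _] [i2 _ _] [[_ fi _] cc] Ac Ac'; have [c1 c2] := cc c c' Ac Ac'.
have [fc ic] := i1 c Ac; have [fc' ic'] := i2 c' Ac'.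
have finj p q a b y : c p a -> c q b -> c' (f p) y -> c' (f q) y -> p = q.
  move=> h1 h2 h3 h4; apply: fi; rewrite ?inE; [exact: car1 h1|exact: car1 h2|].
  exact: ic' h3 h4.
split.
  apply: compat_srel c1 => a b y [p [h1 h2]] [q [h3 h4]].
  by apply: (fc p) => //; rewrite (finj _ _ _ _ _ h1 h3 h2 h4).
apply: compat_srel c2 => a b y [p [h1 h2]] [q [h3 h4]].
by apply: (fc' (f p)) => //; rewrite (ic _ _ _ h2 h4).
Qed.

(** The charts of the middle surface, pulled back to S along f, are the intermediate charts for
    [srel_via]. *)
Lemma superconformal_iso_comp (S S' S'' : surface R) f g :
  wsurf S -> wsurf S' -> wsurf S'' ->
  @superconformal_iso R S S' f -> @superconformal_iso R S' S'' g ->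
  @superconformal_iso R S S'' (fun p => g (f p)).
Proof.
move=> w w' w'' iF iG.
have [[fS fi fsurj] _] := iF; have [[gS gi gsurj] _] := iG.
have [i1 car1 cov1] := w; have [i2 car2 cov2] := w'; have [i3 car3 cov3] := w''.
have gfi : set_inj (carrier S) (fun p => g (f p)).
  move=> p q pS qS E; apply: fi => //; apply: gi => //.
    exact: (mem_set (fS _ (set_mem pS))).
  exact: (mem_set (fS _ (set_mem qS))).
split; first split=> //.
- by move=> p /fS /gS.
- by move=> p /gsurj[q /fsurj[r rS <-] <-]; exists r.
move=> c c'' Ac Ac''.
pose A := carrier S; pose d c' := crestr A (fun p => c' (f p)).
pose e := crestr A (fun p => c'' (g (f p))).
have ie : pinj e by exact: pinj_pullback gfi (i3 c'' Ac'').
have idd c' : atlas S' c' -> pinj (d c') by move=> /i2; exact: pinj_pullback.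
pose Fam := [set d c' | c' in atlas S'].
have FamE dd : Fam dd -> [/\ pinj dd, srel (crel c dd) /\ srel (crel dd c) &
    srel (crel dd e) /\ srel (crel e dd)].
  move=> [c' Ac' <-]; have [s1 s2] := iso_srel w w' iF Ac Ac'.
  have [s3 s4] := iso_srel w' w'' iG Ac' Ac''; split; first exact: idd.
    split; [apply: srel_eq s1 => a a' | apply: srel_eq s2 => a a'].
      split=> [[p [h1 h2]]|[p [h1 [_ h2]]]]; exists p; split=> //; split=> //.
      exact: car1 h1.
    split=> [[p [h1 h2]]|[p [[_ h1] h2]]]; exists p; split=> //; split=> //.
    exact: car1 h2.
  split; [apply: srel_eq s3 => a a' | apply: srel_eq s4 => a a'].
    split=> [[p' [h1 h2]]|[p [[_ h1] [_ h2]]]]; last by exists (f p).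
    have [p pS E] := fsurj p' (car2 _ _ _ Ac' h1).
    by exists p; split; split; rewrite ?E.
  split=> [[p' [h1 h2]]|[p [[_ h1] [_ h2]]]]; last by exists (f p).
  have [p pS E] := fsurj p' (car2 _ _ _ Ac' h2).
  by exists p; split; split; rewrite ?E.
have cover p : A p -> exists dd a', Fam dd /\ dd p a'.
  move=> Ap; have [c' [a' [Ac' h]]] := cov2 _ (fS _ Ap).
  by exists (d c'), a'; split; [exists c' | split].
split; apply: srel_compat.
  suff : srel (crel c e).
    apply: srel_eq => a a'; split=> [[p [h1 [_ h2]]]|[p [h1 h2]]]; exists p; split=> //.
    by split=> //; exact: car1 h1.
  apply: (srel_via (Fam := Fam) (i1 c Ac) ie).
  - by move=> dd /FamE[].
  - by move=> p a a'' _ [Ap _]; exact: cover.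
  - by move=> dd /FamE[_ [h _] [h' _]].
suff : srel (crel e c).
  apply: srel_eq => a a'; split=> [[p [[_ h1] h2]]|[p [h1 h2]]]; exists p; split=> //.
  by split=> //; exact: car1 h2.
apply: (srel_via (Fam := Fam) ie (i1 c Ac)).
- by move=> dd /FamE[].
- by move=> p a a'' [Ap _] _; exact: cover.
- by move=> dd /FamE[_ [_ h] [_ h']].
Qed.

Lemma tubed_equiv_trans n (T T' T'' : tubed R n) :
  wsurf (surf T) -> wsurf (surf T') -> wsurf (surf T'') ->
  tubed_equiv T T' -> tubed_equiv T' T'' -> tubed_equiv T T''.
Proof.
move=> w w' w'' [f [iF hf]] [g [iG hg]]; exists (fun p => g (f p)); split.
  exact: superconformal_iso_comp iF iG.
move=> k; have [fp [e1 /toC_gt0[r1 r10 ->] h1]] := hf k.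
have [gp [e2 /toC_gt0[r2 r20 ->] h2]] := hg k; split; first by rewrite fp gp.
exists (toC (Order.min r1 r2)); first by rewrite -toC0 toC_lt lt_min r10.
move=> p a cp; rewrite normC_lt lt_min => /andP[l1 l2].
by apply: h2; rewrite ?normC_lt //; apply: h1; rewrite ?normC_lt.
Qed.

(** The hypotheses on T are ones that can be checked directly on a sewn surface. Reversing the match
    of germs requires the coordinates of T to attain every value near 0, as the definition of
    equivalence only follows coordinates from T to T'. *)
Lemma tubed_equiv_sym n (T T' : tubed R n) :
  wsurf (surf T) -> wsurf (surf T') ->
  (forall k, carrier (surf T) (punct T k)) ->
  (forall k, exists2 e : R, 0 < e & forall a, nC (body a) < e ->
     exists2 p, carrier (surf T) p & coord T k p a) ->
  (forall k, pinj (coord T' k)) ->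
  (forall k p a, coord T' k p a -> carrier (surf T') p) ->
  tubed_equiv T T' -> tubed_equiv T' T.
Proof.
move=> w w' pT bT iT' cT' [f [iF hf]]; have [[fS fi fsurj] cc] := iF.
have hg p' : exists p, carrier (surf T') p' -> carrier (surf T) p /\ f p = p'.
  (* Off the carrier the inverse needs some value; a puncture is at hand. *)
  have [h|h] := pselect (carrier (surf T') p'); last by exists (punct T ord0).
  by have [p pS E] := fsurj _ h; exists p.
pose g p' := sval (cid (hg p')).
have gP p' : carrier (surf T') p' -> carrier (surf T) (g p') /\ f (g p') = p'.
  by rewrite /g; case: cid.
have gf p : carrier (surf T) p -> g (f p) = p.
  move=> pS; have [h1 h2] := gP _ (fS _ pS).
  by apply: fi; rewrite ?inE.
exists g; split; last first.
  move=> k; have [fp [e1 /toC_gt0[r1 r10 ->] h1]] := hf k.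
  split; first by rewrite -fp gf //; exact: pT.
  have [r2 r20 h2] := bT k.
  exists (toC (Order.min r1 r2)); first by rewrite -toC0 toC_lt lt_min r10.
  move=> p' a cp; rewrite normC_lt lt_min => /andP[l1 l2].
  have [p pS cpa] := h2 a l2.
  have E : f p = p'.
    by apply: (proj2 (iT' k) _ _ a) => //; apply: h1; rewrite ?normC_lt.
  by rewrite -E gf.
split; first split.
- by move=> p' /gP[].
- move=> p' q' /[!inE] pS qS E.
  by rewrite -(gP _ pS).2 E (gP _ qS).2.
- by move=> p pS; exists (f p); [exact: fS | exact: gf].
have [i1 car1 _] := w; have [i2 car2 _] := w'.
move=> c' c Ac' Ac; have [s1 s2] := iso_srel w w' iF Ac Ac'.
split; apply: srel_compat.
  apply: srel_eq s2 => a a'; split=> [[p [h1 h2]]|[p' [h1 h2]]].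
    by exists (f p); rewrite gf //; exact: car1 h2.
  by exists (g p'); rewrite (gP _ (car2 _ _ _ Ac' h1)).2.
apply: srel_eq s1 => a a'; split=> [[p [h1 h2]]|[p' [h1 h2]]].
  by exists (f p); rewrite gf //; exact: car1 h1.
by exists (g p'); rewrite (gP _ (car2 _ _ _ Ac' h2)).2.
Qed.

End Charts.

(** * Inversion and shifts *)

Section BasicMaps.
Variable R : realType.
Local Notation C := (cplx R).
Local Notation Lam := (Gr R).
Implicit Types (a x y z s v w : Lam) (c d : nat -> Lam) (r e : R) (V W U : set C).

Lemma even_unit x : body x != 0 -> x \is a GRing.unit.
Proof. by rewrite grassmann_unitE. Qed.

Lemma od_mul x y : geven x -> od (x * y) = x * od y.
Proof.
move=> ex; rewrite {1}[y]ev_od mulrDr; apply: od_add.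
  exact: gevenM ex (geven_ev y).
exact: goddMr ex (godd_od y).
Qed.

Lemma geven_inv x : geven x -> geven x^-1.
Proof.
move=> ex; have [ux|nux] := boolP (x \is a GRing.unit); last by rewrite invr_out.
have h : x * od x^-1 = 0 by rewrite -(od_mul _ ex) mulrV // (od_even (@geven1 C)).
have o0 : od x^-1 = 0 by rewrite -[LHS](mulKr ux) h mulr0.
by rewrite [x^-1]ev_od o0 addr0; exact: geven_ev.
Qed.

Lemma body_inv x : body x != 0 -> body x^-1 = (body x)^-1.
Proof.
move=> x0; apply: (mulfI x0); rewrite mulfV // -bodyM mulrV ?body1 //.
exact: even_unit.
Qed.

(* sinv o sinv is (w, rho) |-> (w, - rho), hence a separate inverse. *)
Definition rsinv x : Lam := (ev x)^-1 + (- 'i) *: (od x * (ev x)^-1).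

Lemma ev_sinv x : ev (sinv x) = (ev x)^-1.
Proof.
apply: ev_add; first exact/geven_inv/geven_ev.
exact: goddZ (goddMl (godd_od x) (geven_inv (geven_ev x))).
Qed.
Lemma od_sinv x : od (sinv x) = 'i *: (od x * (ev x)^-1).
Proof.
apply: od_add; first exact/geven_inv/geven_ev.
exact: goddZ (goddMl (godd_od x) (geven_inv (geven_ev x))).
Qed.
Lemma ev_rsinv x : ev (rsinv x) = (ev x)^-1.
Proof.
apply: ev_add; first exact/geven_inv/geven_ev.
exact: goddZ (goddMl (godd_od x) (geven_inv (geven_ev x))).
Qed.
Lemma od_rsinv x : od (rsinv x) = (- 'i) *: (od x * (ev x)^-1).
Proof.
apply: od_add; first exact/geven_inv/geven_ev.
exact: goddZ (goddMl (godd_od x) (geven_inv (geven_ev x))).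
Qed.

Lemma body_sinv x : body x != 0 -> body (sinv x) = (body x)^-1.
Proof. by move=> x0; rewrite -body_ev ev_sinv body_inv ?body_ev. Qed.
Lemma body_rsinv x : body x != 0 -> body (rsinv x) = (body x)^-1.
Proof. by move=> x0; rewrite -body_ev ev_rsinv body_inv ?body_ev. Qed.

Lemma sinvK_aux (j k : C) (w r : Lam) : w \is a GRing.unit -> k * j = 1 ->
  k *: ((j *: (r * w^-1)) * w) = r.
Proof. by move=> uw kj; rewrite -scalerAl scalerA kj scale1r mulrVK. Qed.

Lemma sinvK x : body x != 0 -> rsinv (sinv x) = x.
Proof.
move=> x0; have uw : ev x \is a GRing.unit by apply: even_unit; rewrite body_ev.
rewrite /rsinv ev_sinv od_sinv invrK (sinvK_aux _ uw) -?ev_od //.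
by rewrite mulNr -expr2 sqrCi opprK.
Qed.

Lemma rsinvK x : body x != 0 -> sinv (rsinv x) = x.
Proof.
move=> x0; have uw : ev x \is a GRing.unit by apply: even_unit; rewrite body_ev.
rewrite /sinv ev_rsinv od_rsinv invrK (sinvK_aux _ uw) -?ev_od //.
by rewrite mulrN -expr2 sqrCi opprK.
Qed.

(** This is I o I. The standard coordinate at infinity is [flip] in the chart Upsilon. *)
Definition flip x : Lam := ev x - od x.

Lemma ev_flip x : ev (flip x) = ev x.
Proof. exact: ev_add (geven_ev x) (goddN (godd_od x)). Qed.
Lemma od_flip x : od (flip x) = - od x.
Proof. exact: od_add (geven_ev x) (goddN (godd_od x)). Qed.
Lemma flipK x : flip (flip x) = x.
Proof. by rewrite /flip ev_flip od_flip opprK -ev_od. Qed.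
Lemma body_flip x : body (flip x) = body x.
Proof. by rewrite -body_ev ev_flip body_ev. Qed.

Lemma ev_sshift z x : ev (sshift z x) = ev x - ev z - od x * od z.
Proof.
apply: ev_add; last exact: goddB (godd_od x) (godd_od z).
apply: gevenB (gevenB (geven_ev x) (geven_ev z)) _.
exact: gevenMo (godd_od x) (godd_od z).
Qed.
Lemma od_sshift z x : od (sshift z x) = od x - od z.
Proof.
apply: od_add; last exact: goddB (godd_od x) (godd_od z).
apply: gevenB (gevenB (geven_ev x) (geven_ev z)) _.
exact: gevenMo (godd_od x) (godd_od z).
Qed.
Lemma body_sshift z x : body (sshift z x) = body x - body z.
Proof.
rewrite -body_ev ev_sshift; have h : body (- (od x * od z)) = 0.
  by rewrite bodyN (body_oddM _ (godd_od x)) oppr0.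
by rewrite (body_addr0 _ h) bodyB !body_ev.
Qed.

(** The even component of s_(s_b(a)) o s_b = s_a at the point (x0, x1). The products of x1 with b1
    cancel, as do a1 b1 and b1 a1 by anticommutation. *)
Lemma shift_identity (A : nzRingType) (x0 b0 a0 x1 b1 a1 : A) :
  a1 * b1 = - (b1 * a1) -> b1 * b1 = 0 ->
  (x0 - b0 - x1 * b1) - (a0 - b0 - a1 * b1) - (x1 - b1) * (a1 - b1) = x0 - a0 - x1 * a1.
Proof.
move=> h bb; rewrite h opprK mulrBr !mulrBl bb subr0 !opprD !opprK.
move: (x1 * b1) (b1 * a1) (x1 * a1) => P Q S.
rewrite [LHS](AC (3*3*3) ((1*4*7)*((2*5)*((3*9)*(6*8))))).
by rewrite /= !addNr !addr0.
Qed.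

Lemma ev_od_eq x y : ev x = ev y -> od x = od y -> x = y.
Proof. by move=> h1 h2; rewrite [x]ev_od h1 h2 -ev_od. Qed.

Lemma sshift_comp z z' x : sshift (sshift z z') (sshift z x) = sshift z' x.
Proof.
have := (ev_sshift z x, od_sshift z x, ev_sshift z z', od_sshift z z', ev_sshift z' x, od_sshift z' x).
move: (sshift z x) (sshift z z') (sshift z' x) => X Z Y [[[[[h1 h2] h3] h4] h5] h6].
apply: ev_od_eq.
  rewrite ev_sshift h1 h3 h5 h2 h4; apply: shift_identity; last exact: sqr_odd (godd_od z).
  exact: odd_anticomm (godd_od z') (godd_od z).
by rewrite od_sshift h2 h4 h6; exact: sub_shift.
Qed.

Lemma sshift0 x : sshift 0 x = x.
Proof. by rewrite /sshift ev0G od0G mulr0 !subr0 -ev_od. Qed.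

Lemma sshift_diag z : sshift z z = 0.
Proof. by rewrite /sshift !subrr (sqr_odd (godd_od _)) subr0 addr0. Qed.

Lemma sshiftK z x : sshift (- z) (sshift z x) = x.
Proof.
have E : sshift z 0 = - z.
  by rewrite /sshift ev0G od0G mul0r subr0 !sub0r -opprD -ev_od.
by rewrite -E sshift_comp sshift0.
Qed.

Lemma sshift_inj z : injective (sshift z).
Proof. exact: can_inj (sshiftK z). Qed.

Lemma sshiftVK z x : sshift z (sshift (- z) x) = x.
Proof. by rewrite -{1}[z]opprK sshiftK. Qed.

Lemma scu_basic V (f g f' : Lam -> Lam) : maps_to V f (@geven C) -> maps_to V g (@geven C) ->
  super_deriv V f f' -> super_analytic V g ->
  (forall w, geven w -> V (body w) -> g w ^+ 2 = f' w) ->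
  (forall w, geven w -> V (body w) -> body (g w) != 0) ->
  scu V (fun x => f (ev x) + od x * g (ev x)).
Proof.
move=> ef eg sf ag rel u.
have t0 b : taylor (fun=> 0 : Lam) b (fun=> 0 : Lam).
  apply: (@ext_taylor _ 1) => // x ex xe D; apply: vanishing_le (@vanishing0 R) => N.
  by rewrite /psum big1 ?subrr ?nrm0 // => i _; rewrite mul0r.
exists f, (fun=> 0), (fun=> 0), g, f', (fun=> 0); split; last exact: u.
split.
- by split=> // w _ _; exact: godd0.
- split=> // b Vb; exists (fun=> 0); [exact: t0| |exact: t0].
  have -> : (fun n : nat => (0 : Lam) *+ n.+1) = (fun=> 0) by apply/funext => n; rewrite mul0rn.
  exact: t0.
- by move=> x Vx; rewrite mulr0 addr0 add0r.
- by move=> w ew Vw; rewrite mulr0 mul0r addr0; split=> //; exact: rel.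
Qed.

Definition id_coef (b : C) (n : nat) : Lam :=
  if n is 0%N then b%:A else if n is 1%N then 1 else 0.
Definition cst_coef (a : Lam) (n : nat) : Lam := if n is 0%N then a else 0.

Lemma taylor_id (b : C) : taylor id b (id_coef b).
Proof.
apply: (@ext_taylor _ 1) => // x ex xe D; apply: (@vanishing_near _ _ _ 2 _ (@vanishing0 R)) => -[|[|N]] // _.
rewrite psum_recl big_ord_recl expr1 mul1r big1 ?addr0 ?subrr ?nrm0 // => i _.
by rewrite mul0r.
Qed.

Lemma taylor_cst (a : Lam) (b : C) : taylor (fun=> a) b (cst_coef a).
Proof.
apply: (@ext_taylor _ 1) => // x ex xe D; apply: (@vanishing_near _ _ _ 1 _ (@vanishing0 R)) => -[|N] // _.
rewrite psum_recl big1 ?addr0 ?subrr ?nrm0 // => i _.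
by rewrite mul0r.
Qed.

Lemma dcoef_cst a : dcoef (cst_coef a) = cst_coef 0.
Proof. by apply/funext => -[|n]; rewrite /dcoef /= mul0rn. Qed.
Lemma dcoef_id b : dcoef (id_coef b) = cst_coef 1.
Proof. by apply/funext => -[|n]; rewrite /dcoef /= ?mulr1n ?mul0rn. Qed.

Lemma sd_id V : super_deriv V id (fun=> 1 : Lam).
Proof.
move=> b _; exists (id_coef b); first exact: taylor_id.
by have := taylor_cst 1 b; rewrite -(dcoef_id b).
Qed.
Lemma sd_cst V a : super_deriv V (fun=> a) (fun=> 0 : Lam).
Proof.
move=> b _; exists (cst_coef a); first exact: taylor_cst.
by have := taylor_cst 0 b; rewrite -(dcoef_cst a).
Qed.

Lemma scu_sshift z : scu setT (sshift z).
Proof.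
exists (fun w => w + - ev z), (fun=> - od z), (fun=> - od z), (fun=> 1), (fun=> 1), (fun=> 0).
split; last by move=> w _ _; rewrite body1 oner_neq0.
split.
- split=> w ew _; [exact: gevenB ew (geven_ev z) | exact: geven1 | | ];
    exact: goddN (godd_od z).
- split; [ | exact: sd_cst | exact: sd_sa (sd_cst _) | exact: sd_sa (sd_cst _)].
  move=> b Vb; exists (fun n => id_coef b n + cst_coef (- ev z) n).
    exact (@taylor_add _ setT id (fun=> - ev z) b (id_coef b) (cst_coef (- ev z)) openT (sd_sa (sd_id (V:=setT)))
      (sd_sa (sd_cst (V:=setT) (- ev z))) Vb (taylor_id b) (taylor_cst _ b)).
  have -> : (fun n => (id_coef b n.+1 + cst_coef (- ev z) n.+1) *+ n.+1) = cst_coef 1.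
    by apply/funext => -[|n]; rewrite /= addr0 ?mulr1n ?mul0rn.
  exact: taylor_cst.
- move=> x _; rewrite /sshift mulrN mulr1; congr (_ + _); exact: addrC.
- by move=> w _ _; rewrite mul1r expr1n mulr0 addr0.
Qed.

Lemma scu_flip : scu setT flip.
Proof.
have := @scu_basic setT id (fun=> -1) (fun=> 1).
have -> : flip = (fun x => id (ev x) + od x * (-1)) by apply/funext => x; rewrite mulrN1.
apply.
- by [].
- by move=> w _ _; exact: gevenN (@geven1 C).
- exact: sd_id.
- exact: sd_sa (sd_cst _).
- by move=> w _ _; rewrite sqrrN expr1n.
- by move=> w _ _; rewrite bodyN body1 oppr_eq0 oner_neq0.
Qed.

Lemma inv_partial (A : unitRingType) (y p t : A) : y \is a GRing.unit -> y * p = 1 - t ->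
  p - y^-1 = - (y^-1 * t).
Proof.
by move=> uy yp; rewrite -[p](mulKr uy) yp mulrBr mulr1 addrAC subrr add0r.
Qed.

Lemma geo_partial (b : C) x N : b != 0 ->
  (b%:A + x) * psum (fun n => ((-1) ^+ n * b ^- n.+1)%:A) x N = 1 - ((- b^-1) *: x) ^+ N.
Proof.
move=> b0; set t := (- b^-1) *: x.
have -> : b%:A + x = b *: (1 - t).
  by rewrite scalerBr scalerA mulrN mulfV // scaleN1r opprK.
have -> : psum (fun n => ((-1) ^+ n * b ^- n.+1)%:A) x N = b^-1 *: \sum_(i < N) t ^+ i.
  rewrite /psum scaler_sumr; apply: eq_bigr => i _.
  rewrite -scalerAl mul1r /t exprZn scalerA; congr (_ *: _).
  by rewrite [in RHS]exprNn [RHS]mulrCA exprVn -invfM -exprS.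
rewrite -scalerAl -scalerAr scalerA mulfV // scale1r.
by rewrite -[RHS]opprB subrX1 -mulNr opprB.
Qed.

(** The geometric series: the error after N terms is the inverse times the N-th power of - x / b,
    which vanishes because |body x| < |b|, whatever the soul of x. *)
Lemma ext_inv (b : C) : b != 0 ->
  ext (nC b) (@GRing.inv Lam) b (fun n => ((-1) ^+ n * b ^- n.+1)%:A).
Proof.
move=> b0 x ex xb D.
have nb : 0 < nC b by rewrite nC_gt0.
have uy : b%:A + x \is a GRing.unit.
  apply: even_unit; rewrite body_zx; apply/eqP => h.
  have E : b = - body x by apply/eqP; rewrite -addr_eq0 h.
  by move: xb; rewrite E nCN ltxx.
pose r0 := (nC (body x) + nC b) / 2%:R; have n0 := nC_ge0 (body x).
have [A A0 hA] : exists2 A, 0 <= A & forall k, nrm D 1 (x ^+ k) <= A * r0 ^+ k.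
  by apply: nrmX_bound; rewrite /r0; lra.
have t0 : 0 <= r0 / nC b by rewrite divr_ge0 ?(ltW nb) // /r0; lra.
have t1 : r0 / nC b < 1 by rewrite ltr_pdivrMr // mul1r /r0; lra.
have B0 : 0 <= nrm D 1 (b%:A + x)^-1 by exact: nrm_ge0.
apply: vanishing_le (vanishingM (mulr_ge0 B0 A0) (vanishing_geo t0 t1)) => N.
rewrite (inv_partial uy (geo_partial x N b0)) nrmN.
apply: le_trans (nrmM _ _ _ ler01) _; rewrite -mulrA ler_wpM2l //.
rewrite exprZn nrmZ nCX nCN nCV expr_div_n exprVn mulrA [leRHS]mulrC.
by apply: ler_wpM2l; [rewrite invr_ge0 exprn_ge0 // ltW | exact: hA].
Qed.

Lemma open_neq0 : open [set b : C | b != 0].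
Proof.
apply/openCP => b /= b0; exists (nC b); first by rewrite nC_gt0.
move=> z zb; apply/eqP => z0; move: zb; rewrite z0 sub0r nCN ltxx //.
Qed.

Lemma neg_inv_square (A : unitRingType) (w d : A) : w \is a GRing.unit ->
  0 = w * d + 1 * w^-1 -> d = - (w^-1 * w^-1).
Proof.
move=> uw /esym/eqP; rewrite mul1r addr_eq0 => /eqP h.
by rewrite -[d](mulKr uw) h mulrN.
Qed.

(** Covers I and its inverse, k being i or - i: with f = 1 / w and g = k / w, the relation g^2 = f'
    amounts to k^2 = -1. *)
Lemma scu_kinv (k : C) : k ^+ 2 = -1 ->
  scu [set b : C | b != 0] (fun x => (ev x)^-1 + k *: (od x * (ev x)^-1)).
Proof.
move=> k2; set V := [set b : C | b != 0].
have ai : super_analytic V (@GRing.inv Lam).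
  by move=> b b0; eexists; apply: ext_taylor (ext_inv b0); rewrite nC_gt0.
have [F' [sF' aF']] := sa_deriv open_neq0 ai.
have eiv : maps_to V (@GRing.inv Lam) (@geven C) by move=> w ew _; exact: geven_inv.
have rel w : geven w -> V (body w) -> F' w = - (w^-1 * w^-1).
  move=> ew Vw; apply: neg_inv_square; first exact: even_unit.
  have vv v : geven v -> V (body v) -> (fun=> 1 : Lam) v = id v * v^-1.
    by move=> ev0 Vv; apply/esym; apply: mulrV; exact: even_unit.
  (* The derivative of 1 / w comes from differentiating w w^-1 = 1. *)
  exact (@product_rule _ V id (fun=> 1) (@GRing.inv Lam) F' (fun=> 1) (fun=> 0) w open_neq0
    (sd_id (V:=V)) sF' (sd_cst (1 : Lam)) (sd_sa (sd_cst 0)) vv ew Vw).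
have -> : (fun x : Lam => (ev x)^-1 + k *: (od x * (ev x)^-1)) =
    (fun x => (ev x)^-1 + od x * (k *: (ev x)^-1)).
  by apply/funext => x; rewrite scalerAr.
apply: (@scu_basic V (@GRing.inv Lam) (fun w => k *: w^-1) F') => //.
- by move=> w ew _; exact: gevenZ (geven_inv ew).
- have -> : (fun w : Lam => k *: w^-1) = (fun w => (k%:A) * w^-1).
    by apply/funext => w; rewrite -scalerAl mul1r.
  exact: (sa_mul open_neq0 (sd_sa (sd_cst (k%:A : Lam)))).
- by move=> w ew Vw; rewrite rel // exprZn k2 scaleN1r expr2.
- move=> w ew Vw; rewrite bodyZ mulf_neq0 //.
    by apply/eqP => k0; move/eqP: k2; rewrite k0 expr0n /= eq_sym oppr_eq0 oner_eq0.
  by rewrite body_inv // invr_eq0.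
Qed.

Lemma scu_sinv : scu [set b : C | b != 0] (@sinv R).
Proof. by apply: scu_kinv; exact: sqrCi. Qed.
Lemma scu_rsinv : scu [set b : C | b != 0] rsinv.
Proof. by apply: scu_kinv; rewrite sqrrN sqrCi. Qed.

End BasicMaps.

(** * The super-Riemann sphere *)

Section GluingTheory.
Variables (R : realType) (T1 T2 : Type).
Variables (U1 : set T1) (U2 : set T2) (r : T1 -> T2 -> Prop).
Hypothesis r_inj : forall p p' q, r p q -> r p' q -> p = p'.
Hypothesis r_fun : forall p q q', r p q -> r p q' -> q = q'.
Local Notation cls := (glue_class U1 U2 r).
Local Notation gin := (glue_in U1 U2).
Local Notation gcar := (glue_carrier U1 U2 r).

Lemma glue_rel_refl x : glue_rel r x x. Proof. by case: x. Qed.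
Lemma glue_rel_sym x y : glue_rel r x y -> glue_rel r y x.
Proof. by case: x y => [p|q] [p'|q'] /=. Qed.
(** The two chains that leave one piece and come back to it are where the relation has to be a
    partial bijection. *)
Lemma glue_rel_trans x y z : glue_rel r x y -> glue_rel r y z -> glue_rel r x z.
Proof.
case: x y z => [p|q] [p'|q'] [p''|q''] /=; do ?[by move=> -> ->|by move=> ->|by move=> h <-].
- exact: r_inj.
- exact: r_fun.
Qed.

Lemma cls_eq x y : gin x -> (cls x = cls y <-> glue_rel r x y).
Proof.
move=> ix; split=> [E|xy].
  have : cls x x by split=> //; exact: glue_rel_refl.
  by rewrite E => -[_ /glue_rel_sym].
apply/seteqP; split=> z [iz h]; split=> //; last exact: glue_rel_trans h.
exact: glue_rel_trans (glue_rel_sym xy) h.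
Qed.

Lemma glue_carrier_cls x : gin x -> gcar (cls x).
Proof. by move=> ix; exists x. Qed.

Lemma glue_carrierP X x : gcar X -> X x -> gin x /\ X = cls x.
Proof. by move=> [y iy <-] [ix yx]; split=> //; apply/(cls_eq _ iy). Qed.

Lemma glue_chart1P (c : pchart R T1) X a :
  glue_chart1 U1 U2 r c X a <-> exists p, [/\ U1 p, c p a & X = cls (inl p)].
Proof.
split=> [[gX [p Xp cpa]]|[p [Up cpa ->]]].
  by have [ip ->] := glue_carrierP gX Xp; exists p.
split; first exact: (@glue_carrier_cls (inl p)).
by exists p => //; split.
Qed.

Lemma glue_chart2P (c : pchart R T2) X a :
  glue_chart2 U1 U2 r c X a <-> exists q, [/\ U2 q, c q a & X = cls (inr q)].
Proof.
split=> [[gX [p Xp cpa]]|[p [Up cpa ->]]].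
  by have [ip ->] := glue_carrierP gX Xp; exists p.
split; first exact: (@glue_carrier_cls (inr p)).
by exists p => //; split.
Qed.

End GluingTheory.

Section Sphere.
Variable R : realType.
Local Notation C := (cplx R).
Local Notation Lam := (Gr R).
Local Notation pN x := (sphere_class (inl x : Lam + Lam)).
Local Notation pS u := (sphere_class (inr u : Lam + Lam)).
Implicit Types (a x u : Lam) (P Q : set (Lam + Lam)).

Lemma sphere_rel_inj p p' q : @sphere_rel R p q -> sphere_rel p' q -> p = p'.
Proof. by move=> [_ ->] [_ ->]. Qed.
Lemma sphere_rel_fun p q q' : @sphere_rel R p q -> sphere_rel p q' -> q = q'.
Proof. by move=> [q0 ->] [q0' E]; rewrite -(sinvK q0) E sinvK. Qed.

Lemma DeltaE P x : Delta P x <-> P = pN x.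
Proof.
rewrite /Delta; split=> [/(@glue_chart1P R _ _ setT setT _ sphere_rel_inj sphere_rel_fun)|->].
  by move=> [p [_ <-]].
by apply/(@glue_chart1P R _ _ setT setT _ sphere_rel_inj sphere_rel_fun); exists x.
Qed.

Lemma UpsilonE P u : Upsilon P u <-> P = pS u.
Proof.
rewrite /Upsilon; split=> [/(@glue_chart2P R _ _ setT setT _ sphere_rel_inj sphere_rel_fun)|->].
  by move=> [p [_ <-]].
by apply/(@glue_chart2P R _ _ setT setT _ sphere_rel_inj sphere_rel_fun); exists u.
Qed.

Lemma pN_inj x x' : pN x = pN x' -> x = x'.
Proof. by move/(@cls_eq _ _ setT setT _ sphere_rel_inj sphere_rel_fun (inl x) (inl x') I). Qed.
Lemma pS_inj u u' : pS u = pS u' -> u = u'.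
Proof. by move/(@cls_eq _ _ setT setT _ sphere_rel_inj sphere_rel_fun (inr u) (inr u') I). Qed.

Lemma pN_pS x u : pN x = pS u <-> body u != 0 /\ x = sinv u.
Proof. exact: (@cls_eq _ _ setT setT _ sphere_rel_inj sphere_rel_fun (inl x) (inr u) I). Qed.

Lemma pN_pS' x u : pN x = pS u <-> body x != 0 /\ u = rsinv x.
Proof.
rewrite pN_pS; split=> [[u0 ->]|[x0 ->]].
  by rewrite body_sinv // invr_eq0 u0 sinvK.
by rewrite body_rsinv // invr_eq0 x0 rsinvK.
Qed.

Lemma sphere_carrier P : carrier (super_sphere R) P ->
  (exists x, P = pN x) \/ (exists2 u, body u = 0 & P = pS u).
Proof.
move=> [[x|u] _ <-]; first by left; exists x.
have [u0|u0] := eqVneq (body u) 0; first by right; exists u.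
by left; exists (sinv u); apply/esym/pN_pS.
Qed.

Lemma carrier_pN x : carrier (super_sphere R) (pN x). Proof. by exists (inl x). Qed.
Lemma carrier_pS u : carrier (super_sphere R) (pS u). Proof. by exists (inr u). Qed.

Lemma is_pchart_Delta : is_pchart (carrier (super_sphere R)) (@Delta R).
Proof.
split.
- by move=> p a /DeltaE ->; exact: carrier_pN.
- by move=> p a b /DeltaE -> /DeltaE/pN_inj.
- by move=> p q a /DeltaE -> /DeltaE ->.
- exists setT; first exact: openT.
  by apply/seteqP; split=> // a _; exists (pN a); apply/DeltaE.
Qed.

Lemma is_pchart_Upsilon : is_pchart (carrier (super_sphere R)) (@Upsilon R).
Proof.
split.
- by move=> p a /UpsilonE ->; exact: carrier_pS.
- by move=> p a b /UpsilonE -> /UpsilonE/pS_inj.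
- by move=> p q a /UpsilonE -> /UpsilonE ->.
- exists setT; first exact: openT.
  by apply/seteqP; split=> // a _; exists (pS a); apply/UpsilonE.
Qed.

Lemma srel_id : srel (fun a a' : Lam => a = a').
Proof.
apply: srel_eq (srel_graph openT (scu_sshift (0 : Lam))) => a a'.
by rewrite sshift0; split=> [[_ ->]|->].
Qed.

Lemma srel_Delta2 : srel (crel (@Delta R) (@Delta R)).
Proof.
apply: srel_eq srel_id => a a'; split=> [<-|[p [/DeltaE -> /DeltaE/pN_inj]] //].
by exists (pN a); split; apply/DeltaE.
Qed.
Lemma srel_Upsilon2 : srel (crel (@Upsilon R) (@Upsilon R)).
Proof.
apply: srel_eq srel_id => a a'; split=> [<-|[p [/UpsilonE -> /UpsilonE/pS_inj]] //].
by exists (pS a); split; apply/UpsilonE.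
Qed.
Lemma srel_DU : srel (crel (@Delta R) (@Upsilon R)).
Proof.
apply: srel_eq (srel_graph (@open_neq0 R) (@scu_rsinv R)) => a a'.
split=> [/pN_pS' E|[p [/DeltaE -> /UpsilonE/pN_pS']] //].
by exists (pN a); split; [apply/DeltaE | apply/UpsilonE].
Qed.
Lemma srel_UD : srel (crel (@Upsilon R) (@Delta R)).
Proof.
apply: srel_eq (srel_graph (@open_neq0 R) (@scu_sinv R)) => a a'.
split=> [/pN_pS E|[p [/UpsilonE -> /DeltaE/esym/pN_pS]] //].
by exists (pS a); split; [apply/UpsilonE | apply/DeltaE].
Qed.

Lemma super_riemann_sphere : super_riemann (super_sphere R).
Proof.
split.
- by move=> c [->|->]; [exact: is_pchart_Delta | exact: is_pchart_Upsilon].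
- move=> P [[x|u] _ <-]; [exists (@Delta R), x | exists (@Upsilon R), u]; split.
  + by left.
  + exact/DeltaE.
  + by right.
  + exact/UpsilonE.
- move=> c c' [->|->] [->|->]; apply: srel_compat.
  + exact: srel_Delta2.
  + exact: srel_DU.
  + exact: srel_UD.
  + exact: srel_Upsilon2.
Qed.

Lemma wsurf_sphere : wsurf (super_sphere R).
Proof. exact: super_riemann_wsurf super_riemann_sphere. Qed.

End Sphere.

(** * Stereographic projection and the body of the super-Riemann sphere *)

Section Stereographic.
Variable R : realType.
Local Notation C := (cplx R).
Local Notation Lam := (Gr R).
Local Notation pN x := (sphere_class (inl x : Lam + Lam)).
Local Notation pS u := (sphere_class (inr u : Lam + Lam)).
Implicit Types (a x u : Lam) (P Q : set (Lam + Lam)) (b : R * R) (v : R * R * R).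

Definition stereo_den b : R := b.1 ^+ 2 + b.2 ^+ 2 + 1.
(** The inverse of the stereographic projection from the north pole (0, 0, 1), which is [stereo]. *)
Definition stereo_inv b : R * R * R :=
  (2%:R * b.1 / stereo_den b, 2%:R * b.2 / stereo_den b,
   (b.1 ^+ 2 + b.2 ^+ 2 - 1) / stereo_den b).
Definition stereo v : R * R := (v.1.1 / (1 - v.2), v.1.2 / (1 - v.2)).
(* The rotation by pi exchanging the two poles. *)
Definition swap_poles v : R * R * R := (v.1.1, - v.1.2, - v.2).
(** The function 1 / z in real coordinates. *)
Definition recip b : R * R :=
  (b.1 / (b.1 ^+ 2 + b.2 ^+ 2), - b.2 / (b.1 ^+ 2 + b.2 ^+ 2)).

Lemma stereo_den_gt0 b : 0 < stereo_den b.
Proof. by have := (sqr_ge0 b.1, sqr_ge0 b.2); rewrite /stereo_den; move=> [h1 h2]; lra. Qed.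

Lemma stereo_invK b : stereo (stereo_inv b) = b.
Proof.
case: b => x y; have := stereo_den_gt0 (x, y); rewrite /stereo /stereo_inv /stereo_den /=.
set D := _ + 1 => D0.
have E : 1 - (x ^+ 2 + y ^+ 2 - 1) / D = 2%:R / D.
  by rewrite /D; field; rewrite gt_eqF.
have D' : D != 0 by rewrite gt_eqF.
by rewrite E; congr pair; field; rewrite ?D'.
Qed.

Lemma stereo_inv_lt1 b : (stereo_inv b).2 < 1.
Proof.
have D0 := stereo_den_gt0 b; rewrite /stereo_inv /= ltr_pdivrMr // mul1r /stereo_den; lra.
Qed.

Lemma stereo_inv_sphere b : unit_sphere (stereo_inv b).
Proof.
case: b => x y; have := stereo_den_gt0 (x, y); rewrite /unit_sphere /stereo_inv /stereo_den /=.
move=> D0; field; by rewrite gt_eqF.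
Qed.

Lemma stereoK v : unit_sphere v -> v.2 < 1 -> stereo_inv (stereo v) = v.
Proof.
case: v => [[x y] z]; rewrite /unit_sphere /stereo_inv /stereo_den /stereo /= => h z1.
have z0 : 1 - z != 0 by rewrite subr_eq0 gt_eqF.
have E : x ^+ 2 = (1 - z) * (1 + z) - y ^+ 2 by rewrite -[x ^+ 2](addrK (y ^+ 2)); nra.
have F : (x / (1 - z)) ^+ 2 + (y / (1 - z)) ^+ 2 = (1 + z) / (1 - z).
  by rewrite !expr_div_n E; field.
rewrite F; have -> : (1 + z) / (1 - z) + 1 = 2%:R / (1 - z) by field.
by congr (_, _, _); field.
Qed.

Lemma swap_polesK v : swap_poles (swap_poles v) = v.
Proof. by case: v => [[x y] z]; rewrite /swap_poles /= !opprK. Qed.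

Lemma swap_poles_sphere v : unit_sphere v -> unit_sphere (swap_poles v).
Proof. by rewrite /unit_sphere /swap_poles /= !sqrrN. Qed.

(** Makes the two descriptions of the body map, through Delta and through Upsilon, agree on the
    overlap, where the bodies of the coordinates are inverse to each other. *)
Lemma stereo_inv_recip b : b != (0, 0) -> stereo_inv (recip b) = swap_poles (stereo_inv b).
Proof.
case: b => x y b0.
have N0 : 0 < x ^+ 2 + y ^+ 2.
  have [x0|x0] := eqVneq x 0.
    have y0 : y != 0 by apply: contra b0 => /eqP ->; rewrite x0.
    by apply: ltr_wpDl; rewrite ?sqr_ge0 // exprn_even_gt0.
  by apply: ltr_pwDl; rewrite ?sqr_ge0 // exprn_even_gt0.
rewrite /stereo_inv /stereo_den /recip /swap_poles /=.
have N' : x ^+ 2 + y ^+ 2 != 0 by rewrite gt_eqF.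
have D' : x ^+ 2 + y ^+ 2 + 1 != 0 by rewrite gt_eqF // ltr_wpDr.
set N := x ^+ 2 + y ^+ 2 in N' D' *.
have F : (x / N) ^+ 2 + (- y / N) ^+ 2 = N^-1.
  by rewrite !expr_div_n sqrrN -mulrDl -/N; field.
have G : N^-1 + 1 = (N + 1) / N by field.
by rewrite F G; congr (_, _, _); field; rewrite ?N' ?D'.
Qed.

Definition pairC (z : C) : R * R := (complex.Re z, complex.Im z).
Definition Cpair b : C := Complex b.1 b.2.

Lemma pairCK z : Cpair (pairC z) = z. Proof. by case: z. Qed.
Lemma CpairK b : pairC (Cpair b) = b. Proof. by case: b. Qed.

Lemma pairC_inv (z : C) : z != 0 -> pairC z^-1 = recip (pairC z).
Proof.
by case: z => x y _; rewrite /recip /= mulNr.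
Qed.

Lemma pairC_eq0 (z : C) : z != 0 -> pairC z != (0, 0).
Proof.
by apply: contra => /eqP h; rewrite -[z]pairCK h; apply/eqP.
Qed.

Lemma open_Cpair (V : set C) : open V -> open [set b | V (Cpair b)].
Proof.
move=> /openCP oV; rewrite openE => b /= /oV[e e0 eV].
have e2 : 0 < e / 2%:R by lra.
apply/nbhs_ballP; exists (e / 2%:R) => //= b' [h1 h2]; apply: eV.
apply: le_lt_trans (nC_ReIm _) _.
have -> : complex.Re (Cpair b' - Cpair b) = b'.1 - b.1 by [].
have -> : complex.Im (Cpair b' - Cpair b) = b'.2 - b.2 by [].
have {}h1 : `|b.1 - b'.1| < e / 2%:R by [].
have {}h2 : `|b.2 - b'.2| < e / 2%:R by [].
by rewrite distrC [in X in _ + X]distrC; lra.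
Qed.

Lemma open_pairC (W : set (R * R)) : open W -> open [set z : C | W (pairC z)].
Proof.
rewrite openE => oW; apply/openCP => z /= /oW /nbhs_ballP[e /= e0 eW].
exists e => // z' zz; apply: eW; split; rewrite /ball /= distrC.
  by apply: le_lt_trans zz; rewrite -raddfB; exact: Re_le.
by apply: le_lt_trans zz; rewrite -raddfB; exact: Im_le.
Qed.

End Stereographic.

Section Genus0.
Variable R : realType.
Local Notation C := (cplx R).
Local Notation Lam := (Gr R).
Local Notation pN x := (sphere_class (inl x : Lam + Lam)).
Local Notation pS u := (sphere_class (inr u : Lam + Lam)).
Implicit Types (a x u : Lam) (P Q : set (Lam + Lam)) (b : R * R) (v : R * R * R).

Lemma stereo_inv_cont : continuous (@stereo_inv R).
Proof.
move=> b; have D0 : stereo_den b != 0 by rewrite gt_eqF // stereo_den_gt0.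
have c1 : (fun b' : R * R => b'.1) @ b --> b.1 by exact: cvg_fst.
have c2 : (fun b' : R * R => b'.2) @ b --> b.2 by exact: cvg_snd.
have cD : (fun b' => b'.1 ^+ 2 + b'.2 ^+ 2) @ b --> b.1 ^+ 2 + b.2 ^+ 2.
  by apply: cvgD; rewrite !expr2; apply: cvgM.
have cI : (fun b' => (stereo_den b')^-1) @ b --> (stereo_den b)^-1.
  by apply: cvgV => //; apply: cvgD cD _; exact: cvg_cst.
have k1 : (fun b' => 2%:R * b'.1 / stereo_den b') @ b --> 2%:R * b.1 / stereo_den b.
  by apply: cvgM cI; apply: cvgM c1; exact: cvg_cst.
have k2 : (fun b' => 2%:R * b'.2 / stereo_den b') @ b --> 2%:R * b.2 / stereo_den b.
  by apply: cvgM cI; apply: cvgM c2; exact: cvg_cst.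
have k3 : (fun b' => (b'.1 ^+ 2 + b'.2 ^+ 2 - 1) / stereo_den b') @ b -->
    (b.1 ^+ 2 + b.2 ^+ 2 - 1) / stereo_den b.
  by apply: cvgM cI; apply: cvgB cD _; exact: cvg_cst.
exact: (cvg_pair (cvg_pair k1 k2) k3).
Qed.

Lemma stereo_cont v : v.2 < 1 -> (@stereo R) @ v --> stereo v.
Proof.
move=> v1.
have c1 : (fun v' : R * R * R => v'.1.1) @ v --> v.1.1 by apply: cvg_comp cvg_fst cvg_fst.
have c2 : (fun v' : R * R * R => v'.1.2) @ v --> v.1.2 by apply: cvg_comp cvg_fst cvg_snd.
have c3 : (fun v' : R * R * R => v'.2) @ v --> v.2 by exact: cvg_snd.
have cI : (fun v' : R * R * R => (1 - v'.2)^-1) @ v --> (1 - v.2)^-1.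
  apply: cvgV; first by rewrite subr_eq0 gt_eqF.
  by apply: cvgB c3; exact: cvg_cst.
exact: (cvg_pair (cvgM c1 cI) (cvgM c2 cI)).
Qed.

Lemma swap_poles_cont : continuous (@swap_poles R).
Proof.
move=> v.
have c1 : (fun v' : R * R * R => v'.1.1) @ v --> v.1.1 by apply: cvg_comp cvg_fst cvg_fst.
have c2 : (fun v' : R * R * R => v'.1.2) @ v --> v.1.2 by apply: cvg_comp cvg_fst cvg_snd.
have c3 : (fun v' : R * R * R => v'.2) @ v --> v.2 by exact: cvg_snd.
exact: (cvg_pair (cvg_pair c1 (cvgN c2)) (cvgN c3)).
Qed.

Lemma open_stereo (V : set (R * R)) : open V -> open [set v | v.2 < 1 /\ V (stereo v)].
Proof.
rewrite openE => oV; rewrite openE => v /= [v1 Vv].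
have n1 : nbhs v [set v' : R * R * R | v'.2 < 1].
  have c3 : (fun v' : R * R * R => v'.2) @ v --> v.2 by exact: cvg_snd.
  exact: cvgr_lt c3 _ v1.
have n2 : nbhs v [set v' | V (stereo v')] by apply: (stereo_cont v1); exact: oV.
by apply: filterS (filterI n1 n2).
Qed.

Lemma open_swap (W : set (R * R * R)) : open W -> open [set v | W (swap_poles v)].
Proof. by move=> oW; apply: open_comp oW => v _; exact: swap_poles_cont. Qed.

Lemma open_stereo_inv (W : set (R * R * R)) : open W -> open [set b | W (stereo_inv b)].
Proof. by move=> oW; apply: open_comp oW => v _; exact: stereo_inv_cont. Qed.

Definition north : R * R * R := swap_poles (stereo_inv (0, 0)).

(** Read off from the coordinate Delta where it exists; all remaining points have Upsilon-coordinate
    of body 0 and form the single body point at infinity. *)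
Definition body_map P : R * R * R :=
  if pselect (exists x, P = pN x) is left e
  then stereo_inv (pairC (body (sval (cid e)))) else north.

Lemma body_map_pN x : body_map (pN x) = stereo_inv (pairC (body x)).
Proof.
rewrite /body_map; case: pselect => [e|[]]; last by exists x.
by case: cid => x' /= /pN_inj <-.
Qed.

Lemma body_map_pS u : body_map (pS u) = swap_poles (stereo_inv (pairC (body u))).
Proof.
have [u0|u0] := eqVneq (body u) 0.
  rewrite /body_map; case: pselect => [e|_]; last by rewrite u0.
  by exfalso; case: e => x /esym/pN_pS[]; rewrite u0 eqxx.
have <- : pN (sinv u) = pS u by apply/pN_pS.
by rewrite body_map_pN body_sinv // pairC_inv // stereo_inv_recip // pairC_eq0.
Qed.

Lemma body_map_sphere P : carrier (super_sphere R) P -> unit_sphere (body_map P).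
Proof.
move=> [[x|u] _ <-]; rewrite -/(sphere_class _) ?body_map_pN ?body_map_pS.
  exact: stereo_inv_sphere.
exact/swap_poles_sphere/stereo_inv_sphere.
Qed.

Lemma north_ge1 : (swap_poles (stereo_inv (0, 0) : R * R * R)).2 = 1.
Proof. by rewrite /swap_poles /stereo_inv /stereo_den /= expr0n /= !add0r divr1 opprK. Qed.

Lemma body_map_inj P Q : carrier (super_sphere R) P -> carrier (super_sphere R) Q ->
  body_map P = body_map Q <-> @body_eq R (super_sphere R) P Q.
Proof.
move=> cP cQ; split; last first.
  move=> [c [a [b [[->|->] h1 h2 E]]]].
    by move: h1 h2 => /DeltaE -> /DeltaE ->; rewrite !body_map_pN E.
  by move: h1 h2 => /UpsilonE -> /UpsilonE ->; rewrite !body_map_pS E.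
have north1 := north_ge1.
move: (sphere_carrier cP) (sphere_carrier cQ) => [[x ->]|[u u0 ->]] [[y ->]|[w w0 ->]].
- rewrite !body_map_pN => /(congr1 (@stereo R)); rewrite !stereo_invK => E.
  exists (@Delta R), x, y; split; [by left|exact/DeltaE|exact/DeltaE|].
  by rewrite -[body x]pairCK E pairCK.
- rewrite body_map_pN body_map_pS w0 => E.
  by have := stereo_inv_lt1 (pairC (body x)); rewrite E north1 ltxx.
- rewrite body_map_pN body_map_pS u0 => E.
  by have := stereo_inv_lt1 (pairC (body y)); rewrite -E north1 ltxx.
- move=> _; exists (@Upsilon R), u, w; split; [by right|exact/UpsilonE|exact/UpsilonE|].
  by rewrite u0 w0.
Qed.

Lemma body_map_surj v : unit_sphere v -> exists2 P, carrier (super_sphere R) P & body_map P = v.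
Proof.
move=> sv; have [v1|v1] := ltP v.2 1.
  exists (pN (Cpair (stereo v))%:A); first exact: carrier_pN.
  by rewrite body_map_pN bodyA CpairK stereoK.
have sv' := swap_poles_sphere sv.
exists (pS (Cpair (stereo (swap_poles v)))%:A); first exact: carrier_pS.
rewrite body_map_pS bodyA CpairK stereoK // ?swap_polesK //.
by rewrite /swap_poles /=; lra.
Qed.

Lemma genus0_sphere : body_genus0 (super_sphere R).
Proof.
exists body_map; split; [|exact: body_map_inj|].
  apply/seteqP; split=> [_ [P cP <-]|v /body_map_surj[P cP <-]]; last by exists P.
  exact: body_map_sphere.
move=> U Uc; split=> [oU|[W oW UE] c [->|->]]; last first.
- exists [set z | W (swap_poles (stereo_inv (pairC z)))].
    exact: (@open_pairC R [set b | W (swap_poles (stereo_inv b))] (open_stereo_inv (open_swap oW))).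
  rewrite UE; apply/seteqP; split=> [u [P [_ WP] /UpsilonE PE]|u /= Wu].
    by move: WP; rewrite PE body_map_pS.
  by exists (pS u); [split; [exact: carrier_pS | rewrite body_map_pS] | exact/UpsilonE].
- exists [set z | W (stereo_inv (pairC z))].
    exact: (@open_pairC R [set b | W (stereo_inv b)] (open_stereo_inv oW)).
  rewrite UE; apply/seteqP; split=> [u [P [_ WP] /DeltaE PE]|u /= Wu].
    by move: WP; rewrite PE body_map_pN.
  by exists (pN u); [split; [exact: carrier_pN | rewrite body_map_pN] | exact/DeltaE].
have [V oV VE] := oU (@Delta R) (or_introl erefl).
have [V' oV' VE'] := oU (@Upsilon R) (or_intror erefl).
have UN x : U (pN x) <-> V (body x).
  have -> : V (body x) = [set a | exists2 p, U p & Delta p a] x by rewrite VE.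
  by split=> [Ux|[P UP /DeltaE <-]] //; exists (pN x) => //; exact/DeltaE.
have US u : U (pS u) <-> V' (body u).
  have -> : V' (body u) = [set a | exists2 p, U p & Upsilon p a] u by rewrite VE'.
  by split=> [Ux|[P UP /UpsilonE <-]] //; exists (pS u) => //; exact/UpsilonE.
(* The images of U in the two charts, moved to the sphere minus the north pole and minus the south
   pole respectively; their union is the open set sought. *)
pose WN := [set v : R * R * R | v.2 < 1 /\ V (Cpair (stereo v))].
pose WS := [set v : R * R * R | (swap_poles v).2 < 1 /\ V' (Cpair (stereo (swap_poles v)))].
have oWN : open WN by apply: (@open_stereo [set b | V (Cpair b)]); exact: open_Cpair.
have oWS : open WS.
  apply: (@open_swap [set v | v.2 < 1 /\ V' (Cpair (stereo v))]).
  by apply: (@open_stereo [set b | V' (Cpair b)]); exact: open_Cpair.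
have WNE x : WN (body_map (pN x)) <-> U (pN x).
  rewrite UN body_map_pN /WN /= stereo_invK pairCK; split=> [[]|Vx] //; split=> //.
  exact: (stereo_inv_lt1 (pairC (body _))).
have WSE u : WS (body_map (pS u)) <-> U (pS u).
  rewrite US body_map_pS /WS /= swap_polesK stereo_invK pairCK; split=> [[]|Vx] //; split=> //.
  by rewrite opprK; exact: (stereo_inv_lt1 (pairC (body _))).
exists (WN `|` WS); first exact: openU.
apply/seteqP; split=> [P UP|P [cP]].
  split; first exact: Uc.
  by have := Uc _ UP; move: UP => /[swap] -[[x|u] _ <-] UP; [left; exact/WNE | right; exact/WSE].
move: (sphere_carrier cP) => [[x ->]|[u u0 ->]].
  move=> [/WNE //|h]; have [x0|x0] := eqVneq (body x) 0.
    exfalso; move: h => [h _]; move: h; rewrite body_map_pN x0.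
    by rewrite [X in X < _]north_ge1 ltxx.
  have E : pN x = pS (rsinv x) by apply/pN_pS'.
  by move: h; rewrite E; exact: (WSE _).1.
move=> [h|/WSE //]; exfalso; move: h => [h _]; move: h.
by rewrite body_map_pS u0; rewrite [X in X < _]north_ge1 ltxx.
Qed.

Lemma supersphere_sphere : supersphere (super_sphere R).
Proof. by split; [exact: super_riemann_sphere | exact: genus0_sphere]. Qed.

End Genus0.

Section Twist.
Variables (R : realType) (T : Type).
Local Notation C := (cplx R).
Local Notation Lam := (Gr R).
Variables (G G' : Lam -> Lam).
Hypotheses (GK : cancel G G') (G'K : cancel G' G) (sG : scu setT G) (sG' : scu setT G').
Implicit Types (c d : pchart R T).

(** For standard data every local coordinate is Delta followed by a shift or Upsilon followed by
    [flip], both global superconformal bijections; their compatibility follows from that of the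
    charts. *)
Definition twist d : pchart R T := fun p a => exists2 x, d p x & a = G x.

Lemma twistE d p a : twist d p a <-> d p (G' a).
Proof.
split=> [[x dx ->]|h]; first by rewrite GK.
by exists (G' a); rewrite ?G'K.
Qed.

Lemma pinj_twist d : pinj d -> pinj (twist d).
Proof.
move=> [f i]; split=> [p a b [x h1 ->] [y h2 ->]|p q a /twistE h1 /twistE h2].
  by rewrite (f _ _ _ h1 h2).
exact: i h1 h2.
Qed.

Lemma srel_twist_r c d : pinj c -> pinj d -> srel (crel c d) -> srel (crel c (twist d)).
Proof.
move=> ic idd s; apply: (@srel_comp R unit (fun=> crel c d) (fun _ a a' => setT (body a) /\ a' = G a)).
- by [].
- by move=> _; exact: srel_graph openT sG.
- move=> a a''; split=> [[p [h1 [x h2 ->]]]|[_ [a' [[p [h1 h2]] [_ ->]]]]].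
    by exists tt, x; split=> //; exists p.
  by exists p; split=> //; exists a'.
- exact/crel_fun/pinj_twist.
Qed.

Lemma srel_twist_l c d : pinj c -> pinj d -> srel (crel d c) -> srel (crel (twist d) c).
Proof.
move=> ic idd s; apply: (@srel_comp R unit (fun _ a a' => setT (body a) /\ a' = G' a) (fun=> crel d c)).
- by move=> _; exact: srel_graph openT sG'.
- by [].
- move=> a a''; split=> [[p [/twistE h1 h2]]|[_ [a' [[_ ->] [p [h1 h2]]]]]].
    by exists tt, (G' a); split=> //; exists p.
  by exists p; split=> //; apply/twistE.
- by apply: crel_fun ic; exact: pinj_twist.
Qed.

End Twist.

(** * The canonical spheres with standard local coordinates *)

Section Canonical.
Variable R : realType.
Local Notation C := (cplx R).
Local Notation Lam := (Gr R).
Local Notation pN x := (sphere_class (inl x : Lam + Lam)).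
Local Notation pS u := (sphere_class (inr u : Lam + Lam)).
Implicit Types (a x u y v : Lam) (P Q : set (Lam + Lam)).

(** With zero sequences the series in the coordinates are polynomials, so that convergence to v
    determines v at every point and the coordinates are defined everywhere. *)
Lemma sconv_lim (c : nat -> Lam) (N : nat) y v :
  (forall n, (N <= n)%N -> c n = 0) ->
  (forall S, series (fun n => coef (c n * y ^+ n) S) @ \oo --> coef v S) <->
  v = \sum_(n < N) c n * y ^+ n.
Proof.
move=> c0.
have lim S : series (fun n => coef (c n * y ^+ n) S) @ \oo -->
    coef (\sum_(n < N) c n * y ^+ n) S.
  rewrite coef_sum -(big_mkord predT (fun n => coef (c n * y ^+ n) S)).
  apply: (@cvg_series_fin R (fun n => coef (c n * y ^+ n) S) N) => n Nn.
  by rewrite c0 // mul0r; exact: mcoeff0.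
split=> [h|-> //]; apply: coefP => S.
exact: (cvg_unique (@norm_hausdorff _ _) (h S) (lim S)).
Qed.

Lemma powL01 (u : sseries R) : powL0 1 u = u.
Proof.
rewrite [RHS]surjective_pairing /powL0; congr pair; apply/funext => n;
  by rewrite expr1n mulr1.
Qed.

Lemma sconv_sx y v : sconv (sx R) y v <-> v = ev y.
Proof.
have s0 (n : nat) : (2 <= n)%N -> (sx R).1 n = 0 by case: n => [|[|n]].
have s1 (n : nat) : (0 <= n)%N -> (sx R).2 n = 0 by [].
split=> [[v0 [v1 [/(sconv_lim _ _ s0) -> /(sconv_lim _ _ s1) -> ->]]]|->].
  by rewrite big_ord0 mulr0 addr0 big_ord_recl big_ord1 mul0r add0r mul1r.
exists (ev y), 0; split; last by rewrite mulr0 addr0.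
  apply/(sconv_lim _ _ s0).
  by rewrite big_ord_recl big_ord1 mul0r add0r mul1r.
by apply/(sconv_lim _ _ s1); rewrite big_ord0.
Qed.

Lemma sconv_sphi y v : sconv (sphi R) y v <-> v = od y.
Proof.
have s0 (n : nat) : (0 <= n)%N -> (sphi R).1 n = 0 by [].
have s1 (n : nat) : (1 <= n)%N -> (sphi R).2 n = 0 by case: n.
split=> [[v0 [v1 [/(sconv_lim _ _ s0) -> /(sconv_lim _ _ s1) -> ->]]]|->].
  by rewrite big_ord0 add0r big_ord1 mulr1 mulr1.
exists 0, 1; split; last by rewrite mulr1 add0r.
  by apply/(sconv_lim _ _ s0); rewrite big_ord0.
by apply/(sconv_lim _ _ s1); rewrite big_ord1 mulr1.
Qed.

Lemma sconv2_id y v : sconv2 (sx R, sphi R) y v <-> v = y.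
Proof.
split=> [[v0 [v1 [/sconv_sx -> /sconv_sphi -> ->]]]|->]; first by rewrite -ev_od.
by exists (ev y), (od y); split; [exact/sconv_sx|exact/sconv_sphi|exact: ev_od].
Qed.

Lemma Ehat_std : Ehat 1 (sseq0 R) = (sx R, sphi R).
Proof. by apply: (congr2 pair); apply: etrans (opexp0 _) _; exact: powL01. Qed.

Lemma Etilde_std : Etilde ((sseq0 R).1, fun j => - 'i *: (sseq0 R).2 j) = (sx R, sphi R).
Proof.
have -> : ((sseq0 R).1, fun j => - 'i *: (sseq0 R).2 j) = sseq0 R.
  by congr pair; apply/funext => j; rewrite /= scaler0.
by apply: (congr2 pair); exact: opexp0.
Qed.

Variables (n : nat) (zs : n.-1.-tuple Lam).
Local Notation T := (canonical (sk_std zs)).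
Local Notation pt_ := (sk_pt (sk_std zs)).

Lemma canonical_coord0 : coord T ord0 = twist (@flip R) (@Upsilon R).
Proof.
apply/funext => p; apply/funext => a; apply/propext.
rewrite /canonical /= unlift_none /= Etilde_std.
split=> [[u hu /sconv2_id ->]|[u hu ->]]; exists u => //.
exact/sconv2_id.
Qed.

Lemma canonical_coordS j : coord T (lift ord0 j) = twist (sshift (pt_ j)) (@Delta R).
Proof.
apply/funext => p; apply/funext => a; apply/propext.
rewrite /canonical /= liftK /= Ehat_std.
split=> [[u hu /sconv2_id ->]|[u hu ->]]; exists u => //.
exact/sconv2_id.
Qed.

Lemma canonical_punct0 : punct T ord0 = pS 0.
Proof. by rewrite /canonical /= unlift_none. Qed.
Lemma canonical_punctS j : punct T (lift ord0 j) = pN (pt_ j).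
Proof. by rewrite /canonical /= liftK. Qed.

Lemma coord0P p a : coord T ord0 p a <-> p = pS (flip a).
Proof.
rewrite canonical_coord0 (@twistE _ _ _ (@flip R)) ?UpsilonE //; exact: flipK.
Qed.

Lemma coordSP j p a : coord T (lift ord0 j) p a <-> p = pN (sshift (- pt_ j) a).
Proof.
rewrite canonical_coordS (@twistE _ _ _ (sshift (- pt_ j))) ?DeltaE //.
  exact: sshiftK.
exact: sshiftVK.
Qed.

Lemma pinj_canonical k : pinj (coord T k).
Proof.
have [iD iU] : pinj (@Delta R) /\ pinj (@Upsilon R).
  by have [i _ _] := wsurf_sphere R; split; apply: i; [left|right].
case: (unliftP ord0 k) => [j|] ->.
  rewrite canonical_coordS; apply: pinj_twist iD; [exact: sshiftK|exact: sshiftVK].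
by rewrite canonical_coord0; apply: pinj_twist iU; exact: flipK.
Qed.

Lemma canonical_srel k c : atlas (super_sphere R) c ->
  srel (crel c (coord T k)) /\ srel (crel (coord T k) c).
Proof.
move=> Ac.
have [iD iU] : pinj (@Delta R) /\ pinj (@Upsilon R).
  by have [i _ _] := wsurf_sphere R; split; apply: i; [left|right].
have ic : pinj c by case: (wsurf_sphere R) => i _ _; exact: i.
have sD : srel (crel c (@Delta R)) /\ srel (crel (@Delta R) c).
  by case: Ac => ->; split; [exact: srel_Delta2|exact: srel_Delta2|exact: srel_UD|exact: srel_DU].
have sU : srel (crel c (@Upsilon R)) /\ srel (crel (@Upsilon R) c).
  by case: Ac => ->; split; [exact: srel_DU|exact: srel_UD|exact: srel_Upsilon2|exact: srel_Upsilon2].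
case: (unliftP ord0 k) => [j|] ->.
  rewrite canonical_coordS; split.
    by apply: (srel_twist_r (sshiftK _) (sshiftVK _) (scu_sshift _) ic iD); case: sD.
  by apply: (srel_twist_l (sshiftK _) (sshiftVK _) (scu_sshift _) ic iD); case: sD.
rewrite canonical_coord0; split.
  by apply: (srel_twist_r (@flipK _) (@flipK _) (@scu_flip _) ic iU); case: sU.
by apply: (srel_twist_l (@flipK _) (@flipK _) (@scu_flip _) ic iU); case: sU.
Qed.

Lemma canonical_coord_surj k a : exists2 p, carrier (super_sphere R) p & coord T k p a.
Proof.
case: (unliftP ord0 k) => [j|] ->.
  by exists (pN (sshift (- pt_ j) a)); [exact: carrier_pN | exact/coordSP].
by exists (pS (flip a)); [exact: carrier_pS | exact/coord0P].
Qed.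

Lemma canonical_coord_carrier k p a : coord T k p a -> carrier (super_sphere R) p.
Proof.
case: (unliftP ord0 k) => [j|] ->; first by move=> /coordSP ->; exact: carrier_pN.
by move=> /coord0P ->; exact: carrier_pS.
Qed.

Lemma canonical_punct_coord k : coord T k (punct T k) 0.
Proof.
case: (unliftP ord0 k) => [j|] ->.
  apply/coordSP; rewrite canonical_punctS.
  by have := sshiftK (pt_ j) (pt_ j); rewrite sshift_diag => ->.
apply/coord0P; rewrite canonical_punct0.
by rewrite /flip ev0G od0G subr0.
Qed.

Lemma canonical_tubes :
  (forall j k : 'I_n, j != k -> body (pt_ j) != body (pt_ k)) ->
  sphere_with_tubes T.
Proof.
move=> dz; split.
- exact: supersphere_sphere.
- by move=> k; exact: canonical_coord_carrier (canonical_punct_coord k).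
- move=> k l kl /body_map_inj h.
  have {}h : body_map (punct T k) = body_map (punct T l).
    by apply: h; apply: canonical_coord_carrier (canonical_punct_coord _).
  (* Height separates the puncture at infinity from the finite ones, and stereographic projection
     separates the latter. *)
  have S0 : (body_map (punct T ord0)).2 = 1.
    by rewrite canonical_punct0 body_map_pS body0; exact: north_ge1.
  have SN j : (body_map (punct T (lift ord0 j))).2 < 1.
    by rewrite canonical_punctS body_map_pN; exact: stereo_inv_lt1.
  move: kl h; case: (unliftP ord0 k) => [j|] ->; case: (unliftP ord0 l) => [j'|] ->.
  + move=> jj; rewrite !canonical_punctS !body_map_pN => /(congr1 (@stereo R)).
    rewrite !stereo_invK => /(congr1 (@Cpair R)); rewrite !pairCK => E.
    have /dz : j != j' by apply: contra jj => /eqP ->.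
    by rewrite E eqxx.
  + by move=> _ h; have := SN j; rewrite h S0 ltxx.
  + by move=> _ h; have := SN j'; rewrite -h S0 ltxx.
  + by rewrite eqxx.
- move=> k; split; last exact: canonical_punct_coord.
  have [f i] := pinj_canonical k; split=> //.
    by move=> p a; exact: canonical_coord_carrier.
  exists setT; first exact: openT.
  by apply/seteqP; split=> // a _; have [p _ h] := canonical_coord_surj k a; exists p.
- by move=> k c Ac; have [s1 s2] := canonical_srel k Ac; split; apply: srel_compat.
Qed.

End Canonical.

(** Real induction: the supremum of the t such that P holds on [0, t] satisfies P by the closedness
    hypothesis, and could be increased by the openness hypothesis if it were below 1. *)
Lemma interval_induction (R : realType) (P : R -> Prop) : P 0 ->
  (forall t, 0 <= t -> t < 1 -> P t -> exists2 dl, 0 < dl & forall s, t <= s -> s < t + dl -> P s) ->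
  (forall t, 0 < t -> t <= 1 -> (forall s, 0 <= s -> s < t -> P s) -> P t) -> P 1.
Proof.
move=> P0 Popen Pclosed.
pose A := [set t : R | [/\ 0 <= t, t <= 1 & forall s, 0 <= s -> s <= t -> P s]].
have A0 : A 0 by split=> // s s0 s1; have -> : s = 0 by lra.
have hA : has_sup A by split; [exists 0 | exists 1 => t [_]].
have ub t : A t -> t <= sup A by exact: (sup_upper_bound hA).
have s0 := ub _ A0.
have s1 : sup A <= 1 by apply: ge_sup; [exists 0 | move=> t []].
have below s : 0 <= s -> s < sup A -> P s.
  move=> s_ge0 /(sup_gt (proj1 hA))[t [_ _ h] /ltW st]; exact: h.
have Ps : P (sup A).
  move: s0; rewrite le_eqVlt => /orP[/eqP <- //|s_gt0]; exact: Pclosed.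
move: s1; rewrite le_eqVlt => /orP[/eqP <- //|s_lt1]; exfalso.
have [dl dl0 hdl] := Popen _ s0 s_lt1 Ps.
have : A (Order.min (sup A + dl / 2%:R) 1).
  split; first by rewrite le_min; lra.
    by rewrite ge_min lexx orbT.
  move=> s s_ge0; rewrite le_min => /andP[h1 h2].
  by have [/below|h] := ltP s (sup A); [exact | apply: hdl => //; lra].
by move/ub; rewrite ge_min; lra.
Qed.

(** * Continuation of coordinates *)

Section Continuation.
Variable R : realType.
Local Notation C := (cplx R).
Local Notation Lam := (Gr R).
Local Notation pN x := (sphere_class (inl x : Lam + Lam)).
Local Notation pS u := (sphere_class (inr u : Lam + Lam)).
Implicit Types (a x u y v : Lam) (P Q : set (Lam + Lam)).

Lemma crel_crestr (T : Type) (A : set T) (c e : pchart R T) :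
  (forall p a, c p a -> A p) -> srel (crel c (crestr A e)) <-> srel (crel c e).
Proof.
move=> cA; have E a a' : crel c (crestr A e) a a' <-> crel c e a a'.
  split=> [[p [h1 [_ h2]]]|[p [h1 h2]]]; exists p; split=> //.
  by split=> //; exact: cA h1.
by split; apply: srel_eq => a a'; rewrite E.
Qed.

Lemma tubes_coord n (T : tubed R n) k : sphere_with_tubes T ->
  [/\ pinj (coord T k), forall p a, coord T k p a -> carrier (surf T) p &
    forall c, atlas (surf T) c ->
      srel (crel c (coord T k)) /\ srel (crel (coord T k) c)].
Proof.
move=> [[/super_riemann_wsurf[i1 _ _] _] _ _ hc cc].
have [[h1 h2 h3 _] _] := hc k.
have ic : pinj (coord T k) by split.
split=> // c Ac; have [c1 c2] := cc k c Ac; have i := i1 c Ac.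
by split; exact: pinj_srel.
Qed.

(** A local coordinate is related only to the charts of its own surface, so these serve as
    intermediate charts. *)
Lemma srel_coord_iso n (T : tubed R n) S' f k c' : sphere_with_tubes T -> wsurf S' ->
  @superconformal_iso R (surf T) S' f -> atlas S' c' ->
  srel (crel (coord T k) (fun p => c' (f p))) /\
  srel (crel (crestr (carrier (surf T)) (fun p => c' (f p))) (coord T k)).
Proof.
move=> hT w' iF Ac'; have [ic car sc] := tubes_coord k hT.
have [[sr _] _ _ _ _] := hT; have w := super_riemann_wsurf sr.
have [i1 car1 cov] := w; have [i2 _ _] := w'; have [[_ fi _] _] := iF.
pose e := crestr (carrier (surf T)) (fun p => c' (f p)).
have ie : pinj e by exact: pinj_pullback fi (i2 c' Ac').
split.
  apply/(crel_crestr _ car); apply: (srel_via (Fam := atlas (surf T)) ic ie i1).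
    by move=> p a a'' /car/cov[d [a' h]] _; exists d, a'.
  move=> d Ad; have [_ s1] := sc d Ad; split=> //.
  have [s2 _] := iso_srel w w' iF Ad Ac'.
  by apply/(crel_crestr _ (fun p a => @car1 d p a Ad)).
apply: (srel_via (Fam := atlas (surf T)) ie ic i1).
  by move=> p a a'' _ /car/cov[d [a' h]]; exists d, a'.
move=> d Ad; have [s1 _] := sc d Ad; split=> //.
have [_ s2] := iso_srel w w' iF Ad Ac'.
apply: srel_eq s2 => a a'; split=> [[p [h1 h2]]|[p [[_ h1] h2]]]; exists p; split=> //.
by split=> //; exact: car1 h2.
Qed.

(** Treats punctures at infinity and finite ones alike. The coordinate is the chart [d0] followed by
    G, which translates bodies by - z; a point outside [d0] is a zero, on bodies, of the other chart
    [di], and on the overlap the two bodies are inverse to each other. *)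
Lemma canonical_chart n (zs : n.-1.-tuple Lam) k :
  exists (d0 di : pchart R (set (Lam + Lam))) (G G' : Lam -> Lam) (z : C),
  [/\ atlas (super_sphere R) d0, atlas (super_sphere R) di,
      coord (canonical (sk_std zs)) k = twist G d0,
      [/\ cancel G G', cancel G' G, scu setT G & forall x, body (G x) = body x - z] &
      (forall P, carrier (super_sphere R) P ->
        (exists x, d0 P x) \/ (exists2 u, di P u & body u = 0)) /\
      (forall P x u, d0 P x -> di P u -> body u * body x = 1)].
Proof.
case: (unliftP ord0 k) => [j|] ->.
  exists (@Delta R), (@Upsilon R), (sshift (sk_pt (sk_std zs) j)),
    (sshift (- sk_pt (sk_std zs) j)), (body (sk_pt (sk_std zs) j)).
  split; [by left|by right|exact: canonical_coordS| |].
    split; [exact: sshiftK|exact: sshiftVK|exact: scu_sshift|exact: body_sshift].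
  split=> [P /sphere_carrier[[x ->]|[u u0 ->]]|P x u /DeltaE -> /UpsilonE/pN_pS[u0 ->]].
  - by left; exists x; apply/DeltaE.
  - by right; exists u => //; apply/UpsilonE.
  - by rewrite body_sinv // mulfV.
exists (@Upsilon R), (@Delta R), (@flip R), (@flip R), 0.
split; [by right|by left|exact: canonical_coord0| |].
  split; [exact: flipK|exact: flipK|exact: scu_flip|].
  by move=> x; rewrite body_flip subr0.
split=> [P cP|P u x /UpsilonE -> /DeltaE/esym/pN_pS[u0 ->]].
  have := sphere_carrier cP => -[[x E]|[u u0 ->]]; last by left; exists u; apply/UpsilonE.
  have [x0|x0] := eqVneq (body x) 0; first by right; exists x => //; apply/DeltaE.
  by left; exists (rsinv x); rewrite E; apply/UpsilonE/pN_pS'.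
by rewrite body_sinv // mulVf.
Qed.

Lemma scu_id V : scu V (@id Lam).
Proof.
apply: (@scu_sub _ setT) => //; apply: scu_eq (scu_sshift (0 : Lam)) => x _.
exact: sshift0.
Qed.

Lemma nC_sub0 (h k : C) (e : R) : k = 0 -> nC (h - k) < e -> nC h < e.
Proof. by move=> ->; rewrite subr0. Qed.

Lemma coord_continuation n (T : tubed R n) (zs : n.-1.-tuple Lam) f k (r1 : R) p a :
  sphere_with_tubes T ->
  superconformal_iso (f : pt (surf T) -> pt (surf (canonical (sk_std zs)))) ->
  (exists2 e : C, 0 < e & forall p a, coord T k p a -> `|body a| < e ->
     coord (canonical (sk_std zs)) k (f p) a) ->
  0 < r1 -> (forall a, nC (body a) <= r1 -> exists p, coord T k p a) ->
  coord T k p a -> nC (body a) <= r1 -> coord (canonical (sk_std zs)) k (f p) a.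
Proof.
move=> hT iF [_ /toC_gt0[e0 e00 ->] germ] r10 surj cpa ar.
have [ic car sc] := tubes_coord k hT.
have [d0 [di [G [G' [z [Ad0 Adi cE [GK G'K sG bG] [cov0 prod1]]]]]]] := canonical_chart zs k.
have ws := wsurf_sphere R; have [iS _ _] := ws.
have [[fS fi _] _] := iF.
pose S := carrier (surf T).
have [V [H [oV VE sH hH]]] : srel (crel (coord T k) (fun p => coord (canonical (sk_std zs)) k (f p))).
  have [s0 _] := srel_coord_iso k hT ws iF Ad0.
  apply/(crel_crestr _ car).
  have -> : crestr S (fun p => coord (canonical (sk_std zs)) k (f p)) =
      twist G (crestr S (fun p => d0 (f p))).
    apply/funext => q; apply/funext => b; apply/propext; rewrite cE.
    by split=> [[Sq [x h ->]]|[x [Sq h] ->]]; [exists x | split=> //; exists x].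
  apply: (srel_twist_r GK G'K sG ic); first exact: pinj_pullback fi (iS d0 Ad0).
  exact/(crel_crestr _ car).
have [[Vi [Hi [oVi ViE sHi hHi]]] _] := srel_coord_iso k hT ws iF Adi.
have good0 x : nC (body x) < Order.min e0 r1 -> V (body x) /\ H x = x.
  rewrite lt_min => /andP[h1 /ltW h2]; have [q cq] := surj x h2.
  have rx : crel (coord T k) (fun p => coord (canonical (sk_std zs)) k (f p)) x x.
    by exists q; split=> //; apply: germ => //; rewrite normC_lt.
  by split; [apply/VE; exists x | rewrite -(hH _ _ rx)].
(* Equality on a whole neighbourhood, rather than at b alone, is an open condition and is what the
   identity principle propagates. The clause [V b] keeps b in the domain of the transition function,
   beyond which H is arbitrary. *)
pose Good b := V b /\ exists2 dl : R, 0 < dl & forall x, nC (body x - b) < dl -> H x = x.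
have Gopen b : Good b -> exists2 dl : R, 0 < dl & forall b', nC (b' - b) < dl -> Good b'.
  move=> [/(open_ball oV)[e1 e10 h1] [dl dl0 h2]].
  have d20 : 0 < dl / 2%:R by lra.
  exists (Order.min e1 (dl / 2%:R)); first by rewrite lt_min e10.
  move=> b'; rewrite lt_min => /andP[l1 l2]; split.
    by have := h1 _ l1; rewrite addrC subrK.
  exists (dl / 2%:R) => // x xb; apply: h2.
  by rewrite -[body x - b](subrKA b'); apply: le_lt_trans (nCD _ _) _; lra.
have [b bdef] : exists b : R -> C, forall t, b t = toC t * body a by exists (fun t => toC t * body a).
have bn t : 0 <= t -> t <= 1 -> nC (b t) <= r1.
  move=> t0 t1; rewrite bdef nCM nC_toC ger0_norm //; have := nC_ge0 (body a); nra.
have bd t s : nC (b t - b s) <= `|t - s| * (r1 + 1).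
  have -> : b t - b s = toC (t - s) * body a by rewrite !bdef -mulrBl -raddfB.
  by rewrite nCM nC_toC ler_wpM2l //; lra.
have near (dl t : R) : 0 < dl -> forall s, `|s - t| < dl / (r1 + 1) -> nC (b s - b t) < dl.
  move=> dl0 s; rewrite ltr_pdivlMr; last by lra.
  exact: le_lt_trans (bd _ _).
have Gend : Good (b 1).
  apply: (@interval_induction _ (fun t => Good (b t))).
  - have e1 : 0 < Order.min e0 r1 by rewrite lt_min e00.
    rewrite bdef mul0r; split.
      by have := good0 0; rewrite body0 nC0 => /(_ e1)[].
    by exists (Order.min e0 r1) => // x; rewrite subr0 => /good0[].
  - move=> t t0 t1 /Gopen[dl dl0 h]; exists (dl / (r1 + 1)); first by apply: divr_gt0 => //; lra.
    move=> s ts sdl; apply: h; apply: near => //.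
    by rewrite ger0_norm; lra.
  - move=> t t0 t1 below.
    have close (dl : R) : 0 < dl -> exists2 s, Good (b s) /\ nC (b s) <= r1 & nC (b s - b t) < dl.
      move=> dl0; have e1 : 0 < dl / (r1 + 1) by apply: divr_gt0 => //; lra.
      pose s := Order.max 0 (t - dl / (r1 + 1) / 2%:R).
      have [s0 st] : 0 <= s /\ s < t by rewrite /s le_max lexx gt_max t0 /=; split=> //; lra.
      have sl : t - dl / (r1 + 1) / 2%:R <= s by rewrite /s le_max lexx orbT.
      exists s; first by split; [exact: below | apply: bn => //; lra].
      by apply: near => //; rewrite ltr0_norm; lra.
    (* Inside the domain the identity principle applies: its radius at b t is known before a good
       point b s closer than that is chosen. *)
    have [Vb|nVb] := pselect (V (b t)).
      have [e1 e10 h] := scu_ident oV sH (scu_id V) Vb.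
      have [s [[Vs hs] _] st] := close _ e10.
      by split=> //; exists e1 => //; exact: h st hs.
    have bx : body (b t)%:A = b t := bodyA _.
    have [q cq] : exists q, coord T k q (b t)%:A.
      by apply: surj; rewrite bx; apply: bn => //; lra.
    have [[x hx]|[u hu u0]] := cov0 (f q) (fS _ (car _ _ cq)).
      exfalso; apply: nVb; rewrite -[b t]bx; apply/VE.
      by exists (G x); exists q; split=> //; rewrite cE; exists x.
    have ru : crel (coord T k) (fun p => di (f p)) (b t)%:A u by exists q.
    have Vib : Vi (b t) by rewrite -[b t]bx; apply/ViE; exists u.
    have nz := nC_ge0 z.
    (* Outside the domain f q is missed by [d0], so its [di]-coordinate has body 0. Near b t that
       coordinate has modulus below this bound, whereas at good points the [d0]-coordinate is b s +
       z on bodies, of modulus at most r1 + |z|. Their product could not be 1. *)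
    have e1 : 0 < (r1 + nC z + 1)^-1 by rewrite invr_gt0; lra.
    have [dl dl0 h] := scu_cont oVi sHi Vib e1.
    have [s [[Vs [dl' dl'0 hs]] sr] /h[Vis]] := close _ dl0.
    have uE : body (Hi (b t)%:A) = 0.
      by apply: etrans u0; apply: (congr1 (@body C)); apply/esym; exact: hHi ru.
    move=> /(nC_sub0 uE) hlt; exfalso.
    have bs : body (b s)%:A = b s := bodyA _.
    have [q' cq'] : exists q, coord T k q (b s)%:A by apply: surj; rewrite bs.
    have /ViE[u' [q1 [c1 du']]] : Vi (body (b s)%:A) by rewrite bs.
    have /VE[y [q2 [c2]]] : V (body (b s)%:A) by rewrite bs.
    rewrite cE => -[x dx yE].
    have q12 : q1 = q2 by apply: (proj2 ic) c1 c2.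
    rewrite -q12 in c2 dx.
    have yb : y = (b s)%:A.
      rewrite (hH (b s)%:A y); last by exists q1; split=> //; rewrite cE; exists x.
      by apply: hs; rewrite bs subrr nC0.
    have xz : body x = b s + z by rewrite -bs -yb yE bG subrK.
    have u'E : u' = Hi (b s)%:A by apply: hHi; exists q1.
    have := prod1 _ _ _ dx du'; rewrite u'E xz => /(congr1 (@nC R)).
    rewrite nCM nC1; have := nCD (b s) z; have := nC_ge0 (b s + z); move: hlt.
    rewrite -[_^-1]mul1r ltr_pdivlMr; last by lra.
    move: (nC _) (nC (b s + z)) (nC_ge0 (body (Hi (b s)%:A))) => A B; nra.
have bE : b 1 = body a by rewrite bdef mul1r.
have [Va [dl dl0 hdl]] := Gend; rewrite bE in Va hdl.
have /VE[a' [q [cq hq]]] := Va.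
rewrite (proj2 ic _ _ _ cpa cq).
suff <- : a' = a by [].
rewrite (hH a a'); last by exists q.
by apply: hdl; rewrite subrr nC0.
Qed.

End Continuation.

Lemma sinv_inj (R : realType) (a b : Gr R) :
  body a != 0 -> body b != 0 -> sinv a = sinv b -> a = b.
Proof.
move=> a0 b0 /(congr1 (@rsinv R)) h.
exact: etrans (esym (sinvK a0)) (etrans h (sinvK b0)).
Qed.


Lemma flip_sinv (R : realType) (a : Gr R) : flip (sinv a) = rsinv a.
Proof. by rewrite /flip ev_sinv od_sinv /rsinv scaleNr. Qed.

Section CanonicalNat.
Variable R : realType.
Local Notation Lam := (Gr R).
Local Notation pN x := (sphere_class (inl x : Lam + Lam)).
Local Notation pS u := (sphere_class (inr u : Lam + Lam)).

Lemma canonical_coordP n (zs : n.-1.-tuple Lam) (k : 'I_n.+1) p a :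
  coord (canonical (sk_std zs)) k p a <->
  p = if (0 < k)%N then pN (sshift (- nth 0 zs k.-1) a) else pS (flip a).
Proof.
case: (unliftP ord0 k) => [j|] ->; last exact: coord0P.
exact: coordSP.
Qed.

Lemma canonical_punctE n (zs : n.-1.-tuple Lam) (k : 'I_n.+1) :
  punct (canonical (sk_std zs)) k = if (0 < k)%N then pN (nth 0 zs k.-1) else pS 0.
Proof.
case: (unliftP ord0 k) => [j|] ->; last exact: canonical_punct0.
exact: canonical_punctS.
Qed.

End CanonicalNat.

(** * Sewing *)

Section Sewing.
Variables (R : realType) (m n i : nat) (T1 : tubed R m) (T2 : tubed R n).
Local Notation C := (cplx R).
Local Notation Lam := (Gr R).
Local Notation pN x := (sphere_class (inl x : Lam + Lam)).
Local Notation pS u := (sphere_class (inr u : Lam + Lam)).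
Variables (zs1 : m.-1.-tuple Lam) (zs2 : n.-1.-tuple Lam).
Local Notation can1 := (canonical (sk_std zs1)).
Local Notation can2 := (canonical (sk_std zs2)).
Variables (f1 : pt (surf T1) -> pt (surf can1)) (f2 : pt (surf T2) -> pt (surf can2)).
Variables (r1 r2 : R).
Hypotheses (hT1 : sphere_with_tubes T1) (hT2 : sphere_with_tubes T2).
Hypotheses (iF1 : superconformal_iso f1) (iF2 : superconformal_iso f2).
Hypothesis germ1 : forall k, f1 (punct T1 k) = punct can1 k /\
  exists2 e : C, 0 < e & forall p a,
    coord T1 k p a -> `|body a| < e -> coord can1 k (f1 p) a.
Hypothesis germ2 : forall k, f2 (punct T2 k) = punct can2 k /\
  exists2 e : C, 0 < e & forall p a,
    coord T2 k p a -> `|body a| < e -> coord can2 k (f2 p) a.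
Hypotheses (i_range : (0 < i <= m)%N) (r20 : 0 < r2) (r21 : r2 < r1).
Hypotheses (tc1 : tube_contains T1 (inord i) (toC r1))
  (tc2 : tube_contains T2 ord0 (toC r2)^-1).

Local Notation zeta := (nth 0 zs1 i.-1).
Local Notation S1 := (surf T1).
Local Notation S2 := (surf T2).
Local Notation U1 := (@sew_part1 R m i T1 (toC r2)).
Local Notation U2 := (@sew_part2 R n T2 (toC r1)).
Local Notation rr := (@sew_rel R m n i T1 T2 (toC r1) (toC r2)).
Local Notation cls := (glue_class U1 U2 rr).
Local Notation sewn := (sew i T1 T2 (toC r1) (toC r2)).
Local Notation SS := (super_sphere R).
Implicit Types (p : pt S1) (q : pt S2) (a x u : Lam) (X : set (pt S1 + pt S2)).

Lemma sew_r10 : 0 < r1. Proof. exact: lt_trans r20 r21. Qed.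

Lemma inord_i : nat_of_ord (inord i : 'I_m.+1) = i.
Proof. by rewrite inordK // ltnS; case/andP: i_range. Qed.

Lemma tube1_at a : nC (body a) <= r1 ->
  exists2 p, coord T1 (inord i) p a & carrier S1 p.
Proof.
rewrite -normC_le => /(proj1 tc1)[p h]; exists p => //.
by have [_ car _] := tubes_coord (inord i) hT1; exact: car h.
Qed.

Lemma tube2_at b : nC (body b) <= r2^-1 ->
  exists2 q, coord T2 ord0 q b & carrier S2 q.
Proof.
rewrite -normC_le toCV => /(proj1 tc2)[q h]; exists q => //.
by have [_ car _] := tubes_coord ord0 hT2; exact: car h.
Qed.

Lemma tube1_map p a : coord T1 (inord i) p a -> nC (body a) <= r1 ->
  f1 p = pN (sshift (- zeta) a).
Proof.
move=> h ha.
have : coord can1 (inord i) (f1 p) a.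
  apply: (coord_continuation hT1 iF1 (proj2 (germ1 _)) sew_r10 _ h ha).
  by move=> x /tube1_at[p' h' _]; exists p'.
by move/canonical_coordP; rewrite inord_i; case/andP: i_range => ->.
Qed.

Lemma tube2_map q b : coord T2 ord0 q b -> nC (body b) <= r2^-1 -> f2 q = pS (flip b).
Proof.
move=> h ha.
have r2V : 0 < r2^-1 by rewrite invr_gt0.
have : coord can2 ord0 (f2 q) b.
  apply: (coord_continuation hT2 iF2 (proj2 (germ2 _)) r2V _ h ha).
  by move=> x /tube2_at[p' h' _]; exists p'.
by move/canonical_coordP.
Qed.

Lemma f1_inj p p' : carrier S1 p -> carrier S1 p' -> f1 p = f1 p' -> p = p'.
Proof. by move=> h h'; case: iF1 => -[_ fi _] _; apply: fi; rewrite inE. Qed.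
Lemma f2_inj (p p' : pt S2) : carrier S2 p -> carrier S2 p' -> f2 p = f2 p' -> p = p'.
Proof. by move=> h h'; case: iF2 => -[_ fi _] _; apply: fi; rewrite inE. Qed.

Lemma body_unshift x : body (sshift (- zeta) x) = body x + body zeta.
Proof. by rewrite body_sshift bodyN opprK. Qed.

(** The piece kept of T1 is the standard sphere minus the closed disc of radius r2 around zeta.
    Points at infinity are kept: they have no Delta-coordinate and satisfy the condition
    vacuously. *)
Lemma part1P p : carrier S1 p ->
  (U1 p <-> forall x, f1 p = pN x -> r2 < nC (body x - body zeta)).
Proof.
move=> cp; split=> [[_ h] x fx|h].
  rewrite ltNge; apply/negP => hx; apply: h.
  have hx' : nC (body (sshift zeta x)) <= r2 by rewrite body_sshift.
  have [p' h' cp'] := tube1_at (le_trans hx' (ltW r21)).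
  exists (sshift zeta x); last by rewrite normC_le.
  have -> // : p = p'.
  apply: f1_inj => //; rewrite fx (tube1_map h') ?sshiftK //.
  exact: le_trans hx' (ltW r21).
split=> // -[a ha]; rewrite normC_le => la.
have := h _ (tube1_map ha (le_trans la (ltW r21))).
by rewrite body_unshift addrK ltNge la.
Qed.

(** Removing the closed disc of radius 1 / r1 around infinity leaves the open disc of radius r1
    around 0, which lies entirely in the chart Delta. *)
Lemma part2P q : carrier S2 q ->
  (U2 q <-> exists2 x, f2 q = pN x & nC (body x) < r1).
Proof.
have r12 : r1^-1 <= r2^-1 by rewrite lef_pV2 ?posrE ?sew_r10 // ltW.
move=> cq; split=> [[_ h]|[x fx hx]].
  have far u : f2 q = pS u -> r1^-1 < nC (body u).
    move=> fu; rewrite ltNge; apply/negP => hu; apply: h.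
    have hu' : nC (body (flip u)) <= r1^-1 by rewrite body_flip.
    have [q' h' cq'] := tube2_at (le_trans hu' r12).
    exists (flip u); last by rewrite -toCV normC_le.
    have -> // : q = q'.
    apply: f2_inj => //; rewrite fu (tube2_map h') ?flipK //.
    exact: le_trans hu' r12.
  have [fS _ _] := (proj1 iF2).
  have := sphere_carrier (fS _ cq) => -[[x fx]|[u u0 fu]]; last first.
    by have := far u fu; rewrite u0 nC0 ltNge invr_ge0 ltW ?sew_r10.
  exists x => //; have [x0|x0] := eqVneq (body x) 0; first by rewrite x0 nC0 sew_r10.
  have E : pN x = pS (rsinv x) by apply/pN_pS'.
  have := far (rsinv x); rewrite -E => /(_ fx).
  by rewrite body_rsinv // nCV ltf_pV2 ?posrE ?sew_r10 ?nC_gt0.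
split=> // -[b hb]; rewrite -toCV normC_le => lb.
have := tube2_map hb (le_trans lb r12); rewrite fx => /pN_pS[].
rewrite body_flip => b0 xE; move: hx; rewrite xE body_sinv body_flip // nCV.
rewrite ltNge; apply/negP; rewrite negbK.
by rewrite -[r1]invrK lef_pV2 ?posrE ?invr_gt0 ?sew_r10 ?nC_gt0.
Qed.

Lemma sew_rel_inj p p' q : rr p q -> rr p' q -> p = p'.
Proof.
move=> [a [ha la _ xa]] [b [hb lb _ xb]].
have [[_ i1] _ _] := tubes_coord (inord i) hT1; apply: (i1 _ _ a ha).
have [[j2 _] _ _] := tubes_coord ord0 hT2.
have E := j2 _ _ _ xa xb.
have nz (c : Lam) : toC r2 < `|body c| -> body c != 0.
  by rewrite normCE toC_lt -nC_gt0 => h; apply: lt_trans r20 h.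
by have -> : a = b := sinv_inj (nz _ la) (nz _ lb) E.
Qed.

Lemma sew_rel_fun p q q' : rr p q -> rr p q' -> q = q'.
Proof.
move=> [a [ha la _ xa]] [b [hb lb _ xb]].
have [[j1 _] _ _] := tubes_coord (inord i) hT1.
have [[_ i2] _ _] := tubes_coord ord0 hT2; apply: (i2 _ _ _ xa).
by rewrite (j1 _ _ _ ha hb).
Qed.

(** The converse of [glued_map]: points of the two pieces with the same image are identified.
    Membership of p in its piece gives |x| > r2 and x lies within r1, so that x is in the annulus;
    injectivity of f1 and f2 does the rest. *)
Lemma gluedP p q x : U1 p -> carrier S2 q -> f2 q = pN x -> nC (body x) < r1 ->
  f1 p = pN (sshift (- zeta) x) -> rr p q.
Proof.
move=> u1 cq fq xr fp; have cp : carrier S1 p by case: u1.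
have xl : r2 < nC (body x).
  by have := (part1P cp).1 u1 _ fp; rewrite body_unshift addrK.
have x0 : body x != 0 by rewrite -nC_gt0; exact: lt_trans r20 xl.
exists x; rewrite normCE !toC_lt; split=> //.
  have [p' h' cp'] := tube1_at (ltW xr).
  by have -> : p = p'; [apply: f1_inj => //; rewrite fp (tube1_map h' (ltW xr)) | ].
have xV : nC (body (sinv x)) <= r2^-1.
  rewrite body_sinv // nCV lef_pV2 ?posrE ?nC_gt0 //; exact: ltW.
have [q' h' cq'] := tube2_at xV.
have -> // : q = q'.
apply: f2_inj => //; rewrite fq (tube2_map h' xV) flip_sinv.
by apply/pN_pS'.
Qed.

(** If p has coordinate a, then q has coordinate I (a) at infinity, so its Upsilon-coordinate is
    [flip (sinv a)], the inverse of I at a. Hence q has Delta-coordinate a: the flip in the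
    coordinate at infinity exactly undoes I. *)
Lemma glued_map p q : rr p q -> exists x,
  [/\ f2 q = pN x, nC (body x) < r1 & f1 p = pN (sshift (- zeta) x)].
Proof.
move=> [a]; rewrite normCE !toC_lt => -[ha al ar xa]; exists a.
have a0 : body a != 0 by rewrite -nC_gt0; exact: lt_trans r20 al.
split=> //; last exact: tube1_map ha (ltW ar).
rewrite (tube2_map xa) ?flip_sinv; first by apply/esym/pN_pS'.
rewrite body_sinv // nCV lef_pV2 ?posrE ?nC_gt0 //; exact: ltW.
Qed.

Definition sew_map_spec X (P : set (Lam + Lam)) : Prop :=
  (exists p, [/\ U1 p, X = cls (inl p) & P = f1 p]) \/
  (exists q x, [/\ U2 q, X = cls (inr q), f2 q = pN x & P = pN (sshift (- zeta) x)]).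

(* The chart Delta suffices to shift by zeta: f2 maps the retained part of T2 into
   a disc around 0. *)
Definition sew_map X : set (Lam + Lam) := xget (pN 0) [set P | sew_map_spec X P].

Lemma sew_cls_eq (s t : pt S1 + pt S2) : glue_in U1 U2 s ->
  cls s = cls t <-> glue_rel rr s t.
Proof. exact: (@cls_eq _ _ U1 U2 _ sew_rel_inj sew_rel_fun s t). Qed.

Lemma sew_map_fun X P P' : sew_map_spec X P -> sew_map_spec X P' -> P = P'.
Proof.
move=> [[p [u1 XE ->]]|[q [x [u2 XE fx ->]]]] [[p' [u1' XE' ->]]|[q' [x' [u2' XE' fx' ->]]]].
- have /(@sew_cls_eq (inl p) (inl p') u1) /= -> // : cls (inl p) = cls (inl p').
  by rewrite -XE -XE'.
- have /(@sew_cls_eq (inl p) (inr q') u1) /= : cls (inl p) = cls (inr q').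
    by rewrite -XE -XE'.
  by move=> /glued_map[y []]; rewrite fx' => /pN_inj ->.
- have /(@sew_cls_eq (inr q) (inl p') u2) /= : cls (inr q) = cls (inl p').
    by rewrite -XE -XE'.
  by move=> /glued_map[y []]; rewrite fx => /pN_inj ->.
- have /(@sew_cls_eq (inr q) (inr q') u2) /= E : cls (inr q) = cls (inr q').
    by rewrite -XE -XE'.
  by move: fx'; rewrite -E fx => /pN_inj ->.
Qed.

Lemma sew_mapE X P : sew_map_spec X P -> sew_map X = P.
Proof.
move=> h; apply: (sew_map_fun _ h).
exact: (@xgetPex _ (pN 0) [set P | sew_map_spec X P] (ex_intro _ P h)).
Qed.

Lemma sew_map1 p : U1 p -> sew_map (cls (inl p)) = f1 p.
Proof. by move=> u; apply: sew_mapE; left; exists p. Qed.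

Lemma sew_map2 q x : U2 q -> f2 q = pN x -> sew_map (cls (inr q)) = pN (sshift (- zeta) x).
Proof. by move=> u fx; apply: sew_mapE; right; exists q, x. Qed.

Lemma sew_carrierP X : carrier (sew_surface i T1 T2 (toC r1) (toC r2)) X <->
  (exists2 p, U1 p & X = cls (inl p)) \/ (exists2 q, U2 q & X = cls (inr q)).
Proof.
split=> [[[p|q] u <-]|[[p u ->]|[q u ->]]].
- by left; exists p.
- by right; exists q.
- by exists (inl p).
- by exists (inr q).
Qed.

Lemma part2_at q : U2 q -> exists2 x, f2 q = pN x & nC (body x) < r1.
Proof. by move=> u; apply/part2P => //; case: u. Qed.

Lemma sew_map_bij : set_bij (carrier (sew_surface i T1 T2 (toC r1) (toC r2))) (carrier SS) sew_map.
Proof.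
have [[fS1 _ fsurj1] _] := iF1; have [[fS2 _ fsurj2] _] := iF2.
have car1 p : U1 p -> carrier S1 p by case.
have car2 q : U2 q -> carrier S2 q by case.
split.
- move=> X /sew_carrierP[[p u ->]|[q u ->]].
    by rewrite sew_map1 //; apply: fS1; exact: car1.
  by have [x fx _] := part2_at u; rewrite (sew_map2 u fx); exact: carrier_pN.
- move=> X Y; rewrite !inE => /sew_carrierP[[p u ->]|[q u ->]] /sew_carrierP[[p' u' ->]|[q' u' ->]].
  + by rewrite !sew_map1 // => /f1_inj -> //; exact: car1.
  + have [x fx xr] := part2_at u'; rewrite sew_map1 // (sew_map2 u' fx) => E.
    by apply/(@sew_cls_eq (inl p) (inr q') u); apply: gluedP fx xr E => //; exact: car2.
  + have [x fx xr] := part2_at u; rewrite sew_map1 // (sew_map2 u fx) => E.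
    apply/esym/(@sew_cls_eq (inl p') (inr q) u'); apply: gluedP fx xr (esym E) => //.
    exact: car2.
  + have [x fx xr] := part2_at u; have [x' fx' xr'] := part2_at u'.
    rewrite (sew_map2 u fx) (sew_map2 u' fx') => /pN_inj/sshift_inj E; suff -> : q = q' by [].
    by apply: f2_inj; [exact: car2|exact: car2|rewrite fx fx' E].
- move=> P cP.
  (* Points within r2 of zeta come from the second piece, which reaches up to r1; all others,
     infinity included, come from the first. *)
  have [[x [PE xr]]|nP] := pselect (exists x, P = pN x /\ nC (body x - body zeta) <= r2).
    have [q cq fq] := fsurj2 (pN (sshift zeta x)) (carrier_pN _).
    have u : U2 q.
      by apply/part2P => //; exists (sshift zeta x) => //; rewrite body_sshift; exact: le_lt_trans xr r21.
    exists (cls (inr q)); first by apply/sew_carrierP; right; exists q.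
    by rewrite (sew_map2 u fq) sshiftK.
  have [p cp fp] := fsurj1 P cP.
  have u : U1 p.
    apply/part1P => // x; rewrite fp => PE; rewrite ltNge; apply/negP => h.
    by apply: nP; exists x.
  exists (cls (inl p)); first by apply/sew_carrierP; left; exists p.
  by rewrite sew_map1.
Qed.

Local Notation chart1 := (@glue_chart1 R _ _ U1 U2 rr).
Local Notation chart2 := (@glue_chart2 R _ _ U1 U2 rr).
Local Notation Ssew := (sew_surface i T1 T2 (toC r1) (toC r2)).

Lemma chart1P (c : pchart R (pt S1)) X a :
  chart1 c X a <-> exists p, [/\ U1 p, c p a & X = cls (inl p)].
Proof. exact: (@glue_chart1P R _ _ U1 U2 _ sew_rel_inj sew_rel_fun). Qed.
Lemma chart2P (c : pchart R (pt S2)) X a :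
  chart2 c X a <-> exists q, [/\ U2 q, c q a & X = cls (inr q)].
Proof. exact: (@glue_chart2P R _ _ U1 U2 _ sew_rel_inj sew_rel_fun). Qed.

Lemma cls1_inj p p' : U1 p -> cls (inl p) = cls (inl p') -> p = p'.
Proof. by move=> u /(@sew_cls_eq (inl p) (inl p') u). Qed.
Lemma cls2_inj (q q' : pt S2) : U2 q -> cls (inr q) = cls (inr q') -> q = q'.
Proof. by move=> u /(@sew_cls_eq (inr q) (inr q') u). Qed.

Lemma pinj_chart1 c : pinj c -> pinj (chart1 c).
Proof.
move=> [fc ic]; split=> [X a b /chart1P[p [u h ->]] /chart1P[p' [u' h' /(cls1_inj u) E]]|].
  by rewrite -E in h'; exact: fc h h'.
by move=> X Y a /chart1P[p [u h ->]] /chart1P[p' [u' h' ->]]; rewrite (ic _ _ _ h h').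
Qed.
Lemma pinj_chart2 c : pinj c -> pinj (chart2 c).
Proof.
move=> [fc ic]; split=> [X a b /chart2P[p [u h ->]] /chart2P[p' [u' h' /(cls2_inj u) E]]|].
  by rewrite -E in h'; exact: fc h h'.
by move=> X Y a /chart2P[p [u h ->]] /chart2P[p' [u' h' ->]]; rewrite (ic _ _ _ h h').
Qed.

Lemma wsurf_S1 : wsurf S1.
Proof. by have [[/super_riemann_wsurf]] := hT1. Qed.
Lemma wsurf_S2 : wsurf S2.
Proof. by have [[/super_riemann_wsurf]] := hT2. Qed.

Lemma wsurf_sew : wsurf Ssew.
Proof.
have [i1 car1 cov1] := wsurf_S1; have [i2 car2 cov2] := wsurf_S2.
split.
- by move=> _ [[c Ac <-]|[c Ac <-]]; [exact/pinj_chart1/i1|exact/pinj_chart2/i2].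
- by move=> _ X a [[c Ac <-]|[c Ac <-]] [].
- move=> X /sew_carrierP[[p u ->]|[q u ->]].
    have [c [a [Ac h]]] := cov1 p (proj1 u); exists (chart1 c), a.
    by split; [left; exists c | apply/chart1P; exists p].
  have [c [a [Ac h]]] := cov2 q (proj1 u); exists (chart2 c), a.
  by split; [right; exists c | apply/chart2P; exists q].
Qed.

Lemma open_far (b0 : C) (e : R) : open [set b : C | e < nC (b - b0)].
Proof.
apply/openCP => b /= h; exists (nC (b - b0) - e); first by rewrite subr_gt0.
move=> z hz; have := nC_lowerB (b - b0) (b - z).
have -> : b - b0 - (b - z) = z - b0 by rewrite opprB addrC addrA subrK.
by rewrite (nC_dist b z); lra.
Qed.

Lemma open_near (b0 : C) (e : R) : open [set b : C | nC (b - b0) < e].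
Proof.
apply/openCP => b /= h; exists (e - nC (b - b0)); first by rewrite subr_gt0.
by move=> z hz; rewrite -[z - b0](subrKA b); apply: le_lt_trans (nCD _ _) _; lra.
Qed.

(** The condition |1 / b - b0| > e multiplied by |b|, so that it makes sense and holds at b = 0,
    that is, at infinity. *)
Lemma open_far_inf (b0 : C) (e : R) : 0 < e -> open [set b : C | e * nC b < nC (1 - b0 * b)].
Proof.
move=> e0; apply/openCP => b /= h; have n0 := nC_ge0 b0.
have d0 : 0 < nC b0 + e + 1 by lra.
exists ((nC (1 - b0 * b) - e * nC b) / (nC b0 + e + 1)).
  by rewrite divr_gt0 // subr_gt0.
move=> z; rewrite ltr_pdivlMr // => hz.
have h1 : nC z <= nC b + nC (z - b) by rewrite -{1}[z](subrKC b); exact: nCD.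
have h2 : nC (1 - b0 * b) - nC b0 * nC (z - b) <= nC (1 - b0 * z).
  rewrite -nCM; apply: le_trans (nC_lowerB _ _) _.
  rewrite -[X in X <= _]nCN.
  have -> : - (1 - b0 * b - b0 * (z - b)) = - (1 - b0 * z) by ring.
  by rewrite nCN.
have n1 := nC_ge0 (z - b); nra.
Qed.

(** In either chart the first piece is given by an open condition on bodies, so that its transition
    functions are restrictions of those of f1. *)
Lemma part1_chart c' : atlas SS c' -> exists2 W : set C, open W &
  forall p a, carrier S1 p -> c' (f1 p) a -> U1 p <-> W (body a).
Proof.
case=> ->; [exists [set b : C | r2 < nC (b - body zeta)]; first exact: open_far
  | exists [set b : C | r2 * nC b < nC (1 - body zeta * b)]; first exact: open_far_inf];
  move=> p a cp.
  by move=> /DeltaE E; rewrite part1P // E; split=> [/(_ a)|h x /pN_inj <-] //; exact.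
move=> /UpsilonE E; rewrite part1P // E.
have far : body a != 0 -> (r2 < nC (body (sinv a) - body zeta)) =
    (r2 * nC (body a) < nC (1 - body zeta * body a)).
  move=> a0; rewrite body_sinv //.
  have -> : (body a)^-1 - body zeta = (1 - body zeta * body a) / body a.
    by rewrite mulrBl mul1r mulfK.
  by rewrite nCM nCV ltr_pdivlMr // nC_gt0.
split=> [h|h x /esym/pN_pS[a0 ->]]; last by rewrite far.
have [a0|a0] := eqVneq (body a) 0.
  by rewrite /= a0 nC0 !mulr0 subr0 nC1 ltr01.
by rewrite /= -far //; apply: h; apply/esym/pN_pS.
Qed.

Lemma sew_iso1 c c' : atlas S1 c -> atlas SS c' ->
  srel (crel (chart1 c) (fun X => c' (sew_map X))) /\
  srel (crel (fun X => c' (sew_map X)) (chart1 c)).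
Proof.
move=> Ac Ac'; have [W oW WE] := part1_chart Ac'.
have [s1 s2] := iso_srel wsurf_S1 (wsurf_sphere R) iF1 Ac Ac'.
have [_ car1 _] := wsurf_S1.
split; [apply: srel_eq (srel_restr_r oW s1) => a a' | apply: srel_eq (srel_restr_l oW s2) => a a'].
  split=> [[[p [h1 h2]] /(WE p _ (car1 _ _ _ Ac h1) h2) u]|[X [/chart1P[p [u h1 ->]]]]].
    by exists (cls (inl p)); rewrite sew_map1 //; split=> //; apply/chart1P; exists p.
  by rewrite sew_map1 // => h2; split; [exists p | apply/(WE p _ (proj1 u))].
split=> [[[p [h1 h2]] /(WE p _ (car1 _ _ _ Ac h2) h1) u]|[X [/[swap] /chart1P[p [u h1 ->]]]]].
  by exists (cls (inl p)); rewrite sew_map1 //; split=> //; apply/chart1P; exists p.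
by rewrite sew_map1 // => h2; split; [exists p | apply/(WE p _ (proj1 u))].
Qed.

(** On the second piece the map is f2 followed by the inverse shift in the chart Delta, restricted
    to the disc of radius r1 around zeta. *)
Lemma sew_iso2_Delta c : atlas S2 c ->
  srel (crel (chart2 c) (fun X => Delta (sew_map X))) /\
  srel (crel (fun X => Delta (sew_map X)) (chart2 c)).
Proof.
move=> Ac; have AD : atlas SS (@Delta R) by left.
have [s1 s2] := iso_srel wsurf_S2 (wsurf_sphere R) iF2 Ac AD.
have [i2 car2 _] := wsurf_S2; have [iS _ _] := wsurf_sphere R.
pose e := crestr (carrier S2) (fun q => Delta (f2 q)).
have ie : pinj e.
  by have [[_ fi _] _] := iF2; exact: pinj_pullback fi (iS _ AD).
have ic := i2 c Ac.
have t1 : srel (crel c (twist (sshift (- zeta)) e)).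
  apply: (srel_twist_r (sshiftVK zeta) (sshiftK zeta) (scu_sshift _) ic ie).
  by apply/(crel_crestr _ (fun (p : pt S2) a => @car2 c p a Ac)).
have t2 : srel (crel (twist (sshift (- zeta)) e) c).
  apply: (srel_twist_l (sshiftVK zeta) (sshiftK zeta) (scu_sshift _) ic ie).
  apply: srel_eq s2 => a a'; split=> [[p [h1 h2]]|[p [[_ h1] h2]]]; exists p; split=> //.
  by split=> //; exact: car2 h2.
have oW := @open_near (body zeta) r1.
have toW q x a : f2 q = pN x -> a = sshift (- zeta) x -> nC (body a - body zeta) = nC (body x).
  by move=> _ ->; rewrite body_unshift addrK.
split; [apply: srel_eq (srel_restr_r oW t1) => a a' | apply: srel_eq (srel_restr_l oW t2) => a a'].
  split=> [[[q [h1 [x [cq /DeltaE fx] aE]]] /= ]|[X [/chart2P[q [u h1 ->]]]]].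
    rewrite (toW _ _ _ fx aE) => xr.
    have u : U2 q by apply/part2P => //; exists x.
    exists (cls (inr q)); split; first by apply/chart2P; exists q.
    by rewrite (sew_map2 u fx) aE; apply/DeltaE.
  have [x fx xr] := part2_at u; rewrite (sew_map2 u fx) => /DeltaE/pN_inj aE.
  split; last by rewrite /= (toW _ _ _ fx (esym aE)).
  exists q; split=> //; exists x => //.
  by split; [case: u | apply/DeltaE].
split=> [[[q [[x [cq /DeltaE fx] aE] h1]] /= ]|[X [/[swap] /chart2P[q [u h1 ->]]]]].
  rewrite (toW _ _ _ fx aE) => xr.
  have u : U2 q by apply/part2P => //; exists x.
  exists (cls (inr q)); split; last by apply/chart2P; exists q.
  by rewrite (sew_map2 u fx) aE; apply/DeltaE.
have [x fx xr] := part2_at u; rewrite (sew_map2 u fx) => /DeltaE/pN_inj aE.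
split; last by rewrite /= (toW _ _ _ fx (esym aE)).
exists q; split=> //; exists x => //.
by split; [case: u | apply/DeltaE].
Qed.

(** The second piece has its image in the domain of Delta, so Upsilon is reached through the
    transition between the two charts. *)
Lemma sew_iso2 c c' : atlas S2 c -> atlas SS c' ->
  srel (crel (chart2 c) (fun X => c' (sew_map X))) /\
  srel (crel (fun X => c' (sew_map X)) (chart2 c)).
Proof.
move=> Ac [->|->]; first exact: sew_iso2_Delta.
have [s1 s2] := sew_iso2_Delta Ac.
have [i2 car2 _] := wsurf_S2; have [iS _ _] := wsurf_sphere R.
have ic := pinj_chart2 (i2 c Ac).
pose e := crestr (carrier Ssew) (fun X => Upsilon (sew_map X)).
have ie : pinj e.
  by have [_ fi _] := sew_map_bij; apply: pinj_pullback fi (iS _ _); right.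
have inN X a : chart2 c X a -> exists x, sew_map X = pN x.
  move=> /chart2P[q [u _ ->]]; have [x fx _] := part2_at u.
  by exists (sshift (- zeta) x); rewrite (sew_map2 u fx).
split.
  apply: (@srel_comp R unit (fun=> crel (chart2 c) (fun X => Delta (sew_map X))) (fun=> crel (@Delta R) (@Upsilon R))).
  - by [].
  - by move=> _; exact: srel_DU.
  - move=> a a''; split=> [[X [h1 h2]]|[_ [x [[X [h1 /DeltaE h2]] [P [/DeltaE h3 h4]]]]]].
      have [x E] := inN _ _ h1; exists tt, x; split.
        by exists X; split=> //; apply/DeltaE.
      by exists (sew_map X); split=> //; apply/DeltaE.
    by exists X; split=> //; rewrite h2 -h3.
  - move=> a b b' [X [h1 h2]] [Y [h3 h4]].
    by apply: (crel_fun ic ie (a := a)); [exists X | exists Y]; split=> //; split=> //; [case: h1 | case: h3].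
apply: (@srel_comp R unit (fun=> crel (@Upsilon R) (@Delta R)) (fun=> crel (fun X => Delta (sew_map X)) (chart2 c))).
- by move=> _; exact: srel_UD.
- by [].
- move=> a a''; split=> [[X [h1 h2]]|[_ [x [[P [h3 /DeltaE h4]] [X [/DeltaE h2 h1]]]]]].
    have [x E] := inN _ _ h2; exists tt, x; split.
      by exists (sew_map X); split=> //; apply/DeltaE.
    by exists X; split=> //; apply/DeltaE.
  by exists X; split=> //; rewrite h2 -h4.
- move=> a b b' [X [h1 h2]] [Y [h3 h4]].
  by apply: (crel_fun ie ic (a := a)); [exists X | exists Y]; split=> //; split=> //; [case: h2 | case: h4].
Qed.

Lemma sew_map_iso : @superconformal_iso R Ssew SS sew_map.
Proof.
split; first exact: sew_map_bij.
by move=> _ c' [[c Ac <-]|[c Ac <-]] Ac'; [have [s1 s2] := sew_iso1 Ac Ac' | have [s1 s2] := sew_iso2 Ac Ac'];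
  split; apply: srel_compat.
Qed.

Lemma part1_punct l : l != inord i -> U1 (punct T1 l).
Proof.
move=> li; split; first by have [_ h _ _ _] := hT1.
move=> [a h]; rewrite normC_le => ha; move/eqP: li; apply.
by apply: (proj2 tc1 _ _ h); rewrite normC_le; exact: le_trans ha (ltW r21).
Qed.

Lemma part2_punct l : l != ord0 -> U2 (punct T2 l).
Proof.
move=> li; split; first by have [_ h _ _ _] := hT2.
move=> [a h]; rewrite -toCV normC_le => ha; move/eqP: li; apply.
apply: (proj2 tc2 _ _ h); rewrite -toCV normC_le; apply: le_trans ha _.
by rewrite lef_pV2 ?posrE ?sew_r10 // ltW.
Qed.

(** The composition law of shifts, inverted: it carries the coordinate at a puncture of T2 to the
    standard coordinate at the shifted puncture. *)
Lemma unshift_comp z w a : w = sshift z a -> forall y,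
  sshift (- z) (sshift (- w) y) = sshift (- a) y.
Proof.
move=> wE y; apply: (@sshift_inj _ a); apply: etrans (esym (sshift_comp z a _)) _.
apply: etrans (congr2 (@sshift R) (esym wE) (sshiftVK z _)) _.
exact: etrans (sshiftVK w y) (esym (sshiftVK a y)).
Qed.

Variable zs3 : ((m + n).-1).-1.-tuple Lam.
Local Notation can3 := (canonical (sk_std zs3)).
Implicit Type k : 'I_((m + n).-1).+1.

Lemma sew_tube1 (l : 'I_m.+1) k : l != inord i -> (0 < l)%N = (0 < k)%N ->
  ((0 < k)%N -> nth 0 zs1 l.-1 = nth 0 zs3 k.-1) ->
  sew_map (cls (inl (punct T1 l))) = punct can3 k /\
  exists2 e : C, 0 < e & forall X a, chart1 (coord T1 l) X a -> `|body a| < e ->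
    coord can3 k (sew_map X) a.
Proof.
move=> li lk zE; have [fp [e e0 he]] := germ1 l; split.
  rewrite sew_map1; last exact: part1_punct.
  by rewrite fp !canonical_punctE lk; case: ifP => // /zE ->.
exists e => // X a /chart1P[p [u h ->]] /(he _ _ h) /canonical_coordP E.
apply/canonical_coordP; apply: etrans (sew_map1 u) _; apply: etrans E _.
rewrite lk; case k0 : (0 < k)%N; last by [].
exact: (congr1 (fun z => pN (sshift (- z) a)) (zE k0)).
Qed.

Lemma sew_tube2 (l : 'I_n.+1) k : (0 < l)%N -> (0 < k)%N ->
  nth 0 zs2 l.-1 = sshift zeta (nth 0 zs3 k.-1) ->
  sew_map (cls (inr (punct T2 l))) = punct can3 k /\
  exists2 e : C, 0 < e & forall X a, chart2 (coord T2 l) X a -> `|body a| < e ->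
    coord can3 k (sew_map X) a.
Proof.
move=> l0 k0 zE; have [fp [e e0 he]] := germ2 l; split.
  have u : U2 (punct T2 l) by apply: part2_punct; rewrite -lt0n.
  rewrite canonical_punctE l0 zE in fp.
  by rewrite (sew_map2 u fp) sshiftK canonical_punctE k0.
exists e => // X a /chart2P[q [u h ->]] /(he _ _ h) /canonical_coordP.
rewrite l0 => E; apply/canonical_coordP; rewrite (sew_map2 u E) k0.
exact: (congr1 (fun x => pN x) (unshift_comp zE a)).
Qed.

(** Puncture k sits at entry [k.-1], and an index past the end gives 0, the last puncture. Thus
    puncture [(k - i).+1] of T2 is entry [k - i], and puncture [(k - n).+1] of T1 is entry [k - n];
    the equations include the last punctures. *)
Lemma sew_equiv :
  (forall k, (0 < k)%N -> (k < i)%N -> nth 0 zs1 k.-1 = nth 0 zs3 k.-1) ->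
  (forall k, (i <= k)%N -> (k < i + n)%N ->
     nth 0 zs2 (k - i) = sshift zeta (nth 0 zs3 k.-1)) ->
  (forall k, (i + n <= k)%N -> nth 0 zs1 (k - n) = nth 0 zs3 k.-1) ->
  tubed_equiv sewn can3.
Proof.
move=> z1 z2 z3; have /andP[i0 im] := i_range.
exists sew_map; split; first exact: sew_map_iso.
move=> k; have km : (k <= (m + n).-1)%N by rewrite -ltnS.
rewrite /sew /=; case: ifP => ki.
  have lE : nat_of_ord (inord k : 'I_m.+1) = k by rewrite inordK // ltnS; lia.
  apply: sew_tube1; rewrite ?lE //.
    by apply/eqP => /(congr1 (@nat_of_ord _)); rewrite lE inord_i; lia.
  by move=> k0; exact: z1.
case: ifP => kin.
  have lE : nat_of_ord (inord (k - i).+1 : 'I_n.+1) = (k - i).+1 by rewrite inordK //; lia.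
  by apply: sew_tube2; rewrite ?lE //; [lia | apply: z2 => //; lia].
have lE : nat_of_ord (inord (k - n).+1 : 'I_m.+1) = (k - n).+1 by rewrite inordK //; lia.
apply: sew_tube1; rewrite ?lE //; last by move=> _; apply: z3; lia.
  by apply/eqP => /(congr1 (@nat_of_ord _)); rewrite lE inord_i; lia.
by rewrite /=; lia.
Qed.

End Sewing.

Lemma between (R : realType) (a b : R) : a < b -> exists c d, [/\ a < c, c < d & d < b].
Proof. by move=> ab; exists ((a * 2%:R + b) / 3%:R), ((a + b * 2%:R) / 3%:R); split; lra. Qed.

(** * Sewing standard spheres and the resulting classes *)

Section SewStandard.
Variable R : realType.
Local Notation C := (cplx R).
Local Notation Lam := (Gr R).
Local Notation pN x := (sphere_class (inl x : Lam + Lam)).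
Local Notation pS u := (sphere_class (inr u : Lam + Lam)).

Lemma superconformal_iso_id : @superconformal_iso R (super_sphere R) (super_sphere R) id.
Proof.
split; first by split=> // P cP; exists P.
by move=> c c' Ac Ac'; have [_ _ cc] := super_riemann_sphere R; split; exact: cc.
Qed.

Lemma canonical_self n (zs : n.-1.-tuple Lam) k :
  id (punct (canonical (sk_std zs)) k) = punct (canonical (sk_std zs)) k /\
  exists2 e : C, 0 < e & forall p a, coord (canonical (sk_std zs)) k p a ->
    `|body a| < e -> coord (canonical (sk_std zs)) k (id p) a.
Proof. by split=> //; exists 1. Qed.

Variables (m n i : nat) (zs1 : m.-1.-tuple Lam) (zs2 : n.-1.-tuple Lam).
Variable zs3 : ((m + n).-1).-1.-tuple Lam.
Local Notation can1 := (canonical (sk_std zs1)).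
Local Notation can2 := (canonical (sk_std zs2)).
Local Notation can3 := (canonical (sk_std zs3)).
Local Notation zeta := (nth 0 zs1 i.-1).
Implicit Type k : 'I_((m + n).-1).+1.
Hypothesis i_range : (0 < i <= m)%N.
Hypothesis z1 : forall k, (0 < k)%N -> (k < i)%N -> nth 0 zs1 k.-1 = nth 0 zs3 k.-1.
Hypothesis z2 : forall k, (i <= k)%N -> (k < i + n)%N ->
     nth 0 zs2 (k - i) = sshift zeta (nth 0 zs3 k.-1).
Hypothesis z3 : forall k, (i + n <= k)%N -> nth 0 zs1 (k - n) = nth 0 zs3 k.-1.

(** The inclusion for arbitrary representatives, through the isomorphism that [sew_equiv] builds out
    of the given ones. *)
Lemma sew_class_sub (T : tubed R (m + n).-1) :
  sew_class i (sk_class (sk_std zs1)) (sk_class (sk_std zs2)) T -> sk_class (sk_std zs3) T.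
Proof.
move=> [hT [T1 [T2 [r [r1 [r2 [[hT1 [f1 [iF1 g1]]] [hT2 [f2 [iF2 g2]]]]]]]]]].
move=> [[ir /toC_gt0[r2' r20 ->] r2r rr1]] [tc1 tc2] eT; split=> //.
have [r1' r10 r1E] : exists2 x : R, 0 < x & r1 = toC x.
  by apply: toC_gt0; apply: lt_trans (lt_trans r2r rr1); rewrite -toC0 toC_lt.
move: tc1 eT (lt_trans r2r rr1); rewrite r1E toC_lt => tc1 eT r21.
apply: tubed_equiv_trans eT _.
- by have [[/super_riemann_wsurf]] := hT.
- exact: (wsurf_sew i _ hT1 hT2 r20).
- exact: wsurf_sphere.
- exact: (sew_equiv hT1 hT2 iF1 iF2 g1 g2 ir r20 r21 tc1 tc2 z1 z2 z3).
Qed.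

Variables (r1 r2 : R).
Hypotheses (r20 : 0 < r2) (r21 : r2 < r1).
Hypothesis d1 : forall j j' : 'I_m, j != j' -> body (nth 0 zs1 j) != body (nth 0 zs1 j').
Hypothesis d2 : forall j j' : 'I_n, j != j' -> body (nth 0 zs2 j) != body (nth 0 zs2 j').
Hypothesis far1 : forall j : 'I_m, j != i.-1 :> nat -> r1 < nC (body (nth 0 zs1 j) - body zeta).
Hypothesis near2 : forall j : 'I_n, nC (body (nth 0 zs2 j)) < r2.

(** Standard coordinates take all values, so only the position of the other punctures matters;
    [far1] keeps them out of the disc of radius r1 around zeta. *)
Lemma tube_contains1 : tube_contains can1 (inord i) (toC r1).
Proof.
have iE := @inord_i m i i_range; have /andP[i0 im] := i_range.
split=> [a _|l a /canonical_coordP]; first by have [p _ h] := canonical_coord_surj zs1 (inord i) a; exists p.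
rewrite iE i0 canonical_punctE normC_le.
case: (unliftP ord0 l) => [j|] ->; last by move=> /esym/pN_pS[]; rewrite body0 eqxx.
move=> /= /pN_inj zE; have [ji _|ji] := eqVneq (nat_of_ord j) i.-1.
  by apply: val_inj; rewrite /= iE /bump /= ji; lia.
have := far1 ji; rewrite zE body_sshift bodyN opprK addrK => h1 h2.
by have := lt_le_trans h1 h2; rewrite ltxx.
Qed.

Lemma tube_contains2 : tube_contains can2 ord0 (toC r2)^-1.
Proof.
split=> [a _|l a /canonical_coordP]; first by have [p _ h] := canonical_coord_surj zs2 ord0 a; exists p.
rewrite canonical_punctE -toCV normC_le.
case: (unliftP ord0 l) => [j|] -> //= /pN_pS'[z0 E].
have : nC (body (flip a)) = nC (body a) by rewrite body_flip.
rewrite E body_rsinv // nCV => <-; rewrite lef_pV2 ?posrE ?nC_gt0 // => h.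
by have := le_lt_trans h (near2 j); rewrite ltxx.
Qed.

Let hT1 := canonical_tubes d1.
Let hT2 := canonical_tubes d2.
Local Notation sewn := (sew i can1 can2 (toC r1) (toC r2)).
Local Notation U1 := (@sew_part1 R m i can1 (toC r2)).
Local Notation U2 := (@sew_part2 R n can2 (toC r1)).

Lemma canonical_part1P p : carrier (super_sphere R) p ->
  U1 p <-> forall x, p = pN x -> r2 < nC (body x - body zeta).
Proof.
move=> cp.
exact: (part1P hT1 superconformal_iso_id (canonical_self zs1) i_range r20 r21 tube_contains1 cp).
Qed.
Lemma canonical_part2P q : carrier (super_sphere R) q ->
  U2 q <-> exists2 x, q = pN x & nC (body x) < r1.
Proof.
move=> cq.
exact: (part2P hT2 superconformal_iso_id (canonical_self zs2) r20 r21 tube_contains2 cq).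
Qed.

(** Sewing retains a full neighbourhood of each remaining puncture, as is needed to reverse the
    equivalence with the standard sphere. *)
Lemma canonical_ball1 (l : 'I_m.+1) : l != inord i -> exists2 e : R, 0 < e &
  forall p a, coord can1 l p a -> nC (body a) < e -> U1 p.
Proof.
move=> li; have nz := nC_ge0 (body zeta).
case: (unliftP ord0 l) li => [j|] -> li; last first.
  have e0 : 0 < (r2 + nC (body zeta))^-1 by rewrite invr_gt0 ltr_wpDr.
  (* For |a| below this bound, |1 / a - zeta| >= 1 / |a| - |zeta| > r2 on bodies. *)
  exists (r2 + nC (body zeta))^-1 => // p a /coord0P -> ha.
  apply/canonical_part1P; first exact: carrier_pS.
  move=> x /esym/pN_pS[a0 ->]; rewrite body_sinv //.
  apply: lt_le_trans (nC_lowerB _ _); rewrite nCV body_flip ltrBrDr.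
  rewrite body_flip in a0.
  by rewrite -[X in X < _]invrK ltf_pV2 ?posrE ?nC_gt0.
have ji : nat_of_ord j != i.-1.
  apply: contra li => /eqP ji; apply/eqP/val_inj; rewrite /= (@inord_i m i i_range) /bump /= ji.
  by have /andP[] := i_range; lia.
(* The puncture is more than r1 away from zeta, so moving it by less than r1 - r2 leaves it more
   than r2 away. *)
exists (r1 - r2); first by rewrite subr_gt0.
move=> p a /coordSP -> ha; apply/canonical_part1P; first exact: carrier_pN.
move=> x /pN_inj <-; rewrite body_sshift bodyN opprK.
have hf := far1 ji; have := nC_lowerB (body (nth 0 zs1 j) - body zeta) (- body a).
have -> : body (nth 0 zs1 j) - body zeta - - body a = body a + body (nth 0 zs1 j) - body zeta.
  by rewrite opprK addrAC; congr (_ - _); exact: addrC.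
by rewrite nCN; move: hf ha; rewrite /sk_pt /=; lra.
Qed.

Lemma canonical_ball2 (l : 'I_n.+1) : l != ord0 -> exists2 e : R, 0 < e &
  forall p a, coord can2 l p a -> nC (body a) < e -> U2 p.
Proof.
case: (unliftP ord0 l) => [j|] -> // _.
exists (r1 - r2); first by rewrite subr_gt0.
move=> p a /coordSP -> ha; apply/canonical_part2P; first exact: carrier_pN.
exists (sshift (- nth 0 zs2 j) a) => //; rewrite body_sshift bodyN opprK.
by apply: le_lt_trans (nCD _ _) _; have := near2 j; move: ha; lra.
Qed.

Lemma sew_std_punct k : carrier (surf sewn) (punct sewn k).
Proof.
have /andP[i0 im] := i_range; have km : (k <= (m + n).-1)%N by rewrite -ltnS.
have iE := @inord_i m i i_range.
have p1 (l : 'I_m.+1) : l != i :> nat -> U1 (punct can1 l).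
  by move=> li; apply: (part1_punct hT1 r21 tube_contains1); apply: contra li => /eqP ->; rewrite iE.
rewrite /sew /=; case: ifP => ki.
  exists (inl (punct can1 (inord k))) => //; apply: p1.
  by rewrite inordK ?ltnS; lia.
case: ifP => kin.
  exists (inr (punct can2 (inord (k - i).+1))) => //.
  apply: (part2_punct hT2 r20 r21 tube_contains2).
  by apply/eqP => /(congr1 (@nat_of_ord _)); rewrite inordK //; lia.
exists (inl (punct can1 (inord (k - n).+1))) => //; apply: p1.
by rewrite inordK ?ltnS; lia.
Qed.

Lemma sew_std_ball k : exists2 e : R, 0 < e &
  forall a, nC (body a) < e -> exists2 p, carrier (surf sewn) p & coord sewn k p a.
Proof.
have /andP[i0 im] := i_range; have km : (k <= (m + n).-1)%N by rewrite -ltnS.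
have iE := @inord_i m i i_range.
have b1 (l : 'I_m.+1) : l != i :> nat -> exists2 e : R, 0 < e & forall a, nC (body a) < e ->
    exists2 X, carrier (surf sewn) X & glue_chart1 U1 U2 (sew_rel i (toC r1) (toC r2)) (coord can1 l) X a.
  move=> li; have [|e e0 he] := @canonical_ball1 l.
    by apply: contra li => /eqP ->; rewrite iE.
  exists e => // a ha; have [p _ cp] := canonical_coord_surj zs1 l a.
  have u := he p a cp ha; exists (glue_class U1 U2 (sew_rel i (toC r1) (toC r2)) (inl p)).
    by exists (inl p).
  by apply/(chart1P i r1 hT1 hT2 r20); exists p.
rewrite /sew /=; case: ifP => ki; first by apply: b1; rewrite inordK ?ltnS; lia.
case: ifP => kin; last by apply: b1; rewrite inordK ?ltnS; lia.
have [|e e0 he] := @canonical_ball2 (inord (k - i).+1).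
  by apply/eqP => /(congr1 (@nat_of_ord _)); rewrite inordK //; lia.
exists e => // a ha; have [p _ cp] := canonical_coord_surj zs2 (inord (k - i).+1) a.
have u := he p a cp ha; exists (glue_class U1 U2 (sew_rel i (toC r1) (toC r2)) (inr p)).
  by exists (inr p).
by apply/(chart2P i r1 hT1 hT2 r20); exists p.
Qed.

(** For the inclusion not covered by [sew_class_sub] the canonical spheres themselves are sewn, with
    identities as isomorphisms, and the equivalence with the third sphere is reversed. *)
Lemma sk_class_sew :
  sk_class (sk_std zs3) = sew_class i (sk_class (sk_std zs1)) (sk_class (sk_std zs2)).
Proof.
apply/funext => T; apply/propext; split; last exact: sew_class_sub.
move=> [hT eT]; split=> //.
have wS := wsurf_sew i r1 hT1 hT2 r20.
have [r [r' [rr1 rr2 rr3]]] := between r21.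
exists can1, can2, (toC r), (toC r1), (toC r2); split.
- by split=> //; exists id; split; [exact: superconformal_iso_id | exact: canonical_self].
- by split=> //; exists id; split; [exact: superconformal_iso_id | exact: canonical_self].
- by split=> //; rewrite -?[0 : C]toC0 toC_lt //; exact: lt_trans rr2 rr3.
- by split; [exact: tube_contains1 | exact: tube_contains2].
- apply: tubed_equiv_trans eT _.
  + by have [[/super_riemann_wsurf]] := hT.
  + exact: wsurf_sphere.
  + exact: wS.
  apply: tubed_equiv_sym.
  + exact: wS.
  + exact: wsurf_sphere.
  + exact: sew_std_punct.
  + exact: sew_std_ball.
  + exact: pinj_canonical.
  + exact: canonical_coord_carrier.
  + exact: (sew_equiv hT1 hT2 superconformal_iso_id superconformal_iso_id (canonical_self zs1)
      (canonical_self zs2) i_range r20 r21 tube_contains1 tube_contains2 z1 z2 z3).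
Qed.

End SewStandard.

Theorem proposition4p8 (R : realType) (z1 z2 t1 t2 : Gr R)
  (z1_even : geven z1) (z2_even : geven z2)
  (t1_odd : godd t1) (t2_odd : godd t2)
  (h12 : `|body z2| < `|body z1|)
  (h2 : `|body z1 - body z2| < `|body z2|)
  (h0 : 0 < `|body z1 - body z2|) :
  sk_class (@sk_std R 3 [tuple z1 + t1; z2 + t2]) =
    @sew_class R 2 2 1 (sk_class (@sk_std R 2 [tuple z2 + t2]))
      (sk_class (@sk_std R 2 [tuple (z1 - z2 - t1 * t2) + (t1 - t2)]))
  /\
  sk_class (@sk_std R 3 [tuple z1 + t1; z2 + t2]) =
    @sew_class R 2 2 2 (sk_class (@sk_std R 2 [tuple z1 + t1]))
      (sk_class (@sk_std R 2 [tuple z2 + t2])).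
Proof.
move: h12 h2 h0; rewrite !normCE -toC0 !toC_lt => h12 h2 h0.
have shE : (z1 - z2 - t1 * t2) + (t1 - t2) = sshift (z2 + t2) (z1 + t1).
  by rewrite /sshift !ev_add // !od_add.
have b1 : body (z1 + t1) = body z1 by rewrite -body_ev ev_add.
have b2 : body (z2 + t2) = body z2 by rewrite -body_ev ev_add.
have shift0 : sshift (z2 + t2) (z2 + t2) = 0 by exact: sshift_diag.
rewrite shE; move: (z1 + t1) (z2 + t2) b1 b2 shift0 => x1 x2 b1 b2 shift0.
have b3 : body (sshift x2 x1) = body z1 - body z2 by rewrite body_sshift b1 b2.
have n2 : 0 < nC (body z2) := lt_trans h0 h2.
have n1 : 0 < nC (body z1) := lt_trans n2 h12.
have two (x : Gr R) : 0 < nC (body x) -> forall j j' : 'I_2, j != j' ->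
    body (nth 0 [tuple x] j) != body (nth 0 [tuple x] j').
  rewrite nC_gt0 => x0 j j'; rewrite -val_eqE; case: j j' => [[|[|j]]] jj // [[|[|j']]] jj' //= _.
    by rewrite body0.
  by rewrite body0 eq_sym.
split.
  (* Here zeta is x2. The other finite puncture of the first sphere is 0, at distance |z2|; those of
     the second sphere are [sshift x2 x1] and 0, within |z1 - z2| of 0. The shift back by x2 sends
     them to x1 and x2. *)
  have [r2 [r1 [rr1 rr2 rr3]]] := between h2.
  apply: (@sk_class_sew R 2 2 1 [tuple x2] [tuple sshift x2 x1] [tuple x1; x2] _ _ _ _ r1 r2).
  - by [].
  - by move=> k k0 k1; exfalso; move: k0 k1; lia.
  - case=> [[|[|[|k]]]] kk k0 k3; [by exfalso | reflexivity | exact: esym shift0 | by exfalso].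
  - case=> [[|[|[|[|k]]]]] kk k3; [by exfalso | by exfalso | by exfalso | reflexivity | by exfalso].
  - exact: lt_trans h0 rr1.
  - exact: rr2.
  - by apply: two; rewrite b2.
  - by apply: two; rewrite b3.
  - case=> [[|[|j]]] jj // _; change (r1 < nC (body (0 : Gr R) - body x2)).
    by rewrite body0 sub0r nCN b2.
  - case=> [[|[|j]]] jj //.
      by change (nC (body (sshift x2 x1)) < r2); rewrite b3.
    change (nC (body (0 : Gr R)) < r2); rewrite body0 nC0; exact: lt_trans h0 rr1.
(* Here zeta is the last puncture 0, so nothing is shifted. The other finite puncture x1 of the
   first sphere has modulus |z1|, and those of the second sphere are x2 and 0. *)
have [r2 [r1 [rr1 rr2 rr3]]] := between h12.
apply: (@sk_class_sew R 2 2 2 [tuple x1] [tuple x2] [tuple x1; x2] _ _ _ _ r1 r2).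
- by [].
- case=> [[|[|k]]] kk k0 k2; [by exfalso | reflexivity | by exfalso].
- case=> [[|[|[|[|k]]]]] kk k2 k4; [by exfalso | by exfalso | exact: esym (sshift0 _)
    | exact: esym (sshift0 _) | by exfalso].
- case=> [[|[|[|[|k]]]]] kk k4; by exfalso.
- exact: lt_trans n2 rr1.
- exact: rr2.
- by apply: two; rewrite b1.
- by apply: two; rewrite b2.
- case=> [[|[|j]]] jj // _; change (r1 < nC (body x1 - body (0 : Gr R))).
  by rewrite body0 subr0 b1.
- case=> [[|[|j]]] jj //.
    by change (nC (body x2) < r2); rewrite b2.
  change (nC (body (0 : Gr R)) < r2); rewrite body0 nC0; exact: lt_trans n2 rr1.
Qed.
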